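(* Let $(\mathfrak b,H,\widehat\beta,\alpha,\beta,V)$ be a $C^*$-pseudo-multiplicative unitary. The category $\mathbf{C^*\text{-}rep}_V$ of representations of $V$ and morphisms carries the structure of a $C^*$-tensor category, and the category $\mathbf{C^*\text{-}rep}^s_V$ of representations of $V$ and semi-morphisms carries the structure of a tensor category, where in both cases (a) the tensor product is given by $(X,Y)\mapsto X\boxtimes Y$ for representations and $(S,T)\mapsto S\otimes T$ for morphisms; (b) the unit is the trivial representation $\mathbf 1_V$; (c) the associativity isomorphism $(X\boxtimes Y)\boxtimes Z\to X\boxtimes(Y\boxtimes Z)$ is the canonical associativity isomorphism of the relative tensor product of the underlying modules, for all representations $X,Y,Z$; (d) the unit isomorphisms $l_X\colon\mathbf 1_V\boxtimes X\to X$ and $r_X\colon X\boxtimes\mathbf 1_V\to X$ are the canonical unit isomorphisms $\mathfrak K\,{}_{\mathfrak B^\dagger}\otimes_\gamma K\to K$, $b^\dagger\otimes\zeta\otimes\eta\mapsto\eta b^\dagger\zeta$, and $K\,{}_{\widehat\delta}\otimes_{\mathfrak B}\mathfrak K\to K$, $\xi\otimes\zeta\otimes b\mapsto\xi b\zeta$, for each representation $({}_\gamma K_{\widehat\delta},X)$.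
   Context: General notions. $[Y]$ denotes the closed linear span of $Y$; products of sets of operators are elementwise. A $C^*$-tensor category is a $C^*$-category with a monoidal structure whose tensor product is bilinear and $*$-preserving on morphisms and whose associativity and unit isomorphisms are unitary; a tensor category is a monoidal category. A $C^*$-base is a triple $\mathfrak b=(\mathfrak K,\mathfrak B,\mathfrak B^\dagger)$ of a Hilbert space and two commuting nondegenerate $C^*$-algebras $\mathfrak B,\mathfrak B^\dagger\subseteq\mathcal L(\mathfrak K)$; $\mathfrak b^\dagger=(\mathfrak K,\mathfrak B^\dagger,\mathfrak B)$. A $C^*$-$\mathfrak b$-module $H_\alpha=(H,\alpha)$ is a Hilbert space $H$ with a closed subspace $\alpha\subseteq\mathcal L(\mathfrak K,H)$ such that $[\alpha\mathfrak K]=H$, $[\alpha\mathfrak B]=\alpha$, $[\alpha^*\alpha]=\mathfrak B$; it carries the representation $\rho_\alpha\colon\mathfrak B^\dagger\to\mathcal L(H)$, $\rho_\alpha(b^\dagger)\xi\zeta=\xi b^\dagger\zeta$ ($\xi\in\alpha,\zeta\in\mathfrak K$). For $C^*$-$\mathfrak b^\dagger$-modules the roles of $\mathfrak B,\mathfrak B^\dagger$ are swapped. A semi-morphism $H_\alpha\to K_\beta$ is $T\in\mathcal L(H,K)$ with $T\alpha\subseteq\beta$; a morphism additionally satisfies $T^*\beta\subseteq\alpha$. A $C^*$-$(\mathfrak b_1,\dots,\mathfrak b_n)$-module is $(H,\alpha_1,\dots,\alpha_n)$ with each $(H,\alpha_i)$ a $C^*$-$\mathfrak b_i$-module and $[\rho_{\alpha_i}(\mathfrak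 B_i^\dagger)\alpha_j]=\alpha_j$ for $i\neq j$; (semi-)morphisms are operators that are (semi-)morphisms for every component. ${}_\alpha H_\beta:=(H,\alpha,\beta)$. Relative tensor product. For a $C^*$-$\mathfrak b$-module $H_\beta$ and a $C^*$-$\mathfrak b^\dagger$-module $K_\gamma$, $H\,{}_\beta\otimes_\gamma K$ (base suppressed; same definition with $\mathfrak b,\mathfrak b^\dagger$ interchanged) is the Hilbert space generated by elements $\xi\otimes\zeta\otimes\eta$ ($\xi\in\beta,\zeta\in\mathfrak K,\eta\in\gamma$) with $\langle\xi\otimes\zeta\otimes\eta|\xi'\otimes\zeta'\otimes\eta'\rangle=\langle\zeta|\xi^*\xi'\eta^*\eta'\zeta'\rangle$. $|\xi\rangle_1\colon K\to H\,{}_\beta\otimes_\gamma K$, $|\eta\rangle_2\colon H\to H\,{}_\beta\otimes_\gamma K$ are given by $|\xi\rangle_1\eta\zeta=\xi\otimes\zeta\otimes\eta=|\eta\rangle_2\xi\zeta$; $|\beta\rangle_1=\{|\xi\rangle_1:\xi\in\beta\}$ etc. For further module structures $\alpha$ on $H$, $\delta$ on $K$: $\alpha\triangleleft\gamma=[|\gamma\rangle_2\alpha]$, $\beta\triangleright\delta=[|\beta\rangle_1\delta]$, module structures on $H\,{}_\beta\otimes_\gamma K$; the relative tensor product of ${}_\alpha H_\beta$ and ${}_\gamma K_\delta$ is $(H\,{}_\beta\otimes_\gamma K,\alpha\triangleleft\gamma,\beta\triangleright\delta)$. $S\otimes\mathrm{id}$, $\mathrm{id}\otimes T$ are determined by $(S\otimes\mathrm{id})|\eta\rangle_2=|\eta\rangle_2S$,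 $(\mathrm{id}\otimes T)|\xi\rangle_1=|\xi\rangle_1T$ for $S,T$ intertwining the representations $\rho_\beta$ resp. $\rho_\gamma$; for semi-morphisms $S,T$, $(S\otimes T)(\xi\otimes\zeta\otimes\eta)=S\xi\otimes\zeta\otimes T\eta$. Iterated products are identified by associativity: $(H\,{}_\beta\otimes_\gamma K)\,{}_{\beta\triangleright\epsilon}\otimes_\phi L\cong H\,{}_\beta\otimes_{\gamma\triangleleft\phi}(K\,{}_\epsilon\otimes_\phi L)$. $\Sigma$ is the flip. $C^*$-pseudo-multiplicative unitary: a tuple $(\mathfrak b,H,\widehat\beta,\alpha,\beta,V)$ with $\mathfrak b$ a $C^*$-base, $(H,\widehat\beta,\alpha,\beta)$ a $C^*$-$(\mathfrak b^\dagger,\mathfrak b,\mathfrak b^\dagger)$-module and $V\colon H\,{}_{\widehat\beta}\otimes_\alpha H\to H\,{}_\alpha\otimes_\beta H$ a unitary with $V(\alpha\triangleleft\alpha)=\alpha\triangleright\alpha$, $V(\widehat\beta\triangleright\beta)=\widehat\beta\triangleleft\beta$, $V(\widehat\beta\triangleright\widehat\beta)=\alpha\triangleright\widehat\beta$, $V(\beta\triangleleft\alpha)=\beta\triangleleft\beta$ and $V_{23}V_{12}=V_{12}V_{13}V_{23}$ as operators $H\,{}_{\widehat\beta}\otimes_\alpha H\,{}_{\widehat\beta}\otimes_\alpha H\to H\,{}_\alpha\otimes_\beta H\,{}_\alpha\otimes_\beta H$, where $V_{12}=V\otimes\mathrm{id}$, $V_{23}=\mathrm{id}\otimes V$, and $V_{13}\colon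 H\,{}_{\widehat\beta}\otimes_{\alpha\triangleright\alpha}(H\,{}_\alpha\otimes_\beta H)\to(H\,{}_{\widehat\beta}\otimes_\alpha H)\,{}_{\alpha\triangleleft\alpha}\otimes_\beta H$ is $\Sigma_{23}(V\otimes\mathrm{id})(\mathrm{id}\otimes\Sigma)$ with $\Sigma_{23}$ exchanging the last two factors (from $(H\,{}_\alpha\otimes_\beta H)\,{}_{\widehat\beta\triangleleft\beta}\otimes_\alpha H$). Representations. A representation of $V$ is a $C^*$-$(\mathfrak b,\mathfrak b^\dagger)$-module ${}_\gamma K_{\widehat\delta}$ with a unitary $X\colon K\,{}_{\widehat\delta}\otimes_\alpha H\to K\,{}_\gamma\otimes_\beta H$ such that $X(\gamma\triangleleft\alpha)=\gamma\triangleright\alpha$, $X(\widehat\delta\triangleright\beta)=\widehat\delta\triangleleft\beta$, $X(\widehat\delta\triangleright\widehat\beta)=\gamma\triangleright\widehat\beta$ and $V_{23}X_{12}=X_{12}X_{13}V_{23}$ as operators $K\,{}_{\widehat\delta}\otimes_\alpha H\,{}_{\widehat\beta}\otimes_\alpha H\to K\,{}_\gamma\otimes_\beta H\,{}_\alpha\otimes_\beta H$, where $X_{12}=X\otimes\mathrm{id}$ and $X_{13}\colon K\,{}_{\widehat\delta}\otimes_{\alpha\triangleright\alpha}(H\,{}_\alpha\otimes_\beta H)\to(K\,{}_{\widehat\delta}\otimes_\alpha H)\,{}_{\gamma\triangleleft\alpha}\otimes_\beta H$ acts as $X$ on the first and third factor. A (semi-)morphism $({}_\gamma K_{\widehat\delta},X)\to({}_\epsilon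 L_{\widehat\phi},Y)$ is a (semi-)morphism $T$ of the modules with $Y(T\otimes\mathrm{id})=(T\otimes\mathrm{id})X$. The trivial representation $\mathbf 1_V$ is $({}_{\mathfrak B}\mathfrak K_{\mathfrak B^\dagger},\Psi^*\Phi)$ with $\Phi\colon\mathfrak K\,{}_{\mathfrak B^\dagger}\otimes_\alpha H\to H$, $|b^\dagger\rangle_1\zeta\mapsto\rho_\alpha(b^\dagger)\zeta$ and $\Psi\colon\mathfrak K\,{}_{\mathfrak B}\otimes_\beta H\to H$, $|b\rangle_1\zeta\mapsto\rho_\beta(b)\zeta$. For representations $({}_\gamma K_{\widehat\delta},X)$, $({}_\epsilon L_{\widehat\phi},Y)$, $X\boxtimes Y$ is the representation on $(K\,{}_{\widehat\delta}\otimes_\epsilon L,\gamma\triangleleft\epsilon,\widehat\delta\triangleright\widehat\phi)$ given by the composition $K\,{}_{\widehat\delta}\otimes_\epsilon L\,{}_{\widehat\phi}\otimes_\alpha H\xrightarrow{\mathrm{id}\otimes Y}K\,{}_{\widehat\delta}\otimes_{\epsilon\triangleright\alpha}(L\,{}_\epsilon\otimes_\beta H)\xrightarrow{X_{13}}(K\,{}_{\widehat\delta}\otimes_\epsilon L)\,{}_{\gamma\triangleleft\epsilon}\otimes_\beta H$, where $X_{13}$ acts like $X$ on the first and last factor. *)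

(* Defs.v *)
From HB Require Import structures.
From mathcomp Require Import all_boot all_order all_algebra.
From mathcomp Require Import complex.
From mathcomp Require Import all_classical all_reals topology normedtype.

Set Implicit Arguments.
Unset Strict Implicit.
Unset Printing Implicit Defensive.

Import Order.TTheory GRing.Theory Num.Theory.
Import numFieldNormedType.Exports.

Local Open Scope classical_set_scope.
Local Open Scope ring_scope.
Local Open Scope complex_scope.

HB.mixin Record CompleteNormedModule_isHilbert (R : realType) H
    of CompleteNormedModule R[i] H := {
  inner : H -> H -> R[i] ;
  inner_linear : forall x, linear_for *%R (inner x) ;
  inner_conj : forall x y, inner y x = (inner x y)^* ;
  inner_norm : forall x, inner x x = `|x| ^+ 2
}.

#[short(type="hilbertType")]
HB.structure Definition Hilbert (R : realType) :=
  {H of CompleteNormedModule R[i] H & CompleteNormedModule_isHilbert R H}.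

Section BoundedOperators.
Variables (R : realType) (H K : hilbertType R).

Definition bounded_linear : {pred H -> K} :=
  [pred f | `[< linear f /\ continuous f >]].

Record bop := Bop { bop_fun :> H -> K ; _ : bop_fun \in bounded_linear }.

HB.instance Definition _ := [isSub for bop_fun].
HB.instance Definition _ := gen_eqMixin bop.
HB.instance Definition _ := gen_choiceMixin bop.

Lemma bounded_linear_submod : submod_closed bounded_linear.
Proof.
split=> [|a f g].
  apply/asboolP; split; last exact: cst_continuous.
  by move=> a x y; rewrite /= scaler0 addr0.
move=> /asboolP[lf cf] /asboolP[lg cg]; apply/asboolP; split.
  move=> b x y /=; rewrite !fctE lf lg !scalerDr !scalerA (mulrC b).
  by rewrite addrACA.
move=> x; apply: continuousD; last exact: cg.
by apply: continuousZr; exact: cf.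
Qed.

HB.instance Definition _ :=
  GRing.isSubmodClosed.Build R[i] (H -> K) bounded_linear
   bounded_linear_submod.
HB.instance Definition _ := [SubChoice_isSubLmodule of bop by <:].

End BoundedOperators.

Section OperatorNorm.
Variables (R : realType) (H K : hilbertType R).
Implicit Types S T : bop H K.

Lemma bop_linear T : linear T.
Proof. by case: T => f /= /asboolP[]. Qed.

Lemma bop_continuous T : continuous T.
Proof. by case: T => f /= /asboolP[]. Qed.

Definition op_bounds T : set R :=
  [set M | 0 <= M /\ forall x, `|T x| <= M%:C * `|x|].

Definition opnorm T : R[i] := (inf (op_bounds T))%:C.

Lemma op_bounds_has_inf T : has_inf (op_bounds T).
Proof.
split; last by exists 0 => M [].
pose Tl : {linear H -> K} :=
  HB.pack (T : H -> K) (GRing.isLinear.Build _ _ _ _ _ (@bop_linear T)).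
have Tc : continuous Tl := @bop_continuous T.
have /linear_boundedP/pinfty_ex_gt0[r r0 rP] :=
  (linear_bounded_continuous Tl).2 Tc.
have rE : r = (complex.Re r)%:C.
  by move: r0; case: (r) => a b; rewrite ltcE /= => /andP[/eqP-> _].
exists (complex.Re r); split; last by rewrite -rE.
by move: r0; rewrite rE ltcR => /ltW.
Qed.

Lemma opnorm_ge T x : `|T x| <= opnorm T * `|x|.
Proof.
have nE (V : hilbertType R) (v : V) : `|v| = (complex.Re `|v|)%:C.
  by have := normr_ge0 v; case: `|v| => a b; rewrite lecE /= => /andP[/eqP-> _].
have := normr_ge0 x; rewrite le_eqVlt => /predU1P[x0|x0].
  have {}x0 : x = 0 by apply/normr0_eq0.
  have -> : T x = 0 by rewrite x0; have := @bop_linear T (-1) 0 0;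
    rewrite !scaleN1r oppr0 addr0 addNr.
  by rewrite x0 !normr0 mulr0.
rewrite /opnorm (nE _ (T x)) (nE _ x) -rmorphM lecR.
move: x0; rewrite nE ltcR => x0.
rewrite -ler_pdivrMr//; apply: lb_le_inf; first by case: (op_bounds_has_inf T).
by move=> M [M0 /(_ x)]; rewrite (nE _ (T x)) (nE _ x) -rmorphM lecR ler_pdivrMr.
Qed.

Lemma opnorm_le T (M : R) : 0 <= M -> (forall x, `|T x| <= M%:C * `|x|) ->
  opnorm T <= M%:C.
Proof.
move=> M0 TM; rewrite lecR; apply: ge_inf; last by split.
by case: (op_bounds_has_inf T).
Qed.

Lemma inf_op_bounds_ge0 T : 0 <= inf (op_bounds T).
Proof. by apply: lb_le_inf; [case: (op_bounds_has_inf T)|move=> M []]. Qed.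

Lemma opnormD S T : opnorm (S + T) <= opnorm S + opnorm T.
Proof.
rewrite /opnorm -rmorphD; apply: opnorm_le.
  by rewrite addr_ge0// inf_op_bounds_ge0.
move=> x; rewrite (le_trans (ler_normD _ _))// rmorphD mulrDl.
by rewrite lerD//; exact: opnorm_ge.
Qed.

Lemma opnormZ_le (a : R[i]) T : opnorm (a *: T) <= `|a| * opnorm T.
Proof.
have -> : `|a| = (complex.Re `|a|)%:C by case: a => u v.
rewrite /opnorm -rmorphM; apply: opnorm_le.
  by rewrite mulr_ge0// ?inf_op_bounds_ge0//; case: (a) => u v; exact: sqrtr_ge0.
move=> x; rewrite [(a *: T) x]/(a *: T x) normrZ rmorphM -mulrA.
by apply: ler_wpM2l; [|exact: opnorm_ge].
Qed.

Lemma opnorm0_eq0 T : opnorm T = 0 -> T = 0.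
Proof.
move=> T0; apply/val_inj/funext => x; apply/normr0_eq0/le_anti.
by rewrite normr_ge0 andbT (le_trans (opnorm_ge T x))// T0 mul0r.
Qed.

Lemma opnormZ (a : R[i]) T : opnorm (a *: T) = `|a| * opnorm T.
Proof.
apply/le_anti; rewrite opnormZ_le /=.
have [->|a0] := eqVneq a 0.
  by rewrite normr0 mul0r lecR inf_op_bounds_ge0.
rewrite -ler_pdivlMl ?normr_gt0// -normfV.
by rewrite (le_trans _ (opnormZ_le _ _))// scalerA mulVf// scale1r.
Qed.

HB.instance Definition _ :=
  @Lmodule_isNormed.Build R[i] (bop H K) opnorm opnormD opnormZ opnorm0_eq0.

End OperatorNorm.

Reserved Notation "S \ob T" (at level 50, left associativity).

Section Operations.
Variable R : realType.
Implicit Types E H K L : hilbertType R.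

Lemma idop_subproof H : (idfun : H -> H) \in @bounded_linear R H H.
Proof. by apply/asboolP; split=> // x; exact: cvg_id. Qed.

Definition idop H : bop H H := Bop (idop_subproof H).

Lemma compop_subproof H K L (S : bop K L) (T : bop H K) :
  (fun x => S (T x)) \in @bounded_linear R H L.
Proof.
apply/asboolP; split=> [a x y|x]; first by rewrite !bop_linear.
by apply: continuous_comp; exact: bop_continuous.
Qed.

Definition compop H K L (S : bop K L) (T : bop H K) : bop H L :=
  Bop (compop_subproof S T).
Local Notation "S \ob T" := (compop S T).

(* Adjoints, and below all operators that are determined by their values on a
   total set of vectors, are obtained from choice: xget 0 P is the element
   characterized by P, and 0 if there is none. *)
Definition adj H K (T : bop H K) : bop K H :=
  xget 0 [set S : bop K H | forall x y, inner (T x) y = inner x (S y)].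

Definition unitary_op H K (T : bop H K) : Prop :=
  adj T \ob T = idop H /\ T \ob adj T = idop K.

Definition linspan (V : lmodType R[i]) (A : set V) : set V :=
  [set x | exists n (c : 'I_n -> R[i]) (a : 'I_n -> V),
     (forall i, A (a i)) /\ x = \sum_i c i *: a i].

Definition clspan (V : normedModType R[i]) (A : set V) : set V :=
  closure (linspan A).

Definition closed_subspace (V : normedModType R[i]) (A : set V) : Prop :=
  submod_closed [in A] /\ closed A.

Definition opprod H K L (A : set (bop K L)) (B : set (bop H K)) :
  set (bop H L) := [set S \ob T | S in A & T in B].

Definition opimage H K L (S : bop K L) (A : set (bop H K)) : set (bop H L) :=
  [set S \ob T | T in A].

Definition vecprod H K (A : set (bop H K)) : set K :=
  [set T x | T in A & x in [set: H]].

Definition nondegenerate_cstar_algebra H (B : set (bop H H)) : Prop :=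
  [/\ closed_subspace B,
      forall S T, B S -> B T -> B (S \ob T),
      forall T, B T -> B (adj T)
    & clspan (vecprod B) = setT].

Record cstar_base := CstarBase {
  bK : hilbertType R ;
  bB : set (bop bK bK) ;
  bBd : set (bop bK bK) ;
  bB_cstar : nondegenerate_cstar_algebra bB ;
  bBd_cstar : nondegenerate_cstar_algebra bBd ;
  b_commute : forall S T, bB S -> bBd T -> S \ob T = T \ob S
}.
Arguments bB : clear implicits.
Arguments bBd : clear implicits.

Definition base_dag (b : cstar_base) : cstar_base :=
  CstarBase (bBd_cstar b) (bB_cstar b)
    (fun S T BS BT => esym (b_commute BT BS)).

Definition is_cmodule (b : cstar_base) H (alpha : set (bop (bK b) H)) : Prop :=
  [/\ closed_subspace alpha,
      clspan (vecprod alpha) = setT,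
      clspan (opprod alpha (bB b)) = alpha
    & clspan (opprod (@adj _ _ @` alpha) alpha) = bB b].
Arguments is_cmodule : clear implicits.

Definition rho E H (alpha : set (bop E H)) (T : bop E E) : bop H H :=
  xget 0 [set S : bop H H |
    forall xi, alpha xi -> forall z, S (xi z) = xi (T z)].

Definition rho_stable (b c : cstar_base) H (alpha : set (bop (bK b) H))
    (beta : set (bop (bK c) H)) : Prop :=
  clspan (opprod (rho alpha @` bBd b) beta) = beta.
Arguments rho_stable : clear implicits.

Definition is_cmodule2 (b1 b2 : cstar_base) H
    (a1 : set (bop (bK b1) H)) (a2 : set (bop (bK b2) H)) : Prop :=
  [/\ is_cmodule b1 H a1, is_cmodule b2 H a2,
      rho_stable b1 b2 H a1 a2 & rho_stable b2 b1 H a2 a1].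
Arguments is_cmodule2 : clear implicits.

Definition is_cmodule3 (b1 b2 b3 : cstar_base) H (a1 : set (bop (bK b1) H))
    (a2 : set (bop (bK b2) H)) (a3 : set (bop (bK b3) H)) : Prop :=
  [/\ is_cmodule2 b1 b2 H a1 a2, is_cmodule2 b1 b3 H a1 a3
    & is_cmodule2 b2 b3 H a2 a3].
Arguments is_cmodule3 : clear implicits.

Definition semimorphism E H K (alpha : set (bop E H)) (beta : set (bop E K))
    (T : bop H K) : Prop :=
  opimage T alpha `<=` beta.

Definition morphism E H K (alpha : set (bop E H)) (beta : set (bop E K))
    (T : bop H K) : Prop :=
  semimorphism alpha beta T /\ semimorphism beta alpha (adj T).

Section RelativeTensorProduct.
Variables (E H K : hilbertType R) (beta : set (bop E H)) (gamma : set (bop E K)).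

Record rtp_data := RtpData {
  rtp_space : hilbertType R ;
  rtp_elt : bop E H -> E -> bop E K -> rtp_space
}.

Definition is_rtp (D : rtp_data) : Prop :=
  (forall xi z eta xi' z' eta', beta xi -> beta xi' -> gamma eta -> gamma eta' ->
     inner (rtp_elt D xi z eta) (rtp_elt D xi' z' eta') =
     inner z ((adj xi \ob xi' \ob adj eta \ob eta') z')) /\
  clspan [set x | exists xi z eta,
    [/\ beta xi, gamma eta & x = rtp_elt D xi z eta]] = setT.

(* These properties determine the relative tensor product up to a unique
   unitary; rtp_pick is one fixed choice. *)
Definition rtp_pick : rtp_data :=
  if pselect (exists D, is_rtp D) is left e then projT1 (cid e)
  else @RtpData H (fun _ _ _ => 0).

Definition rtp : hilbertType R := rtp_space rtp_pick.

Definition tens (xi : bop E H) (z : E) (eta : bop E K) : rtp :=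
  rtp_elt rtp_pick xi z eta.

Definition ket1 (xi : bop E H) : bop K rtp :=
  xget 0 [set T : bop K rtp |
    forall eta, gamma eta -> forall z, T (eta z) = tens xi z eta].

Definition ket2 (eta : bop E K) : bop H rtp :=
  xget 0 [set T : bop H rtp |
    forall xi, beta xi -> forall z, T (xi z) = tens xi z eta].

(* On the product of (H, beta) and (K, gamma): [ltri alpha] is the structure
   obtained from alpha on H (usually written alpha <| gamma), [rtri delta] the
   one obtained from delta on K (beta |> delta). *)
Definition ltri E' (alpha : set (bop E' H)) : set (bop E' rtp) :=
  clspan (opprod (ket2 @` gamma) alpha).

Definition rtri E' (delta : set (bop E' K)) : set (bop E' rtp) :=
  clspan (opprod (ket1 @` beta) delta).

End RelativeTensorProduct.
Arguments ltri {E H K} beta gamma {E'} alpha _.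
Arguments rtri {E H K} beta gamma {E'} delta _.

Definition tens_l E H H' K (beta : set (bop E H)) (gamma : set (bop E K))
    (beta' : set (bop E H')) (S : bop H H') :
    bop (rtp beta gamma) (rtp beta' gamma) :=
  xget 0 [set T : bop (rtp beta gamma) (rtp beta' gamma) |
    forall eta, gamma eta ->
      T \ob ket2 beta gamma eta = ket2 beta' gamma eta \ob S].

Definition tens_r E H K K' (beta : set (bop E H)) (gamma : set (bop E K))
    (gamma' : set (bop E K')) (T : bop K K') :
    bop (rtp beta gamma) (rtp beta gamma') :=
  xget 0 [set U : bop (rtp beta gamma) (rtp beta gamma') |
    forall xi, beta xi ->
      U \ob ket1 beta gamma xi = ket1 beta gamma' xi \ob T].

Definition tens_op E H H' K K' (beta : set (bop E H)) (gamma : set (bop E K))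
    (beta' : set (bop E H')) (gamma' : set (bop E K'))
    (S : bop H H') (T : bop K K') : bop (rtp beta gamma) (rtp beta' gamma') :=
  xget 0 [set U : bop (rtp beta gamma) (rtp beta' gamma') |
    forall xi z eta, beta xi -> gamma eta ->
      U (tens beta gamma xi z eta) =
      tens beta' gamma' (S \ob xi) z (T \ob eta)].

Definition flip E H K (beta : set (bop E H)) (gamma : set (bop E K)) :
    bop (rtp beta gamma) (rtp gamma beta) :=
  xget 0 [set S : bop (rtp beta gamma) (rtp gamma beta) |
    forall xi z eta, beta xi -> gamma eta ->
      S (tens beta gamma xi z eta) = tens gamma beta eta z xi].

(* (H beta (x) gamma K) (x) phi L -> H beta (x) (K eps (x) phi L) *)
Definition assoc E H K L (beta : set (bop E H)) (gamma eps : set (bop E K))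
    (phi : set (bop E L)) :
    bop (rtp (rtri beta gamma eps) phi) (rtp beta (ltri eps phi gamma)) :=
  xget 0 [set A : bop (rtp (rtri beta gamma eps) phi)
                      (rtp beta (ltri eps phi gamma)) |
    forall xi chi, beta xi -> phi chi ->
      A \ob (ket2 (rtri beta gamma eps) phi chi \ob ket1 beta gamma xi) =
      ket1 beta (ltri eps phi gamma) xi \ob ket2 eps phi chi].

(* (H beta1 (x) gamma1 K) (x) gamma2 L -> (H beta2 (x) gamma2 L) (x) gamma1 K,
   the exchange of the last two factors. *)
Definition flip23 E H K L (beta1 : set (bop E H)) (gamma1 : set (bop E K))
    (beta2 : set (bop E H)) (gamma2 : set (bop E L)) :
    bop (rtp (ltri beta1 gamma1 beta2) gamma2)
        (rtp (ltri beta2 gamma2 beta1) gamma1) :=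
  xget 0 [set S : bop (rtp (ltri beta1 gamma1 beta2) gamma2)
                      (rtp (ltri beta2 gamma2 beta1) gamma1) |
    forall eta chi, gamma1 eta -> gamma2 chi ->
      S \ob (ket2 (ltri beta1 gamma1 beta2) gamma2 chi \ob
             ket2 beta1 gamma1 eta) =
      ket2 (ltri beta2 gamma2 beta1) gamma1 eta \ob ket2 beta2 gamma2 chi].

(* X acting on the first and third factor of K hdelta (x) (L eps (x) beta H):
   flip L and H, reassociate, apply X (x) id, and flip back. *)
Definition leg13 E K L H (hdelta gamma : set (bop E K)) (eps : set (bop E L))
    (alpha beta : set (bop E H)) (X : bop (rtp hdelta alpha) (rtp gamma beta)) :
    bop (rtp hdelta (rtri eps beta alpha)) (rtp (ltri hdelta eps gamma) beta) :=
  flip23 gamma beta hdelta eps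
  \ob tens_l (rtri hdelta alpha beta) eps (ltri gamma beta hdelta) X
  \ob adj (assoc hdelta alpha beta eps)
  \ob tens_r hdelta (rtri eps beta alpha) (ltri beta eps alpha) (flip eps beta).

(* V_23 X_12 = X_12 X_13 V_23, with the associativity isomorphisms that the
   usual notation suppresses. *)
Definition pentagon_eq E K H (hdelta gamma : set (bop E K))
    (hbeta alpha beta : set (bop E H))
    (X : bop (rtp hdelta alpha) (rtp gamma beta))
    (V : bop (rtp hbeta alpha) (rtp alpha beta)) : Prop :=
  tens_r gamma (ltri hbeta alpha beta) (ltri alpha beta beta) V
  \ob assoc gamma beta hbeta alpha
  \ob tens_l (rtri hdelta alpha hbeta) alpha (rtri gamma beta hbeta) X
  = assoc gamma beta alpha beta
    \ob tens_l (ltri hdelta alpha gamma) beta (rtri gamma beta alpha) X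
    \ob leg13 alpha X
    \ob tens_r hdelta (ltri hbeta alpha alpha) (rtri alpha beta alpha) V
    \ob assoc hdelta alpha hbeta alpha.

Record cpmu := Cpmu {
  mb : cstar_base ;
  mH : hilbertType R ;
  mhbeta : set (bop (bK mb) mH) ;
  malpha : set (bop (bK mb) mH) ;
  mbeta : set (bop (bK mb) mH) ;
  mV : bop (rtp mhbeta malpha) (rtp malpha mbeta) ;
  m_module : is_cmodule3 (base_dag mb) mb (base_dag mb) mH mhbeta malpha mbeta ;
  mV_unitary : unitary_op mV ;
  mV_alpha_alpha :
    opimage mV (ltri mhbeta malpha malpha) = rtri malpha mbeta malpha ;
  mV_hbeta_beta :
    opimage mV (rtri mhbeta malpha mbeta) = ltri malpha mbeta mhbeta ;
  mV_hbeta_hbeta :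
    opimage mV (rtri mhbeta malpha mhbeta) = rtri malpha mbeta mhbeta ;
  mV_beta_alpha :
    opimage mV (ltri mhbeta malpha mbeta) = ltri malpha mbeta mbeta ;
  mV_pentagon : pentagon_eq mV mV
}.
Arguments mhbeta : clear implicits.
Arguments malpha : clear implicits.
Arguments mbeta : clear implicits.

Section Representations.
Variable M : cpmu.
Let b := mb M.
Let E := bK b.
Let alpha := malpha M.
Let beta := mbeta M.
Let hbeta := mhbeta M.

Record rep_data := RepData {
  rK : hilbertType R ;
  rgamma : set (bop E rK) ;
  rhdelta : set (bop E rK) ;
  rX : bop (rtp rhdelta alpha) (rtp rgamma beta)
}.
Arguments rgamma : clear implicits.
Arguments rhdelta : clear implicits.

Record is_rep (Y : rep_data) : Prop := IsRep {
  r_module : is_cmodule2 b (base_dag b) (rK Y) (rgamma Y) (rhdelta Y) ;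
  rX_unitary : unitary_op (rX Y) ;
  rX_gamma_alpha :
    opimage (rX Y) (ltri (rhdelta Y) alpha (rgamma Y)) =
    rtri (rgamma Y) beta alpha ;
  rX_hdelta_beta :
    opimage (rX Y) (rtri (rhdelta Y) alpha beta) =
    ltri (rgamma Y) beta (rhdelta Y) ;
  rX_hdelta_hbeta :
    opimage (rX Y) (rtri (rhdelta Y) alpha hbeta) =
    rtri (rgamma Y) beta hbeta ;
  rX_pentagon : pentagon_eq (rX Y) (mV M)
}.

Definition intertwiner (X Y : rep_data) (T : bop (rK X) (rK Y)) : Prop :=
  rX Y \ob tens_l (rhdelta X) alpha (rhdelta Y) T =
  tens_l (rgamma X) beta (rgamma Y) T \ob rX X.

Definition rep_semimorphism (X Y : rep_data) : set (bop (rK X) (rK Y)) :=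
  [set T | [/\ semimorphism (rgamma X) (rgamma Y) T,
               semimorphism (rhdelta X) (rhdelta Y) T
             & intertwiner T]].

Arguments rep_semimorphism : clear implicits.

Definition rep_morphism (X Y : rep_data) : set (bop (rK X) (rK Y)) :=
  [set T | [/\ morphism (rgamma X) (rgamma Y) T,
               morphism (rhdelta X) (rhdelta Y) T
             & intertwiner T]].
Arguments rep_morphism : clear implicits.

Definition triv_Phi : bop (rtp (bBd b) alpha) (mH M) :=
  xget 0 [set T : bop (rtp (bBd b) alpha) (mH M) |
    forall c, bBd b c -> T \ob ket1 (bBd b) alpha c = rho alpha c].

Definition triv_Psi : bop (rtp (bB b) beta) (mH M) :=
  xget 0 [set T : bop (rtp (bB b) beta) (mH M) |
    forall c, bB b c -> T \ob ket1 (bB b) beta c = rho beta c].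

Definition triv_rep : rep_data :=
  @RepData E (bB b) (bBd b) (adj triv_Psi \ob triv_Phi).

Definition box (X Y : rep_data) : rep_data :=
  @RepData (rtp (rhdelta X) (rgamma Y))
    (ltri (rhdelta X) (rgamma Y) (rgamma X))
    (rtri (rhdelta X) (rgamma Y) (rhdelta Y))
    (leg13 (rgamma Y) (rX X)
     \ob tens_r (rhdelta X) (ltri (rhdelta Y) alpha (rgamma Y))
           (rtri (rgamma Y) beta alpha) (rX Y)
     \ob assoc (rhdelta X) (rgamma Y) (rhdelta Y) alpha).

Definition box_op (X X' Y Y' : rep_data)
    (S : bop (rK X) (rK X')) (T : bop (rK Y) (rK Y')) :
    bop (rK (box X Y)) (rK (box X' Y')) :=
  tens_op (rhdelta X) (rgamma Y) (rhdelta X') (rgamma Y') S T.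

Definition box_assoc (X Y Z : rep_data) :
    bop (rK (box (box X Y) Z)) (rK (box X (box Y Z))) :=
  assoc (rhdelta X) (rgamma Y) (rhdelta Y) (rgamma Z).

Definition box_unit_l (X : rep_data) : bop (rK (box triv_rep X)) (rK X) :=
  xget 0 [set U : bop (rtp (bBd b) (rgamma X)) (rK X) |
    forall c z eta, bBd b c -> rgamma X eta ->
      U (tens (bBd b) (rgamma X) c z eta) = eta (c z)].

Definition box_unit_r (X : rep_data) : bop (rK (box X triv_rep)) (rK X) :=
  xget 0 [set U : bop (rtp (rhdelta X) (bB b)) (rK X) |
    forall xi z c, rhdelta X xi -> bB b c ->
      U (tens (rhdelta X) (bB b) xi z c) = xi (c z)].

End Representations.

End Operations.

Notation "S \ob T" := (compop S T) : ring_scope.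
Arguments bB {R} c : rename.
Arguments bBd {R} c : rename.
Arguments is_cmodule {R} b H alpha.
Arguments rho_stable {R} b c H alpha beta.
Arguments is_cmodule2 {R} b1 b2 H a1 a2.
Arguments is_cmodule3 {R} b1 b2 b3 H a1 a2 a3.
Arguments ltri {R E H K} beta gamma {E'} alpha _.
Arguments rtri {R E H K} beta gamma {E'} delta _.
Arguments mhbeta {R} M _ : rename.
Arguments malpha {R} M _ : rename.
Arguments mbeta {R} M _ : rename.
Arguments rgamma {R M} Y _ : rename.
Arguments rhdelta {R M} Y _ : rename.
Arguments rep_semimorphism {R M} X Y _.
Arguments rep_morphism {R M} X Y _.

(* Categories are presented by subsets: [isob] singles out the objects in the
   type [ob], and [hom X Y] the morphisms in the type [arr X Y], on which the
   operations are defined. All axioms concern objects and morphisms only. *)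
Record cat_data := CatData {
  ob : Type ;
  isob : ob -> Prop ;
  arr : ob -> ob -> Type ;
  hom : forall X Y, set (arr X Y) ;
  idm : forall X, arr X X ;
  cmp : forall X Y Z, arr Y Z -> arr X Y -> arr X Z
}.
Arguments isob : clear implicits.
Arguments hom : clear implicits.
Arguments idm : clear implicits.
Arguments cmp {c X Y Z}.

Record is_category (C : cat_data) : Prop := IsCategory {
  idm_hom : forall X, isob C X -> hom C X X (idm C X) ;
  cmp_hom : forall X Y Z f g, isob C X -> isob C Y -> isob C Z ->
    hom C X Y f -> hom C Y Z g -> hom C X Z (cmp g f) ;
  cmp_idl : forall X Y f, isob C X -> isob C Y -> hom C X Y f ->
    cmp (idm C Y) f = f ;
  cmp_idr : forall X Y f, isob C X -> isob C Y -> hom C X Y f ->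
    cmp f (idm C X) = f ;
  cmpA : forall W X Y Z f g h,
    isob C W -> isob C X -> isob C Y -> isob C Z ->
    hom C W X f -> hom C X Y g -> hom C Y Z h ->
    cmp h (cmp g f) = cmp (cmp h g) f
}.

Definition is_iso (C : cat_data) X Y (f : arr X Y) : Prop :=
  hom C X Y f /\ exists2 g, hom C Y X g &
    cmp g f = idm C X /\ cmp f g = idm C Y.
Arguments is_iso : clear implicits.

Record tensor_data (C : cat_data) := TensorData {
  tob : ob C -> ob C -> ob C ;
  tarr : forall X X' Y Y' : ob C,
    arr X X' -> arr Y Y' -> arr (tob X Y) (tob X' Y') ;
  tunit : ob C ;
  tassoc : forall X Y Z, arr (tob (tob X Y) Z) (tob X (tob Y Z)) ;
  tunit_l : forall X, arr (tob tunit X) X ;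
  tunit_r : forall X, arr (tob X tunit) X
}.
Arguments tob {C} t.
Arguments tarr {C} t {X X' Y Y'}.
Arguments tunit {C} t.
Arguments tassoc {C} t.
Arguments tunit_l {C} t.
Arguments tunit_r {C} t.

Record is_tensor_category (C : cat_data) (T : tensor_data C) : Prop :=
    IsTensorCategory {
  tcat_category : is_category C ;
  tob_ob : forall X Y, isob C X -> isob C Y -> isob C (tob T X Y) ;
  tunit_ob : isob C (tunit T) ;
  tarr_hom : forall X X' Y Y' f g,
    isob C X -> isob C X' -> isob C Y -> isob C Y' ->
    hom C X X' f -> hom C Y Y' g ->
    hom C (tob T X Y) (tob T X' Y') (tarr T f g) ;
  tarr_id : forall X Y, isob C X -> isob C Y ->
    tarr T (idm C X) (idm C Y) = idm C (tob T X Y) ;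
  tarr_cmp : forall X X' X'' Y Y' Y'' f f' g g',
    isob C X -> isob C X' -> isob C X'' ->
    isob C Y -> isob C Y' -> isob C Y'' ->
    hom C X X' f -> hom C X' X'' f' -> hom C Y Y' g -> hom C Y' Y'' g' ->
    tarr T (cmp f' f) (cmp g' g) = cmp (tarr T f' g') (tarr T f g) ;
  tassoc_iso : forall X Y Z, isob C X -> isob C Y -> isob C Z ->
    is_iso C _ _ (tassoc T X Y Z) ;
  tunit_l_iso : forall X, isob C X -> is_iso C _ _ (tunit_l T X) ;
  tunit_r_iso : forall X, isob C X -> is_iso C _ _ (tunit_r T X) ;
  tassoc_natural : forall X X' Y Y' Z Z' f g h,
    isob C X -> isob C X' -> isob C Y -> isob C Y' -> isob C Z -> isob C Z' ->
    hom C X X' f -> hom C Y Y' g -> hom C Z Z' h ->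
    cmp (tassoc T X' Y' Z') (tarr T (tarr T f g) h) =
    cmp (tarr T f (tarr T g h)) (tassoc T X Y Z) ;
  tunit_l_natural : forall X Y f, isob C X -> isob C Y -> hom C X Y f ->
    cmp (tunit_l T Y) (tarr T (idm C (tunit T)) f) = cmp f (tunit_l T X) ;
  tunit_r_natural : forall X Y f, isob C X -> isob C Y -> hom C X Y f ->
    cmp (tunit_r T Y) (tarr T f (idm C (tunit T))) = cmp f (tunit_r T X) ;
  tpentagon : forall W X Y Z,
    isob C W -> isob C X -> isob C Y -> isob C Z ->
    cmp (tarr T (idm C W) (tassoc T X Y Z))
      (cmp (tassoc T W (tob T X Y) Z) (tarr T (tassoc T W X Y) (idm C Z))) =
    cmp (tassoc T W X (tob T Y Z)) (tassoc T (tob T W X) Y Z) ;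
  ttriangle : forall X Y, isob C X -> isob C Y ->
    cmp (tarr T (idm C X) (tunit_l T Y)) (tassoc T X (tunit T) Y) =
    tarr T (tunit_r T X) (idm C Y)
}.

Record cstar_cat_data (R : realType) := CstarCatData {
  cob : Type ;
  cisob : cob -> Prop ;
  carr : cob -> cob -> normedModType R[i] ;
  chom : forall X Y, set (carr X Y) ;
  cidm : forall X, carr X X ;
  ccmp : forall X Y Z, carr Y Z -> carr X Y -> carr X Z ;
  cstar : forall X Y, carr X Y -> carr Y X
}.

Definition cat_of_cstar (R : realType) (C : cstar_cat_data R) : cat_data :=
  @CatData (cob C) (@cisob R C) (@carr R C) (@chom R C) (@cidm R C)
    (@ccmp R C).
Coercion cat_of_cstar : cstar_cat_data >-> cat_data.
Arguments cisob {R} C : rename.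
Arguments chom {R} C : rename.
Arguments cidm {R} C : rename.
Arguments ccmp {R C X Y Z} : rename.
Arguments cstar {R C X Y} : rename.

Record is_cstar_category (R : realType) (C : cstar_cat_data R) : Prop :=
    IsCstarCategory {
  ccat_category : is_category C ;
  chom_submod : forall X Y, cisob C X -> cisob C Y ->
    submod_closed [in chom C X Y] ;
  chom_complete : forall X Y, cisob C X -> cisob C Y ->
    forall u : nat -> carr X Y, (forall n, chom C X Y (u n)) ->
      cauchy (u @ \oo) -> exists2 f, chom C X Y f & u @ \oo --> f ;
  ccmp_linear_l : forall X Y Z a f f' g,
    cisob C X -> cisob C Y -> cisob C Z ->
    chom C Y Z f -> chom C Y Z f' -> chom C X Y g ->
    ccmp (a *: f + f') g = a *: ccmp f g + ccmp f' g ;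
  ccmp_linear_r : forall X Y Z a f g g',
    cisob C X -> cisob C Y -> cisob C Z ->
    chom C Y Z f -> chom C X Y g -> chom C X Y g' ->
    ccmp f (a *: g + g') = a *: ccmp f g + ccmp f g' ;
  ccmp_norm : forall X Y Z f g, cisob C X -> cisob C Y -> cisob C Z ->
    chom C Y Z f -> chom C X Y g -> `|ccmp f g| <= `|f| * `|g| ;
  cstar_hom : forall X Y f, cisob C X -> cisob C Y ->
    chom C X Y f -> chom C Y X (cstar f) ;
  cstar_antilinear : forall X Y a f g, cisob C X -> cisob C Y ->
    chom C X Y f -> chom C X Y g ->
    cstar (a *: f + g) = (a^*)%C *: cstar f + cstar g ;
  cstarK : forall X Y f, cisob C X -> cisob C Y -> chom C X Y f ->
    cstar (cstar f) = f ;
  cstar_cmp : forall X Y Z f g, cisob C X -> cisob C Y -> cisob C Z ->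
    chom C Y Z f -> chom C X Y g ->
    cstar (ccmp f g) = ccmp (cstar g) (cstar f) ;
  cstar_norm : forall X Y f, cisob C X -> cisob C Y -> chom C X Y f ->
    `|ccmp (cstar f) f| = `|f| ^+ 2 ;
  cstar_positive : forall X Y f, cisob C X -> cisob C Y -> chom C X Y f ->
    exists2 g, chom C X X g & ccmp (cstar f) f = ccmp (cstar g) g
}.

Definition cunitary (R : realType) (C : cstar_cat_data R) (X Y : cob C)
    (f : carr X Y) : Prop :=
  ccmp (cstar f) f = cidm C X /\ ccmp f (cstar f) = cidm C Y.

Record is_cstar_tensor_category (R : realType) (C : cstar_cat_data R)
    (T : tensor_data C) : Prop := IsCstarTensorCategory {
  ctcat_cstar : is_cstar_category C ;
  ctcat_tensor : is_tensor_category T ;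
  ctarr_linear_l : forall (X X' Y Y' : cob C) a (f f' : carr X X')
    (g : carr Y Y'), cisob C X -> cisob C X' -> cisob C Y -> cisob C Y' ->
    chom C X X' f -> chom C X X' f' -> chom C Y Y' g ->
    tarr T (a *: f + f') g = a *: (tarr T f g : carr _ _) + tarr T f' g ;
  ctarr_linear_r : forall (X X' Y Y' : cob C) a (f : carr X X')
    (g g' : carr Y Y'), cisob C X -> cisob C X' -> cisob C Y -> cisob C Y' ->
    chom C X X' f -> chom C Y Y' g -> chom C Y Y' g' ->
    tarr T f (a *: g + g') = a *: (tarr T f g : carr _ _) + tarr T f g' ;
  ctarr_star : forall (X X' Y Y' : cob C) (f : carr X X') (g : carr Y Y'),
    cisob C X -> cisob C X' -> cisob C Y -> cisob C Y' ->
    chom C X X' f -> chom C Y Y' g ->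
    cstar (tarr T f g : carr _ _) = tarr T (cstar f) (cstar g) ;
  ctassoc_unitary : forall X Y Z, cisob C X -> cisob C Y -> cisob C Z ->
    cunitary (tassoc T X Y Z) ;
  ctunit_l_unitary : forall X, cisob C X -> cunitary (tunit_l T X) ;
  ctunit_r_unitary : forall X, cisob C X -> cunitary (tunit_r T X)
}.

Section RepresentationCategories.
Variables (R : realType) (M : cpmu R).

Definition cstar_rep : cstar_cat_data R :=
  @CstarCatData R (rep_data M) (@is_rep R M) (fun X Y => bop (rK X) (rK Y))
    (@rep_morphism R M) (fun X => idop (rK X))
    (fun X Y Z => @compop R (rK X) (rK Y) (rK Z))
    (fun X Y => @adj R (rK X) (rK Y)).

Definition rep_s : cat_data :=
  @CatData (rep_data M) (@is_rep R M) (fun X Y => bop (rK X) (rK Y))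
    (@rep_semimorphism R M) (fun X => idop (rK X))
    (fun X Y Z => @compop R (rK X) (rK Y) (rK Z)).

End RepresentationCategories.

(* Main.v *)
(* The relative tensor product is the Hilbert space of the kernel
   <z|(xi^* xi')(eta^* eta') z'>, which is positive definite because the entrywise
   product of commuting positive operator matrices p, q is positive: it is a
   compression of the product of the commuting positive operators A = p (x) 1 and
   D = 1 (x) q, and A D >= 0 by the series A = A_0^2 + A_1^2 + ... of Riesz and
   Nagy, where 0 <= A <= 1, A_0 = A and A_(n+1) = A_n - A_n^2.
   Operators on relative tensor products are determined by their composites with
   the kets |xi>_1 and |eta>_2, and every coherence law (pentagon and triangle for
   the module category, the pentagon equation of X [box] Y, compatibility of the
   associativity and unit isomorphisms with X [box] Y) becomes, after slicing with
   kets, an equation that follows from naturality and from the pentagon equations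
   of the factors. The morphisms between two representations form a closed
   subspace, stable under products and adjoints; positivity of f^* f is witnessed
   by its square root, obtained as a norm limit of polynomials in f^* f. *)
Require Import Defs.
From mathcomp Require Import reals.
From HB Require Import structures.
From mathcomp Require Import all_boot all_order all_algebra.
From mathcomp Require Import complex ring lra.
From mathcomp Require Import all_classical all_reals topology normedtype.

Set Implicit Arguments.
Unset Strict Implicit.
Unset Printing Implicit Defensive.

Import Order.TTheory GRing.Theory Num.Theory.
Import numFieldNormedType.Exports.

Local Open Scope classical_set_scope.
Local Open Scope ring_scope.
Local Open Scope complex_scope.

(** * Complex numbers and normed modules *)

(** Boundedness is the obstacle at every level: an operator is prescribed on generators, and this is
    legitimate only after a norm estimate on finite combinations. The estimates for kets, for [rho]
    and for S tensored with T are all instances of positivity of an entrywise product, one factor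
    being a Gram matrix of operators and the other stating a norm bound as positivity of a matrix
    built from ||S||^2 - S^* S. This route covers semi-morphisms, whose adjoints need not respect
    the module structures. Since the operators of the statement are chosen by [xget] from a
    characterizing property, each must be shown to exist before any equation about it can be used.
    Iterated products are in general isomorphic, not equal, so the associativity unitary stands
    explicitly in every equation, and its naturality does the work that identification does on
    paper. Modules over the base and over its opposite are treated together by a boolean parameter.
    The series of Riesz and Nagy is taken instead of square roots because it works for a form on a
    bare vector space, before any Hilbert space of families of vectors has been built. *)

Section ComplexNumbers.
Variable R : realType.
Implicit Types (a b z : R[i]) (s t : R).

(** The norm on [R[i]] takes values in [R[i]]; its real part carries the same information ([cnE]) in
    the ordered field [R], where [lra] and [nra] apply. *)
Definition cn a : R := complex.Re `|a|.

Lemma cnE a : `|a| = (cn a)%:C.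
Proof. by rewrite /cn normc_def. Qed.

Lemma cn_sqr a : cn a ^+ 2 = complex.Re a ^+ 2 + complex.Im a ^+ 2.
Proof. by rewrite /cn normc_def /= sqr_sqrtr// addr_ge0// sqr_ge0. Qed.

Lemma cn_ge0 a : 0 <= cn a.
Proof. by rewrite /cn normc_def /= sqrtr_ge0. Qed.

Lemma cnR t : cn t%:C = `|t|.
Proof. by rewrite /cn normc_def /= expr0n /= addr0 sqrtr_sqr. Qed.

Lemma cnM a b : cn (a * b) = cn a * cn b.
Proof. by apply: complexI; rewrite -cnE normrM !cnE -rmorphM. Qed.

Lemma cnD a b : cn (a + b) <= cn a + cn b.
Proof. by rewrite -lecR rmorphD /= -!cnE ler_normD. Qed.

Lemma cnN a : cn (- a) = cn a.
Proof. by rewrite /cn normrN. Qed.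

Lemma cnJ a : cn (a^*%C) = cn a.
Proof. by rewrite /cn normcJ. Qed.

Lemma cn_eq0 a : cn a = 0 -> a = 0.
Proof. by move=> a0; apply/normr0_eq0; rewrite cnE a0. Qed.

Lemma cn0 : cn 0 = 0.
Proof. by rewrite /cn normr0. Qed.

Lemma Re_le_cn a : `|complex.Re a| <= cn a.
Proof. by rewrite -lecR -cnE normc_ge_Re. Qed.

Lemma creD a b : complex.Re (a + b) = complex.Re a + complex.Re b.
Proof. by case: a b => ? ? [? ?]. Qed.

Lemma cimD a b : complex.Im (a + b) = complex.Im a + complex.Im b.
Proof. by case: a b => ? ? [? ?]. Qed.

Lemma creN a : complex.Re (- a) = - complex.Re a.
Proof. by case: a. Qed.

Lemma cimN a : complex.Im (- a) = - complex.Im a.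
Proof. by case: a. Qed.

Lemma creM a b : complex.Re (a * b) =
  complex.Re a * complex.Re b - complex.Im a * complex.Im b.
Proof. by case: a b => ? ? [? ?]. Qed.

Lemma cimM a b : complex.Im (a * b) =
  complex.Re a * complex.Im b + complex.Im a * complex.Re b.
Proof. by case: a b => ? ? [? ?]. Qed.

Lemma creJ a : complex.Re (a^*%C) = complex.Re a. Proof. by case: a. Qed.
Lemma cimJ a : complex.Im (a^*%C) = - complex.Im a. Proof. by case: a. Qed.

Lemma cjD a b : (a + b)^*%C = a^*%C + b^*%C. Proof. exact: rmorphD. Qed.
Lemma cjN a : (- a)^*%C = - a^*%C. Proof. exact: rmorphN. Qed.
Lemma cjM a b : (a * b)^*%C = a^*%C * b^*%C. Proof. exact: rmorphM. Qed.
Lemma cj0 : (0 : R[i])^*%C = 0. Proof. exact: rmorph0. Qed.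
Lemma cjK a : a^*%C^*%C = a. Proof. exact: conjcK. Qed.

Lemma cj_sum I (r : seq I) (P : pred I) (F : I -> R[i]) :
  (\sum_(i <- r | P i) F i)^*%C = \sum_(i <- r | P i) (F i)^*%C.
Proof. by apply: (big_morph _ cjD cj0). Qed.

Lemma creMR t a : complex.Re (t%:C * a) = t * complex.Re a.
Proof. by rewrite creM /= mul0r subr0. Qed.

Lemma complex_eqP a b : complex.Re a = complex.Re b ->
  complex.Im a = complex.Im b -> a = b.
Proof. by case: a b => ? ? [? ?] /= -> ->. Qed.

Lemma cre_sum I (r : seq I) (P : pred I) (F : I -> R[i]) :
  complex.Re (\sum_(i <- r | P i) F i) = \sum_(i <- r | P i) complex.Re (F i).
Proof. by apply: (big_morph _ creD). Qed.


(** The discriminant argument, kept apart from any inner product: it yields the Cauchy-Schwarz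
    inequality for several forms, degenerate ones included, and the error estimate in [riesz]. *)
Lemma quadratic_bound s t b : 0 <= t ->
  (forall z, 0 <= s + 2 * complex.Re (z * b) + cn z ^+ 2 * t) ->
  cn b ^+ 2 <= s * t.
Proof.
move=> t0 Q.
have {}Q u : 0 <= s - 2 * u * cn b ^+ 2 + u ^+ 2 * (cn b ^+ 2) * t.
  (* A real multiple of the conjugate of [b] makes z b real and leaves a real quadratic in u. *)
  have := Q ((- u)%:C * b^*%C); rewrite -[_ * _ * b]mulrA creMR cnM cnJ cnR.
  rewrite exprMn real_normK ?num_real// creM creJ cimJ.
  by have := cn_sqr b => ->; nra.
move: t0 Q; rewrite le_eqVlt => /predU1P[<-|t0] Q.
  have [c0|c0] := eqVneq (cn b ^+ 2) 0; first by rewrite c0 mulr0.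
  (* For t = 0 the expression is affine in u, and this u gives it the value -1. *)
  have := Q ((s + 1) / (2 * cn b ^+ 2)).
  rewrite [X in _ - X](_ : _ = s + 1); last by field; rewrite expf_eq0 /= in c0.
  by lra.
(* The quadratic is minimal at u = 1 / t. *)
have := Q t^-1.
rewrite [X in _ <= X](_ : _ = (s * t - cn b ^+ 2) / t); last by field; lra.
by rewrite pmulr_lge0 ?invr_gt0// subr_ge0.
Qed.

End ComplexNumbers.

Section NormedModules.
Variable R : realType.
Implicit Types (V : normedModType R[i]) (e : R).

Definition nrm V (x : V) : R := complex.Re `|x|.

Lemma nrmE V (x : V) : `|x| = (nrm x)%:C.
Proof.
by have := normr_ge0 x; rewrite /nrm; case: `|x| => a b; rewrite lecE /= => /andP[/eqP->].
Qed.

Lemma nrm_ge0 V (x : V) : 0 <= nrm x.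
Proof. by rewrite -lecR -nrmE normr_ge0. Qed.

Lemma nrmD V (x y : V) : nrm (x + y) <= nrm x + nrm y.
Proof. by rewrite -lecR rmorphD /= -!nrmE ler_normD. Qed.

Lemma nrmN V (x : V) : nrm (- x) = nrm x.
Proof. by rewrite /nrm normrN. Qed.

Lemma nrm0 V : nrm (0 : V) = 0.
Proof. by rewrite /nrm normr0. Qed.

Lemma nrm_eq0 V (x : V) : nrm x = 0 -> x = 0.
Proof. by move=> x0; apply/normr0_eq0; rewrite nrmE x0. Qed.

Lemma nrmB V (x y : V) : nrm (x - y) = nrm (y - x).
Proof. by rewrite /nrm distrC. Qed.

Lemma nrm_triangle V (y x z : V) : nrm (x - z) <= nrm (x - y) + nrm (y - z).
Proof. by rewrite (le_trans _ (nrmD _ _))// addrA subrK. Qed.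

Lemma nrmZ V (a : R[i]) (x : V) : nrm (a *: x) = cn a * nrm x.
Proof. by apply: complexI; rewrite -nrmE normrZ cnE nrmE -rmorphM. Qed.

Lemma nrm_small V (x : V) : (forall e, 0 < e -> nrm x <= e) -> x = 0.
Proof.
move=> xe; apply/nrm_eq0/le_anti; rewrite nrm_ge0 andbT.
by apply/ler_addgt0Pr => e e0; rewrite add0r xe.
Qed.

Lemma posC (e : R[i]) : 0 < e -> 0 < complex.Re e /\ e = (complex.Re e)%:C.
Proof. by case: e => a b; rewrite ltcE /= => /andP[/eqP-> ->]. Qed.

Lemma ballC V (x y : V) e : ball x e%:C y <-> nrm (x - y) < e.
Proof. by rewrite -ball_normE /= nrmE ltcR. Qed.

Lemma nrm_close V (x y z : V) e d :
  nrm (x - z) < e -> nrm (y - z) < d -> nrm (x - y) <= e + d.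
Proof. by have := nrm_triangle z x y; rewrite (nrmB z); lra. Qed.

Lemma nrm_closer V (x y z : V) e d :
  nrm (x - y) <= e -> nrm (y - z) < d -> nrm (x - z) < e + d.
Proof. by have := nrm_triangle y x z; lra. Qed.

Lemma closureE V (A : set V) x :
  closure A x <-> forall e, 0 < e -> exists2 y, A y & nrm (x - y) < e.
Proof.
split=> [cA e e0|cA B].
  have [|y [Ay /=]] := cA (ball x e%:C).
    by apply: nbhsx_ballx; rewrite ltcR.
  by rewrite -ball_normE /= nrmE ltcR; exists y.
move=> /nbhs_ballP[e /= /posC[e0 eE] eB].
have [y Ay xy] := cA _ e0; exists y; split=> //; apply: eB.
by rewrite eE -ball_normE /= nrmE ltcR.
Qed.

(** [S e] is to be thought of as the set of e-approximations to a point still to be found; the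
    second hypothesis says that approximations of any two accuracies are consistent. This form of
    completeness needs no sequences and returns the same explicit rate. *)
Lemma complete_net (V : completeNormedModType R[i]) (S : R -> set V) :
  (forall e, 0 < e -> S e !=set0) ->
  (forall e e' x y, 0 < e -> 0 < e' -> S e x -> S e' y -> nrm (x - y) <= e + e') ->
  exists l, forall e, 0 < e -> forall x, S e x -> nrm (l - x) <= e.
Proof.
move=> S0 SS.
(* [S] is not assumed monotone in e, so all sufficiently small d are required. *)
pose F : set_system V := [set A | exists2 e, 0 < e & forall d, 0 < d -> d <= e -> S d `<=` A].
have FF : ProperFilter F.
  apply: Build_ProperFilter.
    move=> [e e0 /(_ e e0 (lexx _))]; have [x Sx] := S0 e e0.
    by move=> /(_ x Sx).
  split.
  - by exists 1.
  - move=> P Q [e e0 eP] [d d0 dQ]; exists (Num.min e d); first by rewrite lt_min e0.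
    move=> c c0; rewrite le_min => /andP[ce cd] x Sx.
    by split; [apply: eP Sx|apply: dQ Sx].
  - by move=> P Q PQ [e e0 eP]; exists e => // d d0 de x /(eP _ d0 de)/PQ.
have /cauchy_cvg/cvg_ex[l Fl] : cauchy F.
  apply: cauchy_exP => eps /posC[]; move: (complex.Re eps) => e e0 ->.
  have e4 : 0 < e / 4 by lra.
  have [x Sx] := S0 _ e4; exists x; exists (e / 4) => // d d0 de y Sy.
  rewrite -ball_normE /= nrmE ltcR.
  by have := SS _ _ _ _ e4 d0 Sx Sy; lra.
exists l => e e0 x Sx; apply/ler_addgt0Pr => d d0.
have d2 : 0 < d / 2 by lra.
have /(_ (ball l (d / 2)%:C)) /= [] := Fl.
  by apply: nbhsx_ballx; rewrite ltcR.
move=> c c0 /(_ (Num.min c (d / 2))); rewrite lt_min c0 d2 /= => /(_ isT).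
rewrite ge_min lexx => /(_ isT) sub.
have m0 : 0 < Num.min c (d / 2) by rewrite lt_min c0.
have [y Sy] := S0 _ m0.
have := sub y Sy; rewrite -ball_normE /= nrmE ltcR => ly.
have := SS _ _ _ _ m0 e0 Sy Sx.
have := nrm_triangle y l x; have : Num.min c (d / 2) <= d / 2 by rewrite ge_min lexx orbT.
by lra.
Qed.

End NormedModules.

(** * Hilbert spaces, operators and closed spans *)

Section InnerProduct.
Variables (R : realType) (H : hilbertType R).
Implicit Types (x y z : H) (a : R[i]).

Lemma innerC x y : inner y x = (inner x y)^*%C.
Proof. exact: inner_conj. Qed.

Lemma innerDr x y z : inner x (y + z) = inner x y + inner x z.
Proof. by have := inner_linear x 1 y z; rewrite scale1r mul1r. Qed.

Lemma inner0r x : inner x 0 = 0.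
Proof. by have := innerDr x 0 0; rewrite addr0 => /eqP; rewrite -subr_eq subrr => /eqP. Qed.

Lemma innerZr a x y : inner x (a *: y) = a * inner x y.
Proof. by have := inner_linear x a y 0; rewrite inner0r !addr0. Qed.

Lemma innerNr x y : inner x (- y) = - inner x y.
Proof. by rewrite -scaleN1r innerZr mulN1r. Qed.

Lemma innerBr x y z : inner x (y - z) = inner x y - inner x z.
Proof. by rewrite innerDr innerNr. Qed.

Lemma innerDl x y z : inner (x + y) z = inner x z + inner y z.
Proof. by rewrite innerC innerDr cjD -!innerC. Qed.

Lemma innerZl a x y : inner (a *: x) y = a^*%C * inner x y.
Proof. by rewrite innerC innerZr cjM -innerC. Qed.

Lemma inner0l x : inner 0 x = 0.
Proof. by rewrite innerC inner0r cj0. Qed.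

Lemma innerNl x y : inner (- x) y = - inner x y.
Proof. by rewrite innerC innerNr cjN -innerC. Qed.

Lemma innerBl x y z : inner (x - y) z = inner x z - inner y z.
Proof. by rewrite innerDl innerNl. Qed.

Lemma inner_sumr I (r : seq I) (P : pred I) (F : I -> H) x :
  inner x (\sum_(i <- r | P i) F i) = \sum_(i <- r | P i) inner x (F i).
Proof. by apply: (big_morph _ (innerDr x) (inner0r x)). Qed.

Lemma inner_suml I (r : seq I) (P : pred I) (F : I -> H) x :
  inner (\sum_(i <- r | P i) F i) x = \sum_(i <- r | P i) inner (F i) x.
Proof. by apply: (big_morph (inner ^~ x) _ (inner0l x)) => y z; rewrite innerDl. Qed.

Lemma inner_sqr x : inner x x = (nrm x ^+ 2)%:C.
Proof. by rewrite inner_norm nrmE -rmorphXn. Qed.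

Lemma Re_inner_sqr x : complex.Re (inner x x) = nrm x ^+ 2.
Proof. by rewrite inner_sqr. Qed.

Lemma Re_innerC x y : complex.Re (inner x y) = complex.Re (inner y x).
Proof. by rewrite innerC creJ. Qed.

Lemma nrm_sqrDZ x y a : nrm (x + a *: y) ^+ 2 =
  nrm x ^+ 2 + 2 * complex.Re (a * inner x y) + cn a ^+ 2 * nrm y ^+ 2.
Proof.
rewrite -Re_inner_sqr innerDl !innerDr !creD Re_inner_sqr.
rewrite (Re_innerC (a *: y) x) innerZr innerZl innerZr inner_sqr.
by rewrite !creM !cimM creJ cimJ /= cn_sqr; ring.
Qed.

Lemma nrm_sqrD x y : nrm (x + y) ^+ 2 =
  nrm x ^+ 2 + 2 * complex.Re (inner x y) + nrm y ^+ 2.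
Proof. by have := nrm_sqrDZ x y 1; rewrite scale1r mul1r cnR normr1 expr1n mul1r. Qed.

Lemma nrm_sqrB x y : nrm (x - y) ^+ 2 =
  nrm x ^+ 2 - 2 * complex.Re (inner x y) + nrm y ^+ 2.
Proof. by rewrite nrm_sqrD nrmN innerNr creN mulrN. Qed.

Lemma cauchy_schwarz x y : cn (inner x y) <= nrm x * nrm y.
Proof.
rewrite -(@ler_pXn2r _ 2) ?nnegrE ?cn_ge0 ?mulr_ge0 ?nrm_ge0// exprMn.
apply: quadratic_bound; first exact: sqr_ge0.
by move=> a; rewrite -nrm_sqrDZ sqr_ge0.
Qed.

Lemma inner_ext x y : (forall z, inner z x = inner z y) -> x = y.
Proof.
move=> xy; apply/eqP; rewrite -subr_eq0; apply/eqP/nrm_eq0/eqP.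
by rewrite -sqrf_eq0 -Re_inner_sqr innerBr xy subrr.
Qed.

(** The representing vector minimizes J x = ||x||^2 - 2 Re (f x). The parallelogram law makes
    near-minimizers a Cauchy net, which replaces the projection onto the orthogonal complement of
    the kernel. *)
Lemma riesz (f : H -> R[i]) (M : R) : linear_for *%R f ->
  (forall x, cn (f x) <= M * nrm x) -> exists y, forall x, f x = inner y x.
Proof.
move=> lf fM.
have fB x y a : f (x + a *: y) = f x + a * f y by rewrite addrC lf addrC.
have M0 : 0 <= `|M| by [].
have {}fM x : cn (f x) <= `|M| * nrm x.
  by rewrite (le_trans (fM x))// ler_wpM2r ?nrm_ge0// ler_norm.
move: `|M| M0 fM => {}M M0 fM.
pose J x := nrm x ^+ 2 - 2 * complex.Re (f x).
have Jlb x : - M ^+ 2 <= J x.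
  rewrite /J; have := fM x; have := Re_le_cn (f x); rewrite ler_norml.
  by have := nrm_ge0 x; have := sqr_ge0 (nrm x - M); nra.
pose JS : set R := [set J x | x in setT].
have JSinf : has_inf JS.
  by split; [exists (J 0); exists 0|exists (- M ^+ 2) => _ [x _ <-]].
pose m := inf JS.
have mJ x : m <= J x by apply: ge_inf => //; [case: JSinf|exists x].
(* With slack e^2 / 2, comparison with the midpoint gives ||x - y||^2 <= e^2 + d^2, hence a distance
   of at most e + d. *)
pose S e : set H := [set x | J x <= m + e ^+ 2 / 2].
have [e e0|e d x y e0 d0|l lS] := @complete_net R H S.
- have [||_ [x _ <-] xm] := @inf_adherent _ JS (e ^+ 2 / 2) => //.
    by rewrite divr_gt0// exprn_gt0.
  by exists x; rewrite /S /=; apply: ltW.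
- rewrite /S /= => xe yd.
  rewrite -(@ler_pXn2r _ 2) ?nnegrE ?nrm_ge0 ?addr_ge0 ?ltW//.
  have := mJ ((1/2)%:C *: x + (1/2)%:C *: y).
  rewrite /J nrm_sqrDZ fB -[(1/2)%:C *: x]add0r fB nrm_sqrDZ nrm0 inner0l.
  rewrite add0r innerZl [f 0](_ : _ = 0); last first.
    by apply: cn_eq0; apply/le_anti; rewrite cn_ge0 (le_trans (fM 0))// nrm0 mulr0.
  rewrite add0r creD !creMR conjc_real creMR mulr0 cnR.
  rewrite [`|1 / 2|]gtr0_norm; last by lra.
  move: xe yd; rewrite /J nrm_sqrB /=; move: (complex.Re _) => u.
  by have := mulr_gt0 e0 d0; rewrite !expr2; lra.
exists l => z; apply/eqP; rewrite -subr_eq0; apply/eqP/cn_eq0/le_anti.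
rewrite cn_ge0 andbT; apply/ler_addgt0Pr => d d0; rewrite add0r.
have z0 := nrm_ge0 z.
have [e e0 ed] : exists2 e : R, 0 < e & 2 * e * nrm z <= d.
  exists (d / (2 * (nrm z + 1))); first by rewrite divr_gt0// mulr_gt0//; lra.
  rewrite [X in X <= _](_ : _ = d * (nrm z / (nrm z + 1))); last by field; lra.
  by rewrite ger_pMr// ler_pdivrMr ?mul1r; lra.
have [x Sx] : S e !=set0.
  have [||_ [x _ <-] xm] := @inf_adherent _ JS (e ^+ 2 / 2) => //.
    by rewrite divr_gt0// exprn_gt0.
  by exists x; rewrite /S /=; apply: ltW.
have lx := lS _ e0 _ Sx.
(* J (x + a z) - J x >= - e^2 / 2 for every a, and the left side is a quadratic in a with linear
   coefficient <x, z> - f z. *)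
have : cn (inner x z - f z) ^+ 2 <= (e ^+ 2 / 2) * nrm z ^+ 2.
  apply: quadratic_bound; first exact: sqr_ge0.
  move=> a; move: Sx (mJ (x + a *: z)); rewrite /S /J /= fB nrm_sqrDZ creD.
  by rewrite mulrBr creD creN; lra.
move=> xz.
have {}xz : cn (inner x z - f z) <= e * nrm z.
  rewrite -(@ler_pXn2r _ 2) ?nnegrE ?cn_ge0 ?(mulr_ge0 (ltW e0))//.
  apply: (le_trans xz); rewrite exprMn ler_wpM2r ?sqr_ge0//.
  by have := sqr_ge0 e; lra.
have -> : f z - inner l z = - (inner x z - f z) - inner (l - x) z.
  by rewrite innerBl; ring.
rewrite (le_trans (cnD _ _))// !cnN.
have := cauchy_schwarz (l - x) z; have := nrm_ge0 z.
by move: lx xz ed; nra.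
Qed.

End InnerProduct.

Section Operators.
Variable R : realType.
Implicit Types E H K L : hilbertType R.

HB.instance Definition _ H K (T : bop H K) :=
  GRing.isLinear.Build _ _ _ _ (bop_fun T) (@bop_linear R H K T).

Lemma bopD H K (S T : bop H K) x : (S + T) x = S x + T x.
Proof. by []. Qed.

Lemma bopZ H K a (T : bop H K) x : (a *: T) x = a *: T x.
Proof. by []. Qed.

Lemma bopZr H K a (T : bop H K) x : T (a *: x) = a *: T x.
Proof. exact: linearZ. Qed.

Lemma bopN H K (T : bop H K) x : (- T) x = - T x.
Proof. by []. Qed.

Lemma bop_sumr H K (T : bop H K) I (r : seq I) (P : pred I) (F : I -> H) :
  T (\sum_(i <- r | P i) F i) = \sum_(i <- r | P i) T (F i).
Proof. by apply: (big_morph T (linearD T) (linear0 T)). Qed.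

Lemma bopP H K (S T : bop H K) : (forall x, S x = T x) -> S = T.
Proof. by move=> ST; apply/val_inj/funext. Qed.

Lemma compopE H K L (S : bop K L) (T : bop H K) x : (S \ob T) x = S (T x).
Proof. by []. Qed.

Lemma idopE H (x : H) : idop H x = x. Proof. by []. Qed.

Lemma compopA E H K L (S : bop K L) (T : bop H K) (U : bop E H) :
  S \ob (T \ob U) = S \ob T \ob U.
Proof. exact: bopP. Qed.

Lemma comp1op H K (T : bop H K) : idop K \ob T = T.
Proof. exact: bopP. Qed.

Lemma compop1 H K (T : bop H K) : T \ob idop H = T.
Proof. exact: bopP. Qed.

Lemma compDl H K L (S T : bop K L) (U : bop H K) : (S + T) \ob U = (S \ob U) + (T \ob U).
Proof. exact: bopP. Qed.

Lemma compDr H K L (S T : bop H K) (U : bop K L) : U \ob (S + T) = (U \ob S) + (U \ob T).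
Proof. by apply: bopP => x; rewrite /= linearD. Qed.

Lemma compZl H K L a (S : bop K L) (U : bop H K) : (a *: S) \ob U = a *: (S \ob U).
Proof. exact: bopP. Qed.

Lemma compZr H K L a (S : bop H K) (U : bop K L) : U \ob (a *: S) = a *: (U \ob S).
Proof. by apply: bopP => x; rewrite /= linearZ. Qed.

Lemma compNl H K L (S : bop K L) (U : bop H K) : (- S) \ob U = - (S \ob U).
Proof. exact: bopP. Qed.

Lemma compNr H K L (S : bop H K) (U : bop K L) : U \ob (- S) = - (U \ob S).
Proof. by apply: bopP => x; rewrite /= linearN. Qed.

Lemma nrm_bop H K (T : bop H K) x : nrm (T x) <= nrm T * nrm x.
Proof. by rewrite -lecR rmorphM /= -!nrmE; apply: opnorm_ge. Qed.

Lemma nrm_bop_le H K (T : bop H K) M : 0 <= M ->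
  (forall x, nrm (T x) <= M * nrm x) -> nrm T <= M.
Proof.
move=> M0 TM; rewrite -lecR -nrmE; apply: opnorm_le => // x.
by rewrite !nrmE -rmorphM lecR.
Qed.

Lemma nrm_comp H K L (S : bop K L) (T : bop H K) : nrm (S \ob T) <= nrm S * nrm T.
Proof.
apply: nrm_bop_le => [|x]; first by rewrite mulr_ge0 ?nrm_ge0.
rewrite (le_trans (nrm_bop S (T x)))// -[leRHS]mulrA ler_wpM2l ?nrm_ge0//.
exact: nrm_bop.
Qed.

Lemma bop_exists H K (f : H -> K) (M : R) : linear f ->
  (forall x, nrm (f x) <= M * nrm x) -> exists T : bop H K, forall x, T x = f x.
Proof.
move=> lf fM; pose fl : {linear H -> K} :=
  HB.pack f (GRing.isLinear.Build _ _ _ _ _ lf).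
have cf : continuous f.
  apply: (linear_bounded_continuous fl).1.
  apply/linear_boundedP; exists (`|M| + 1)%:C; split.
    by apply: ger0_real; rewrite ler0c addr_ge0.
  move=> r; case: r => r i; rewrite ltcE /= => /andP[/eqP-> Mr] x.
  rewrite complexr0 !nrmE -rmorphM lecR (le_trans (fM x))// ler_wpM2r ?nrm_ge0//.
  by rewrite (le_trans (ler_norm _))// (le_trans _ (ltW Mr))// lerDl.
have fb : f \in @bounded_linear R H K by apply/asboolP; split.
by exists (Bop fb).
Qed.

(** Gives the [xget] in [adj] its meaning. [riesz] supplies the values of the adjoint, and their
    boundedness comes from ||S y||^2 = <T (S y), y> <= ||T|| ||S y|| ||y||. *)
Lemma adjP H K (T : bop H K) x y : inner (T x) y = inner x (adj T y).
Proof.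
rewrite /adj; move: x y.
apply: (@xgetPex _ 0 [set S : bop K H | forall x y, inner (T x) y = inner x (S y)]).
have /choice[S SP] : forall y, exists z, forall x, inner y (T x) = inner z x.
  move=> y; apply: (@riesz _ _ _ (nrm y * nrm T)) => [a x z|x].
    by rewrite linearP innerDr innerZr.
  rewrite (le_trans (cauchy_schwarz _ _))// -mulrA ler_wpM2l ?nrm_ge0//.
  exact: nrm_bop.
have {}SP x y : inner (T x) y = inner x (S y) by rewrite innerC SP -innerC.
have [|y|U US] := @bop_exists _ _ S (nrm T).
- by move=> a y z; apply: inner_ext => x; rewrite innerDr innerZr -!SP innerDr innerZr.
- have := nrm_ge0 (S y); rewrite le_eqVlt => /predU1P[<-|S0].
    by rewrite mulr_ge0 ?nrm_ge0.
  rewrite -(ler_pM2r S0) -expr2 -Re_inner_sqr -SP.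
  rewrite (le_trans (ler_norm _))// (le_trans (Re_le_cn _))//.
  rewrite (le_trans (cauchy_schwarz _ _))// [leRHS]mulrAC ler_wpM2r ?nrm_ge0//.
  exact: nrm_bop.
- by exists U => x y; rewrite US.
Qed.

Lemma adjPl H K (T : bop H K) x y : inner x (T y) = inner (adj T x) y.
Proof. by rewrite innerC adjP -innerC. Qed.

Lemma adj_uniq H K (T : bop H K) (S : bop K H) :
  (forall x y, inner (T x) y = inner x (S y)) -> adj T = S.
Proof. by move=> TS; apply: bopP => y; apply: inner_ext => x; rewrite -adjP TS. Qed.

Lemma adjK H K (T : bop H K) : adj (adj T) = T.
Proof. by apply: adj_uniq => x y; rewrite -adjPl. Qed.

Lemma adjM H K L (S : bop K L) (T : bop H K) : adj (S \ob T) = adj T \ob adj S.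
Proof. by apply: adj_uniq => x y; rewrite /= !adjP. Qed.

Lemma adj1 H : adj (idop H) = idop H.
Proof. exact: adj_uniq. Qed.

Lemma adjD H K (S T : bop H K) : adj (S + T) = adj S + adj T.
Proof. by apply: adj_uniq => x y; rewrite bopD innerDl innerDr !adjP. Qed.

Lemma adjZ H K a (T : bop H K) : adj (a *: T) = a^*%C *: adj T.
Proof. by apply: adj_uniq => x y; rewrite bopZ innerZl innerZr adjP. Qed.

Lemma adj0 H K : adj (0 : bop H K) = 0.
Proof. by apply: adj_uniq => x y; rewrite inner0l inner0r. Qed.

Lemma adjB H K (S T : bop H K) : adj (S - T) = adj S - adj T.
Proof.
by apply: adj_uniq => x y; rewrite !bopD !bopN innerBl innerBr !adjP.
Qed.

Lemma nrm_adj_le H K (T : bop H K) : nrm (adj T) <= nrm T.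
Proof.
apply: nrm_bop_le => [|y]; first exact: nrm_ge0.
have := nrm_ge0 (adj T y); rewrite le_eqVlt => /predU1P[<-|S0].
  by rewrite mulr_ge0 ?nrm_ge0.
rewrite -(ler_pM2r S0) -expr2 -Re_inner_sqr -adjP.
rewrite (le_trans (ler_norm _))// (le_trans (Re_le_cn _))//.
rewrite (le_trans (cauchy_schwarz _ _))// [leRHS]mulrAC ler_wpM2r ?nrm_ge0//.
exact: nrm_bop.
Qed.

Lemma nrm_adj H K (T : bop H K) : nrm (adj T) = nrm T.
Proof. by apply/le_anti; rewrite nrm_adj_le -{1}(adjK T) nrm_adj_le. Qed.

Lemma nrm_cstar H K (T : bop H K) : nrm (adj T \ob T) = nrm T ^+ 2.
Proof.
apply/le_anti; rewrite (le_trans (nrm_comp _ _)) ?nrm_adj//=.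
rewrite -[leRHS]sqr_sqrtr ?nrm_ge0// ler_sqr ?nnegrE ?nrm_ge0 ?sqrtr_ge0//.
apply: nrm_bop_le => [|x]; first exact: sqrtr_ge0.
rewrite -(@ler_pXn2r _ 2) ?nnegrE ?mulr_ge0 ?sqrtr_ge0 ?nrm_ge0//.
rewrite exprMn sqr_sqrtr ?nrm_ge0// -Re_inner_sqr adjP -compopE.
rewrite (le_trans (ler_norm _))// (le_trans (Re_le_cn _))//.
rewrite (le_trans (cauchy_schwarz _ _))// [leLHS]mulrC expr2 mulrA.
by rewrite ler_wpM2r ?nrm_ge0// nrm_bop.
Qed.

End Operators.

Section Spans.
Variable R : realType.
Implicit Types V W : normedModType R[i].

Lemma csubP V (A : set V) : closed_subspace A <->
  [/\ A 0, (forall a x y, A x -> A y -> A (a *: x + y)) & closure A `<=` A].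
Proof.
split=> [[[A0 AD] cA]|[A0 AD cA]].
  split=> [|a x y Ax Ay|]; first by rewrite inE in A0.
    by have := AD a x y; rewrite !inE; apply.
  by move/closure_id: cA => <-.
split; last by apply/closure_id/seteqP; split=> //; exact: subset_closure.
by split=> [|a x y]; rewrite !inE //; apply: AD.
Qed.

Lemma linspan0 (V : lmodType R[i]) (A : set V) : linspan A 0.
Proof.
exists 0, (fun=> 0), (fun=> 0); split=> [[]//|].
by rewrite big_ord0.
Qed.

Lemma linspanP (V : lmodType R[i]) (A : set V) a x y :
  linspan A x -> linspan A y -> linspan A (a *: x + y).
Proof.
move=> [n [c [u [Au ->]]]] [m [d [v [Av ->]]]].
exists (n + m)%N, (fun i => match fintype.split i with inl j => a * c j | inr j => d j end),
  (fun i => match fintype.split i with inl j => u j | inr j => v j end); split.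
  by move=> i; case: (fintype.split i).
rewrite big_split_ord /= scaler_sumr; congr (_ + _); apply: eq_bigr => i _.
  by rewrite (unsplitK (inl i)) scalerA.
by rewrite (unsplitK (inr i)).
Qed.

Lemma sub_linspan (V : lmodType R[i]) (A : set V) : A `<=` linspan A.
Proof.
move=> x Ax; exists 1, (fun=> 1), (fun=> x); split=> //.
by rewrite big_ord1 scale1r.
Qed.

Lemma linspan_ind (V : lmodType R[i]) (A : set V) (P : V -> Prop) :
  P 0 -> (forall a x y, A x -> P y -> P (a *: x + y)) ->
  forall x, linspan A x -> P x.
Proof.
move=> P0 PD x [n [c [u [Au ->]]]].
by elim/big_rec: _ => // i y _ Py; exact: PD.
Qed.

Lemma clspan_closed V (A : set V) : closed_subspace (clspan A).
Proof.
apply/csubP; split=> [|a x y Ax Ay|].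
- exact/subset_closure/linspan0.
- apply/closureE => e e0; have d0 : 0 < e / (2 * (cn a + 1)).
    by rewrite divr_gt0// mulr_gt0// ltr_wpDl// cn_ge0.
  have e2 : 0 < e / 2 by lra.
  have [x' Ax' xx'] := (closureE _ _).1 Ax _ d0.
  have [y' Ay' yy'] := (closureE _ _).1 Ay _ e2.
  exists (a *: x' + y'); first exact: linspanP.
  rewrite opprD addrACA -scalerBr (le_lt_trans (nrmD _ _))// nrmZ.
  have : cn a * nrm (x - x') <= e / 2; last by lra.
  rewrite (@le_trans _ _ (cn a * (e / (2 * (cn a + 1)))))//.
    by rewrite ler_wpM2l ?cn_ge0 1?ltW.
  have a0 := cn_ge0 a.
  rewrite [leLHS](_ : _ = e / 2 * (cn a / (cn a + 1))); last by field; lra.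
  by rewrite ger_pMr// ler_pdivrMr ?mul1r; lra.
- by apply: closed_closure.
Qed.

Lemma sub_clspan V (A : set V) : A `<=` clspan A.
Proof. by move=> x Ax; apply/subset_closure/sub_linspan. Qed.

Lemma clspan_min V (A B : set V) : closed_subspace B -> A `<=` B -> clspan A `<=` B.
Proof.
move=> /csubP[B0 BD cB] AB; apply: subset_trans cB; apply: closure_subset.
by move=> x; apply: linspan_ind => // a y z Ay Bz; apply: BD => //; exact: AB.
Qed.

Lemma clspan_sub V (A B : set V) : A `<=` clspan B -> clspan A `<=` clspan B.
Proof. by move=> AB; apply: clspan_min => //; exact: clspan_closed. Qed.

Lemma clspan_mono V (A B : set V) : A `<=` B -> clspan A `<=` clspan B.
Proof. by move=> AB; apply: clspan_sub => x /AB; exact: sub_clspan. Qed.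

(** The scalar b may differ from a, so that the antilinear map [adj] is covered as well as
    composition on either side. *)
Lemma clspan_map V W (f : V -> W) (M : R) (A : set V) (B : set W) :
  (forall x y, f (x + y) = f x + f y) ->
  (forall a x, exists b, f (a *: x) = b *: f x) ->
  (forall x, nrm (f x) <= M * nrm x) -> closed_subspace B ->
  (forall x, A x -> B (f x)) -> forall x, clspan A x -> B (f x).
Proof.
move=> fD fZ fM /csubP[B0 BD cB] AB.
apply: clspan_min => //; apply/csubP.
have f0 : f 0 = 0.
  by have := fD 0 0; rewrite addr0 => /eqP; rewrite -subr_eq subrr => /eqP.
have fN x : f (- x) = - f x.
  by apply/eqP; rewrite -subr_eq0 opprK -fD addNr f0.
split=> [|a x y /= Bx By|x /= cx]; first by rewrite /= f0.
  by rewrite fD; have [b ->] := fZ a x; exact: BD.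
apply: cB; apply/closureE => e e0.
have M0 : 0 < `|M| + 1 by rewrite ltr_wpDl.
have d0 : 0 < e / (`|M| + 1) by rewrite divr_gt0.
have [y By xy] := (closureE _ _).1 cx _ d0.
exists (f y) => //; rewrite -fN -fD (le_lt_trans (fM _))//.
move: xy; rewrite ltr_pdivlMr// => xy; have := nrm_ge0 (x - y).
by have := ler_norm M; nra.
Qed.

End Spans.

Section TotalSets.
Variable R : realType.
Implicit Types E H K L : hilbertType R.

Lemma total_ind H K (A : set H) (B : set K) (T : bop H K) :
  clspan A = setT -> closed_subspace B -> (forall x, A x -> B (T x)) ->
  forall x, B (T x).
Proof.
move=> tA cB AB x; apply: (@clspan_map _ _ _ _ (nrm T) A) => //.
- exact: linearD.
- by move=> a y; exists a; rewrite linearZ.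
- exact: nrm_bop.
- by rewrite tA.
Qed.

Lemma closed_subspace0 H : closed_subspace [set 0 : H].
Proof.
apply/csubP; split=> // [a x y /= -> ->|x /closureE cx]; first by rewrite scaler0 addr0.
by apply: nrm_small => e /cx[y ->]; rewrite subr0 => /ltW.
Qed.

Lemma total_ext H K (A : set H) (S T : bop H K) :
  clspan A = setT -> (forall x, A x -> S x = T x) -> S = T.
Proof.
move=> tA ST; apply/eqP; rewrite -subr_eq0; apply/eqP/bopP => x.
apply: (total_ind tA (@closed_subspace0 K)) => y Ay.
by rewrite bopD bopN ST// subrr.
Qed.

(** Extension by continuity of a densely defined bounded linear relation. With a relation,
    independence of the chosen finite combination never has to be checked separately: the bound
    forces single-valuedness. *)
Lemma bop_graph H K (G : H -> K -> Prop) (M : R) :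
  0 <= M -> (forall x, closure [set x | exists y, G x y] x) -> 
  (forall a x y x' y', G x y -> G x' y' -> G (a *: x + x') (a *: y + y')) ->
  (forall x y, G x y -> nrm y <= M * nrm x) ->
  exists2 T : bop H K, (forall x y, G x y -> T x = y) &
    forall x, nrm (T x) <= M * nrm x.
Proof.
move=> M0 Gd GD GM.
have GB x y x' y' : G x y -> G x' y' -> nrm (y - y') <= M * nrm (x - x').
  move=> g g'; have := GM _ _ (GD (-1) _ _ _ _ g' g).
  by rewrite !scaleN1r ![- _ + _]addrC.
pose S x e : set K := [set y | exists2 x', G x' y & M * nrm (x - x') <= e].
have /choice[f fP] : forall x, exists y, forall e, 0 < e -> forall z, S x e z -> nrm (y - z) <= e.
  move=> x; apply: complete_net.
    move=> e e0; have d0 : 0 < e / (M + 1) by rewrite divr_gt0// ltr_wpDl.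
    have [x' [y gy] xx'] := (closureE _ _).1 (Gd x) _ d0.
    exists y, x' => //; move: xx'; rewrite ltr_pdivlMr ?ltr_wpDl//.
    by have := nrm_ge0 (x - x'); nra.
  move=> e d y y' e0 d0 [z gz ze] [z' gz' zd].
  rewrite (le_trans (GB _ _ _ _ gz gz'))// (le_trans _ (lerD ze zd))// -mulrDr.
  by rewrite ler_wpM2l// (nrmB x) nrm_triangle.
have fG x y x' y' e : 0 < e -> G x y -> M * nrm (x' - x) <= e -> y' = f x' -> nrm (y' - y) <= e.
  by move=> e0 g xe ->; apply: fP => //; exists x.
have fE x y : G x y -> f x = y.
  move=> g; apply/eqP; rewrite -subr_eq0; apply/eqP/nrm_small => e e0.
  by apply: (fG x) => //; rewrite subrr nrm0 mulr0 ltW.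
have approx x e : 0 < e -> exists2 x', exists y, G x' y & M * nrm (x - x') <= e.
  move=> e0; have d0 : 0 < e / (M + 1) by rewrite divr_gt0// ltr_wpDl.
  have [x' gy xx'] := (closureE _ _).1 (Gd x) _ d0; exists x' => //.
  move: xx'; rewrite ltr_pdivlMr ?ltr_wpDl//.
  by have := nrm_ge0 (x - x'); nra.
have lf : linear f.
  move=> a x x'; apply/eqP; rewrite -subr_eq0; apply/eqP/nrm_small => e e0.
  (* The error below adds up to (2 |a| + 2) d, which this choice of d keeps under e. *)
  have d0 : 0 < e / (2 * (cn a + 2)) by rewrite divr_gt0// mulr_gt0// ltr_wpDl// cn_ge0.
  set d := e / _ in d0.
  have dE : (2 * cn a + 4) * d = e.
    by rewrite /d; field; have := cn_ge0 a; lra.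
  have [z [y g] xz] := approx x _ d0; have [z' [y' g'] xz'] := approx x' _ d0.
  have h := fG _ _ _ _ _ d0 g xz erefl; have h' := fG _ _ _ _ _ d0 g' xz' erefl.
  have a0 := cn_ge0 a.
  have c0 : 0 < (cn a + 1) * d by rewrite mulr_gt0//; lra.
  have h2 : nrm (f (a *: x + x') - (a *: y + y')) <= (cn a + 1) * d.
    apply: (fG _ _ _ _ _ c0 (GD a _ _ _ _ g g')) => //.
    rewrite opprD addrACA -scalerBr.
    rewrite (@le_trans _ _ (M * (cn a * nrm (x - z) + nrm (x' - z'))))//.
      by rewrite ler_wpM2l// (le_trans (nrmD _ _))// nrmZ.
    rewrite mulrDr mulrCA mulrDl mul1r lerD// ler_wpM2l//.
  have -> : f (a *: x + x') - (a *: f x + f x') =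
      (f (a *: x + x') - (a *: y + y')) - (a *: (f x - y) + (f x' - y')).
    by rewrite scalerBr [a *: f x - _ + _]addrACA -opprD opprB addrA subrK.
  rewrite (le_trans (nrmD _ _))// nrmN.
  have := nrmD (a *: (f x - y)) (f x' - y'); rewrite nrmZ.
  have : cn a * nrm (f x - y) <= cn a * d by rewrite ler_wpM2l.
  by lra.
have fM x : nrm (f x) <= M * nrm x.
  apply/ler_addgt0Pr => e e0; have e2 : 0 < e / 2 by lra.
  have [z [y g] xz] := approx x _ e2.
  have h := fG _ _ _ _ _ e2 g xz erefl.
  have := GM _ _ g; have := nrmD (f x - y) y; rewrite subrK.
  have : M * nrm z <= M * nrm x + M * nrm (x - z).
    rewrite -mulrDr ler_wpM2l//; have := nrmD x (z - x); rewrite addrC subrK.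
    by rewrite nrmB addrC.
  by lra.
have [T TE] := bop_exists lf fM.
by exists T => [x y /fE <-|x]; rewrite TE.
Qed.

End TotalSets.

(** * Operators prescribed on total families *)

Section Extension.
Variable R : realType.
Implicit Types E H K L : hilbertType R.

Lemma ext_op I (P : set I) H K (e : I -> H) (f : I -> K) M : 0 <= M ->
  clspan (e @` P) = setT ->
  (forall n (c : 'I_n -> R[i]) (a : 'I_n -> I), (forall i, P (a i)) ->
     nrm (\sum_i c i *: f (a i)) <= M * nrm (\sum_i c i *: e (a i))) ->
  exists2 T : bop H K, (forall i, P i -> T (e i) = f i) &
    forall x, nrm (T x) <= M * nrm x.
Proof.
move=> M0 te ef.
pose G x y := exists n (c : 'I_n -> R[i]) (a : 'I_n -> I),
  [/\ forall i, P (a i), x = \sum_i c i *: e (a i) & y = \sum_i c i *: f (a i)].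
have [x|b x y x' y'|x y|T TG TM] := @bop_graph _ _ _ G M M0.
- have : clspan (e @` P) x by rewrite te.
  apply: closure_subset => {}x [n [c [u [Pu ->]]]].
  have /choice[a aP] : forall i, exists j, P j /\ e j = u i.
    by move=> i; have [j Pj <-] := Pu i; exists j.
  exists (\sum_i c i *: f (a i)), n, c, a; split => // [i|]; first by case: (aP i).
  by apply: eq_bigr => i _; case: (aP i) => _ ->.
- move=> [n [c [u [Au -> ->]]]] [m [d [v [Av -> ->]]]].
  exists (n + m)%N, (fun i => match fintype.split i with inl j => b * c j | inr j => d j end),
    (fun i => match fintype.split i with inl j => u j | inr j => v j end); split.
  + by move=> i; case: (fintype.split i).
  + rewrite big_split_ord /= scaler_sumr; congr (_ + _); apply: eq_bigr => i _.
      by rewrite (unsplitK (inl i)) scalerA.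
    by rewrite (unsplitK (inr i)).
  + rewrite big_split_ord /= scaler_sumr; congr (_ + _); apply: eq_bigr => i _.
      by rewrite (unsplitK (inl i)) scalerA.
    by rewrite (unsplitK (inr i)).
- by move=> [n [c [a [Pa -> ->]]]]; exact: ef.
exists T => // i Pi; apply: TG; exists 1%N, (fun=> 1), (fun=> i).
by split=> //; rewrite big_ord1 scale1r.
Qed.

Lemma total_inner H (A : set H) x y : clspan A = setT ->
  (forall a, A a -> inner a x = inner a y) -> x = y.
Proof.
move=> tA axy; apply/eqP; rewrite -subr_eq0; apply/eqP/nrm_eq0/eqP.
rewrite -sqrf_eq0 -Re_inner_sqr.
suff -> : inner (x - y) (x - y) = 0 by [].
have : clspan A (x - y) by rewrite tA.
have : forall z, clspan A z -> inner z (x - y) = 0; last by move=> + Az; apply.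
move=> z Az; apply: (@nrm_small R (R[i]^o)) => e e0.
have [w Aw zw] : exists2 w, linspan A w & nrm (z - w) < e / (nrm (x - y) + 1).
  by apply: ((closureE _ _).1 Az); rewrite divr_gt0// ltr_wpDl ?nrm_ge0.
have w0 : inner w (x - y) = 0.
  apply: (@linspan_ind _ _ A (fun w => inner w (x - y) = 0)) => //.
    by rewrite inner0l.
  by move=> a u v Au; rewrite innerDl innerZl (innerBr u) (axy u)// subrr mulr0 add0r.
rewrite -[z](subrK w) innerDl w0 addr0.
rewrite (le_trans (cauchy_schwarz (z - w) (x - y)))//.
move: zw; rewrite ltr_pdivlMr ?ltr_wpDl ?nrm_ge0//.
by have := nrm_ge0 (x - y); have := nrm_ge0 (z - w); lra.
Qed.

Lemma nrm_isometry H K (T : bop H K) x : adj T \ob T = idop H -> nrm (T x) = nrm x.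
Proof.
move=> TT; apply/eqP; rewrite -(eqrXn2 (n := 2)) ?nrm_ge0// -!Re_inner_sqr adjP.
by rewrite -compopE TT.
Qed.

(** Equal Gram matrices give equal norms of finite combinations, so [ext_op] applies with bound 1;
    the same equality tested on the total set gives the isometry. *)
Lemma isometry_ext I (P : set I) H K (e : I -> H) (f : I -> K) :
  clspan (e @` P) = setT ->
  (forall i j, P i -> P j -> inner (f i) (f j) = inner (e i) (e j)) ->
  exists2 T : bop H K, (forall i, P i -> T (e i) = f i) & adj T \ob T = idop H.
Proof.
move=> te ef.
have [|n c a Pa|T Te _] := @ext_op I P H K e f 1 _ te; first by [].
  rewrite mul1r -ler_sqr ?nnegrE ?nrm_ge0// -!Re_inner_sqr !inner_suml.
  rewrite !cre_sum; apply: ler_sum => i _; rewrite !inner_sumr !cre_sum.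
  by apply: ler_sum => j _; rewrite !innerZl !innerZr ef.
exists T => //; apply: (total_ext te) => _ [i Pi <-]; apply: (total_inner te).
by move=> _ [j Pj <-]; rewrite /= -adjP !Te// ef.
Qed.

Lemma unitaryP H K (T : bop H K) (B : set K) : adj T \ob T = idop H ->
  clspan B = setT -> (forall y, B y -> exists x, T x = y) -> unitary_op T.
Proof.
move=> TT tB BT; split=> //; apply: (total_ext tB) => y /BT[x <-].
by rewrite /= -[adj T (T x)]/((adj T \ob T) x) TT.
Qed.

Lemma unitary_ext I (P : set I) H K (e : I -> H) (f : I -> K) :
  clspan (e @` P) = setT -> clspan (f @` P) = setT ->
  (forall i j, P i -> P j -> inner (f i) (f j) = inner (e i) (e j)) ->
  exists2 T : bop H K, (forall i, P i -> T (e i) = f i) & unitary_op T.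
Proof.
move=> te tf ef; have [T Te TT] := isometry_ext te ef; exists T => //.
apply: (unitaryP TT tf) => _ [i Pi <-]; exists (e i); exact: Te.
Qed.

Lemma unitary_adj H K (T : bop H K) : unitary_op T -> unitary_op (adj T).
Proof. by move=> [? ?]; split; rewrite adjK. Qed.

Lemma unitary_comp H K L (S : bop K L) (T : bop H K) :
  unitary_op S -> unitary_op T -> unitary_op (S \ob T).
Proof.
move=> [S1 S2] [T1 T2]; split; rewrite adjM.
  by rewrite -compopA (compopA (adj S)) S1 comp1op.
by rewrite -compopA (compopA T) T2 comp1op.
Qed.

End Extension.

Section OperatorSets.
Variable R : realType.
Implicit Types E H K L : hilbertType R.

Lemma compl_map H K L (S : bop K L) (A : set (bop H K)) (B : set (bop H L)) :
  closed_subspace B -> (forall T, A T -> B (S \ob T)) ->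
  forall T, clspan A T -> B (S \ob T).
Proof.
move=> cB AB; apply: (@clspan_map _ _ _ (fun T => S \ob T) (nrm S)) => //.
- by move=> x y; rewrite compDr.
- by move=> a x; exists a; rewrite compZr.
- by move=> x; apply: nrm_comp.
Qed.

Lemma compr_map H K L (S : bop H K) (A : set (bop K L)) (B : set (bop H L)) :
  closed_subspace B -> (forall T, A T -> B (T \ob S)) ->
  forall T, clspan A T -> B (T \ob S).
Proof.
move=> cB AB; apply: (@clspan_map _ _ _ (fun T => T \ob S) (nrm S)) => //.
- by move=> x y; rewrite compDl.
- by move=> a x; exists a; rewrite compZl.
- by move=> x; rewrite mulrC; apply: nrm_comp.
Qed.

Lemma adj_map H K (A : set (bop H K)) (B : set (bop K H)) :
  closed_subspace B -> (forall T, A T -> B (adj T)) ->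
  forall T, clspan A T -> B (adj T).
Proof.
move=> cB AB; apply: (@clspan_map _ _ _ (@adj _ H K) 1) => //.
- by move=> x y; rewrite adjD.
- by move=> a x; exists a^*%C; rewrite adjZ.
- by move=> x; rewrite nrm_adj mul1r.
Qed.

Lemma opprod_min H K L (A : set (bop K L)) (B : set (bop H K)) (C : set (bop H L)) :
  closed_subspace C -> (forall S T, A S -> B T -> C (S \ob T)) ->
  forall S T, clspan A S -> clspan B T -> C (S \ob T).
Proof.
move=> cC ABC S T cS cT; apply: (compr_map cC _ cS) => {cS}S AS.
by apply: (compl_map cC _ cT) => {cT}T BT; exact: ABC.
Qed.

Lemma sub_opprod H K L (A : set (bop K L)) (B : set (bop H K)) S T :
  A S -> B T -> clspan (opprod A B) (S \ob T).
Proof. by move=> AS BT; apply: sub_clspan; exists S => //; exists T. Qed.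

Lemma opprod_clspanl H K L (A : set (bop K L)) (B : set (bop H K)) :
  clspan (opprod (clspan A) B) = clspan (opprod A B).
Proof.
apply/seteqP; split; apply: clspan_sub => _ [S AS] [T BT] <-.
  apply: (opprod_min (clspan_closed _) _ AS (sub_clspan BT)).
  exact: sub_opprod.
by apply: sub_opprod => //; exact: sub_clspan.
Qed.

Lemma opprod_clspanr H K L (A : set (bop K L)) (B : set (bop H K)) :
  clspan (opprod A (clspan B)) = clspan (opprod A B).
Proof.
apply/seteqP; split; apply: clspan_sub => _ [S AS] [T BT] <-.
  apply: (opprod_min (clspan_closed _) _ (sub_clspan AS) BT).
  exact: sub_opprod.
by apply: sub_opprod => //; exact: sub_clspan.
Qed.

Lemma opprodA E H K L (A : set (bop K L)) (B : set (bop H K)) (C : set (bop E H)) :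
  opprod A (opprod B C) = opprod (opprod A B) C.
Proof.
apply/seteqP; split.
  move=> _ [S AS] [_ [T BT] [U CU] <-] <-; exists (S \ob T); first by exists S => //; exists T.
  by exists U => //; rewrite compopA.
move=> _ [_ [S AS] [T BT] <-] [U CU] <-; exists S => //; exists (T \ob U).
  by exists T => //; exists U.
by rewrite compopA.
Qed.

Lemma total_vecprod H K (A : set (bop H K)) (B : set (bop H K)) :
  A `<=` clspan B -> clspan (vecprod A) = setT -> clspan (vecprod B) = setT.
Proof.
move=> AB tA; apply/seteqP; split=> // y _; have : clspan (vecprod A) y by rewrite tA.
apply: clspan_sub => _ [T /AB AT [x _ <-]].
apply: (@clspan_map _ _ _ (fun T : bop H K => T x) (nrm x) B) AT => //.
- by move=> a S; exists a.
- by move=> S; rewrite mulrC nrm_bop.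
- exact: clspan_closed.
- by move=> S BS; apply: sub_clspan; exists S => //; exists x.
Qed.

Lemma total_opprod E H K (A : set (bop H K)) (B : set (bop E H)) :
  clspan (vecprod A) = setT -> clspan (vecprod B) = setT ->
  clspan (vecprod (opprod A B)) = setT.
Proof.
move=> tA tB; apply/seteqP; split=> // y _; have : clspan (vecprod A) y by rewrite tA.
apply: clspan_sub => _ [T AT [x _ <-]].
apply: (total_ind tB (clspan_closed _)) => _ [S BS [z _ <-]].
by apply: sub_clspan; exists (T \ob S); [exists T => //; exists S|exists z].
Qed.

Lemma vecprod_ext H K L (A : set (bop H K)) (S T : bop K L) :
  clspan (vecprod A) = setT -> (forall U, A U -> S \ob U = T \ob U) -> S = T.
Proof.
move=> tA ST; apply: (total_ext tA) => _ [U AU [x _ <-]].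
by rewrite -!compopE ST.
Qed.

(** The adjoint of [U] inverts composition with [U], so the image of a closed span is again
    closed. *)
Lemma opimage_clspan H K L (U : bop K L) (A : set (bop H K)) :
  unitary_op U -> opimage U (clspan A) = clspan (opimage U A).
Proof.
move=> uU; apply/seteqP; split.
  move=> _ [T AT <-]; apply: (compl_map (clspan_closed _) _ AT) => S AS.
  by apply: sub_clspan; exists S.
move=> T AT; exists (adj U \ob T); last by rewrite compopA uU.2 comp1op.
apply: (compl_map (clspan_closed _) _ AT) => _ [S AS <-].
by rewrite compopA uU.1 comp1op; exact: sub_clspan.
Qed.

End OperatorSets.

(** * Positive definite kernels *)

Section RieszNagy.
Variables (R : realType) (V : lmodType R[i]) (f : V -> V -> R).
Hypothesis fD : forall x y z, f (x + y) z = f x z + f y z.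
Hypothesis fC : forall x y, f x y = f y x.
Hypothesis fZ : forall (t : R) x y, f (t%:C *: x) y = t * f x y.
Hypothesis f_ge0 : forall x, 0 <= f x x.

Let fDr x y z : f x (y + z) = f x y + f x z.
Proof. by rewrite fC fD !(fC x). Qed.

Let fN x y : f (- x) y = - f x y.
Proof. by have := fZ (-1) x y; rewrite rmorphN1 scaleN1r mulN1r. Qed.

Let fNr x y : f x (- y) = - f x y.
Proof. by rewrite fC fN fC. Qed.

Let fZr t x y : f x (t%:C *: y) = t * f x y.
Proof. by rewrite fC fZ fC. Qed.

Let f_cs x y : f x y ^+ 2 <= f x x * f y y.
Proof.
have := @quadratic_bound R (f x x) (f y y) (f x y)%:C.
rewrite cnR real_normK ?num_real//; apply=> // z.
have := f_ge0 (x + (complex.Re z)%:C *: y).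
rewrite fD !fDr !fZ !fZr creM /= mulr0 subr0 (fC y x).
have := cn_sqr z; have := sqr_ge0 (complex.Im z); have := f_ge0 y.
by move=> fy zi ->; nra.
Qed.

Variables A D : V -> V.
Hypothesis AD : forall x y, A (x + y) = A x + A y.
Hypothesis DD : forall x y, D (x + y) = D x + D y.
Hypothesis Asym : forall x y, f (A x) y = f x (A y).
Hypothesis Dsym : forall x y, f (D x) y = f x (D y).
Hypothesis comm : forall x, A (D x) = D (A x).
Hypothesis A_ge0 : forall x, 0 <= f x (A x).
Hypothesis A_le1 : forall x, f x (A x) <= f x x.
Hypothesis D_ge0 : forall x, 0 <= f x (D x).

(* Telescoping: A = A_0^2 + ... + A_(n-1)^2 + A_n. *)
Fixpoint riesz_nagy_iter n : V -> V :=
  if n is n'.+1 then fun x =>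
    riesz_nagy_iter n' x - riesz_nagy_iter n' (riesz_nagy_iter n' x) else A.
Local Notation An := riesz_nagy_iter.

Let AnD n x y : An n (x + y) = An n x + An n y.
Proof.
by elim: n x y => //= n IH x y; rewrite !IH opprD addrACA.
Qed.

Let AnN n x : An n (- x) = - An n x.
Proof.
have An0 : An n 0 = 0.
  by have := AnD n 0 0; rewrite addr0 => /eqP; rewrite -subr_eq subrr => /eqP.
by apply/eqP; rewrite -subr_eq0 opprK -AnD addNr An0.
Qed.

Let Ansym n x y : f (An n x) y = f x (An n y).
Proof.
by elim: n x y => //= n IH x y; rewrite fD fN !IH fDr fNr.
Qed.

Let DN x : D (- x) = - D x.
Proof.
have D0 : D 0 = 0.
  by have := DD 0 0; rewrite addr0 => /eqP; rewrite -subr_eq subrr => /eqP.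
by apply/eqP; rewrite -subr_eq0 opprK -DD addNr D0.
Qed.

Let Ancomm n x : An n (D x) = D (An n x).
Proof. by elim: n x => //= n IH x; rewrite !IH DD DN. Qed.

(** The lower bound survives the step because A_n - A_n^2 = A_n (1 - A_n) A_n + (1 - A_n) A_n (1 -
    A_n). *)
Let An_bounds n : forall x, 0 <= f x (An n x) <= f x x.
Proof.
elim: n => [x|n IH x]; first by rewrite A_ge0 A_le1.
have [h1 h2] := andP (IH x).
rewrite [An n.+1 x]/= fDr fNr -(Ansym n x (An n x)).
have [k1 k2] := andP (IH (An n x)).
have [l1 l2] := andP (IH (x - An n x)).
apply/andP; split; last by have := f_ge0 (An n x); lra.
have e : f x (An n (An n x)) = f (An n x) (An n x) by rewrite Ansym.
move: k1 k2 l1; rewrite AnD AnN !(fD, fDr, fN, fNr) e.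
by lra.
Qed.

Let An_sum x n : \sum_(k < n) f (An k x) (An k x) <= f x x.
Proof.
suff e : \sum_(k < n) f (An k x) (An k x) + f x (An n x) = f x (A x).
  by have := A_le1 x; have /andP[] := An_bounds n x; lra.
elim: n => [|n IH]; first by rewrite big_ord0 add0r.
by rewrite big_ord_recr /= fDr fNr -(Ansym n x (An n x)) -IH; ring.
Qed.

(** D commutes with A_n, so D A_n^2 = A_n D A_n is positive and each step can only lower the form of
    D A_n. *)
Let DAn_le x n : f x (D (An n x)) <= f x (D (A x)).
Proof.
elim: n => //= n IH; rewrite DD DN fDr fNr.
rewrite -(Ancomm n (An n x)) -(Ansym n x).
by have := D_ge0 (An n x); lra.
Qed.

(** No limit is taken. If the value were negative, all f x (D (A_k x)) would stay below it, while
    the squares ||A_k x||^2 have bounded sum by telescoping; Cauchy-Schwarz then bounds n times a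
    fixed positive number independently of n. *)
Lemma riesz_nagy x : 0 <= f x (D (A x)).
Proof.
rewrite leNgt; apply/negP => neg.
have S n : n%:R * f x (D (A x)) ^+ 2 <= f (D x) (D x) * f x x.
  rewrite -[n in n%:R]card_ord -sum1_card natr_sum mulr_suml.
  rewrite (@le_trans _ _ (\sum_(k < n) f (D x) (D x) * f (An k x) (An k x)))//.
    apply: ler_sum => k _; rewrite mul1r (le_trans _ (f_cs _ _))// Dsym.
    by have := DAn_le x k; nra.
  by rewrite -mulr_sumr ler_wpM2l.
have e0 : 0 < f x (D (A x)) ^+ 2 by rewrite exprn_even_gt0//= lt_eqF.
have := S (Num.bound (f (D x) (D x) * f x x / f x (D (A x)) ^+ 2)).
rewrite -ler_pdivlMr// => h; move: h; rewrite leNgt => /negP[].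
by apply: archi_boundP; rewrite divr_ge0 ?sqr_ge0// mulr_ge0.
Qed.

End RieszNagy.

Section SchurProduct.
Variables (R : realType) (E : hilbertType R) (I : finType).
Implicit Types p q : I -> I -> bop E E.

Definition psd p := (forall i j, adj (p i j) = p j i) /\
  (forall x : I -> E, 0 <= complex.Re (\sum_i \sum_j inner (x i) (p i j (x j)))).

Let V := (I * I -> E)%type.
Let f (x y : V) : R := complex.Re (\sum_k inner (x k) (y k)).

Let fE x y : f x y = \sum_i \sum_l complex.Re (inner (x (i, l)) (y (i, l))).
Proof. by rewrite /f cre_sum pair_bigA; apply: eq_bigr => -[i l]. Qed.

(* The entrywise product is the compression of p (x) q to the diagonal. *)
Lemma schur_psd p q : psd p -> psd q ->
  (forall i j l m, p i j \ob q l m = q l m \ob p i j) ->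
  forall x : I -> E,
  0 <= complex.Re (\sum_i \sum_j inner (x i) (p i j (q i j (x j)))).
Proof.
move=> [pa p0] [qa q0] pq x.
(* M bounds the matrix p as an operator on families, so that A, which is p / M tensored with 1, lies
   between 0 and 1; the summand 1 keeps M positive. *)
pose M := \sum_i \sum_j nrm (p i j) + 1.
have M0 : 0 < M.
  by rewrite ltr_wpDl// sumr_ge0// => i _; rewrite sumr_ge0// => j _; rewrite nrm_ge0.
pose A (u : V) : V := fun k => M^-1%:C *: \sum_j p k.1 j (u (j, k.2)).
pose D (u : V) : V := fun k => \sum_m q k.2 m (u (k.1, m)).
(* The vector x placed on the diagonal: pairing with it keeps exactly the products of entries with
   equal indices. *)
pose X : V := fun k => if k.1 == k.2 then x k.1 else 0.
have -> : complex.Re (\sum_i \sum_j inner (x i) (p i j (q i j (x j)))) =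
    M * f X (D (A X)).
  rewrite fE mulr_sumr cre_sum; apply: eq_bigr => i _.
  rewrite [X in _ = M * X](bigD1 i)//= [X in _ = M * (_ + X)]big1 ?addr0; last first.
    by move=> l /negPf li; rewrite /X /= eq_sym li inner0l.
  rewrite /X /= eqxx /D /= inner_sumr !cre_sum mulr_sumr; apply: eq_bigr => j _.
  rewrite /A /= (bigD1 j)//= big1 ?addr0 => [|l /negPf li]; last first.
    by rewrite /X /= li linear0.
  rewrite /X /= eqxx linearZ /= innerZr creMR mulrA divff ?gt_eqF// mul1r.
  by rewrite -!compopE pq.
rewrite mulr_ge0 ?(ltW M0)//; apply: (@riesz_nagy R (I * I -> E)%type f).
- by move=> u v w; rewrite /f -creD -big_split; congr complex.Re; apply: eq_bigr => k _; rewrite innerDl.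
- by move=> u v; rewrite /f !cre_sum; apply: eq_bigr => k _; rewrite Re_innerC.
- move=> t u v; rewrite /f !cre_sum mulr_sumr; apply: eq_bigr => k _.
  by rewrite innerZl conjc_real creMR.
- by move=> u; rewrite /f cre_sum sumr_ge0// => k _; rewrite Re_inner_sqr sqr_ge0.
- move=> u v; apply/funext => k; rewrite /A !fctE -scalerDr -big_split.
  by congr (_ *: _); apply: eq_bigr => j _; rewrite /= linearD.
- move=> u v; apply/funext => k; rewrite /D !fctE -big_split.
  by apply: eq_bigr => j _; rewrite /= linearD.
- move=> u v; rewrite !fE exchange_big [RHS]exchange_big; apply: eq_bigr => l _.
  rewrite /A /=.
  under eq_bigr => i _ do rewrite innerZl conjc_real creMR inner_suml cre_sum mulr_sumr.
  under [RHS]eq_bigr => i _ do rewrite innerZr creMR inner_sumr cre_sum mulr_sumr.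
  rewrite exchange_big; apply: eq_bigr => i _; apply: eq_bigr => j _.
  by rewrite adjP pa.
- move=> u v; rewrite !fE; apply: eq_bigr => i _; rewrite /D /=.
  under eq_bigr => l _ do rewrite inner_suml cre_sum.
  under [RHS]eq_bigr => l _ do rewrite inner_sumr cre_sum.
  rewrite exchange_big; apply: eq_bigr => l _; apply: eq_bigr => j _.
  by rewrite adjP qa.
- move=> u; apply/funext => k; rewrite /A /D /= scaler_sumr.
  transitivity (\sum_j \sum_m (M^-1)%:C *: p k.1 j (q k.2 m (u (j, m)))).
    by apply: eq_bigr => j _; rewrite bop_sumr scaler_sumr.
  rewrite exchange_big; apply: eq_bigr => m _; rewrite linearZ /= bop_sumr scaler_sumr.
  by apply: eq_bigr => j _; rewrite -!compopE pq.
- move=> u; rewrite fE exchange_big sumr_ge0// => l _.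
  rewrite /A /=; under eq_bigr => i _ do rewrite innerZr creMR inner_sumr.
  by rewrite -mulr_sumr mulr_ge0 ?invr_ge0 ?(ltW M0)// -cre_sum; exact: (p0 (fun i => u (i, l))).
- move=> u; rewrite !fE exchange_big [leRHS]exchange_big; apply: ler_sum => l _.
  rewrite /A /=; under eq_bigr => i _ do rewrite innerZr creMR.
  rewrite -mulr_sumr mulrC ler_pdivrMr// -cre_sum.
  rewrite (le_trans (ler_norm _))// (le_trans (Re_le_cn _))//.
  under [X in cn X]eq_bigr => i _ do rewrite inner_sumr.
  under [X in X * _]eq_bigr => i _ do rewrite Re_inner_sqr.
  (* Each product ||u_i|| ||u_j|| is at most N, so the form of p is at most N times the sum of the
     norms of its entries, which is M - 1. *)
  set N := \sum_i _ ^+ 2.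
  have nN i : nrm (u (i, l)) ^+ 2 <= N.
    by rewrite /N (bigD1 i)//= lerDl sumr_ge0// => j _; rewrite sqr_ge0.
  have N0 : 0 <= N by rewrite /N sumr_ge0// => j _; rewrite sqr_ge0.
  have cn_sum J (r : seq J) F : cn (\sum_(j <- r) F j : R[i]) <= \sum_(j <- r) cn (F j).
    by elim/big_ind2: _ => [|a b c d ? ?|//]; rewrite ?cn0// (le_trans (cnD _ _))// lerD.
  rewrite (le_trans (cn_sum _ _ _))// (@le_trans _ _ (N * (M - 1)))//; last first.
    by rewrite ler_wpM2l// gerBl.
  rewrite /M addrK mulr_sumr ler_sum// => i _.
  rewrite (le_trans (cn_sum _ _ _))// mulr_sumr ler_sum// => j _.
  rewrite (le_trans (cauchy_schwarz _ _))//.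
  have := nrm_bop (p i j) (u (j, l)); have := nN i; have := nN j.
  have := nrm_ge0 (u (i, l)); have := nrm_ge0 (u (j, l)); have := nrm_ge0 (p i j).
  move: (nrm (p i j)) (nrm (u (i, l))) (nrm (u (j, l))) (nrm _) => a b c d a0 c0 b0 cN bN da.
  have bc : b * c <= N by have := sqr_ge0 (b - c); nra.
  by nra.
- move=> u; rewrite fE sumr_ge0// => i _.
  rewrite /D /=; under eq_bigr => l _ do rewrite inner_sumr.
  by rewrite -cre_sum; exact: (q0 (fun l => u (i, l))).
Qed.

End SchurProduct.

Section ComplexNets.
Variable R : realType.

Lemma real_net (S : R -> set R) :
  (forall e : R, 0 < e -> S e !=set0) ->
  (forall (e d : R) x y, 0 < e -> 0 < d -> S e x -> S d y -> `|x - y| <= e + d) ->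
  exists l, forall e : R, 0 < e -> forall x, S e x -> `|l - x| <= e.
Proof.
move=> S0 SS; pose D : set R := [set t | exists (e : R) x, [/\ 0 < e, S e x & t = x - e]].
have ubD d y : 0 < d -> S d y -> ubound D (y + d).
  move=> d0 Sy _ [e [x [e0 Sx ->]]].
  by have := SS _ _ _ _ e0 d0 Sx Sy; rewrite ler_norml => /andP[]; lra.
have [x1 Sx1] := S0 1 ltr01.
have hD : has_sup D.
  by split; [exists (x1 - 1), 1, x1|exists (x1 + 1); exact: ubD].
exists (sup D) => e e0 x Sx; rewrite ler_norml; apply/andP; split.
  suff : x - e <= sup D by lra.
  by apply: (sup_upper_bound hD); exists e, x.
suff : sup D <= x + e by lra.
by apply: ge_sup; [case: hD|exact: ubD].
Qed.

Lemma cn_le_Re_Im (z : R[i]) : cn z <= `|complex.Re z| + `|complex.Im z|.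
Proof.
rewrite -ler_sqr ?nnegrE ?cn_ge0 ?addr_ge0// cn_sqr.
rewrite -(real_normK (num_real (complex.Re z))) -(real_normK (num_real (complex.Im z))).
by have := normr_ge0 (complex.Re z); have := normr_ge0 (complex.Im z); nra.
Qed.

Lemma Im_le_cn (z : R[i]) : `|complex.Im z| <= cn z.
Proof.
rewrite -ler_sqr ?nnegrE ?cn_ge0// cn_sqr real_normK ?num_real//.
by rewrite lerDr sqr_ge0.
Qed.

Lemma complex_net (S : R -> set R[i]) :
  (forall e : R, 0 < e -> S e !=set0) ->
  (forall (e d : R) x y, 0 < e -> 0 < d -> S e x -> S d y -> cn (x - y) <= e + d) ->
  exists l, forall e : R, 0 < e -> forall x, S e x -> cn (l - x) <= e.
Proof.
move=> S0 SS.
have [e e0|e d _ _ e0 d0 [z Sz <-] [w Sw <-]|a aP] := @real_net (fun e => @complex.Re R @` S e).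
- by have [x Sx] := S0 e e0; exists (complex.Re x), x.
- by have := Re_le_cn (z - w); have := SS _ _ _ _ e0 d0 Sz Sw; rewrite creD creN; lra.
have [e e0|e d _ _ e0 d0 [z Sz <-] [w Sw <-]|b bP] := @real_net (fun e => @complex.Im R @` S e).
- by have [x Sx] := S0 e e0; exists (complex.Im x), x.
- by have := Im_le_cn (z - w); have := SS _ _ _ _ e0 d0 Sz Sw; rewrite cimD cimN; lra.
exists (a +i* b) => e e0 x Sx; apply/ler_addgt0Pr => d d0.
have d3 : 0 < d / 3 by lra.
(* The coordinates alone would bound the distance only by a multiple of e. Passing through a (d /
   3)-approximation y gives e + d with d arbitrary. *)
have [y Sy] := S0 _ d3.
have ya : `|a - complex.Re y| <= d / 3 by apply: aP => //; exists y.
have yb : `|b - complex.Im y| <= d / 3 by apply: bP => //; exists y.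
have := SS _ _ _ _ d3 e0 Sy Sx.
have := cnD (a +i* b - y) (y - x); rewrite addrA subrK.
have := cn_le_Re_Im (a +i* b - y); rewrite creD creN cimD cimN /=.
by lra.
Qed.

Lemma cn_small (z : R[i]) : (forall e, 0 < e -> cn z <= e) -> z = 0.
Proof.
move=> ze; apply/cn_eq0/le_anti; rewrite cn_ge0 andbT.
by apply/ler_addgt0Pr => e e0; rewrite add0r ze.
Qed.

Lemma cn_small_lin (z : R[i]) (M : R) : (forall e, 0 < e -> e <= 1 -> cn z <= e * M) -> z = 0.
Proof.
move=> zM; apply: cn_small => e e0.
have M0 : 0 <= `|M| by [].
pose d := Num.min 1 (e / (`|M| + 1)).
have d0 : 0 < d by rewrite lt_min ltr01 divr_gt0// ltr_wpDl.
have d1 : d <= 1 by rewrite ge_min lexx.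
have dM : d * (`|M| + 1) <= e.
  by rewrite -ler_pdivlMr ?ltr_wpDl// ge_min lexx orbT.
by have := zM d d0 d1; have := ler_norm M; nra.
Qed.

End ComplexNets.

Record psd_kernel (R : realType) (I : Type) := PsdKernel {
  ker : I -> I -> R[i] ;
  kerC : forall i j, ker j i = (ker i j)^*%C ;
  ker_psd : forall n (c : 'I_n -> R[i]) (a : 'I_n -> I),
    0 <= complex.Re (\sum_i \sum_j (c i)^*%C * c j * ker (a i) (a j))
}.

(* Reproducing kernel Hilbert space: the closure, in the antidual of the
   formal combinations of points of I, of the functions [kfun u]. *)
Section KernelSpace.
Variables (R : realType) (I : Type) (k : psd_kernel R I).
Implicit Types (u v w : seq (R[i] * I)) (f g h : I -> R[i]) (e d : R).

Definition kfun u : I -> R[i] := fun i => \sum_(q <- u) q.1 * ker k i q.2.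

(** [w] stands for a formal combination of points, and [kev w f] is the value at w of the antilinear
    extension of f; thus [kev u (kfun v)] is the inner product of the combinations u and v. *)
Definition kev w f : R[i] := \sum_(p <- w) (p.1)^*%C * f p.2.

Definition kscale (a : R[i]) u := [seq (a * p.1, p.2) | p <- u].

Lemma kfunD u v : kfun (u ++ v) = kfun u + kfun v.
Proof. by apply/funext => i; rewrite /kfun big_cat. Qed.

Lemma kfunZ a u : kfun (kscale a u) = a *: kfun u.
Proof.
apply/funext => i; rewrite /kfun fctE big_map /= scaler_sumr.
by apply: eq_bigr => p _; rewrite -mulrA.
Qed.

Lemma kev_cat u v f : kev (u ++ v) f = kev u f + kev v f.
Proof. by rewrite /kev big_cat. Qed.

Lemma kev_scale a u f : kev (kscale a u) f = a^*%C * kev u f.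
Proof.
rewrite /kev big_map mulr_sumr; apply: eq_bigr => p _ /=.
by rewrite cjM mulrA.
Qed.

Lemma kev1 i f : kev [:: (1, i)] f = f i.
Proof. by rewrite /kev big_seq1 conjc1 mul1r. Qed.

Lemma kevD w f g : kev w (f + g) = kev w f + kev w g.
Proof. by rewrite /kev -big_split; apply: eq_bigr => p _; rewrite fctE mulrDr. Qed.

Lemma kevZ w a f : kev w (a *: f) = a * kev w f.
Proof. by rewrite /kev mulr_sumr; apply: eq_bigr => p _; rewrite fctE mulrCA. Qed.

Lemma kevB w f g : kev w (f - g) = kev w f - kev w g.
Proof. by rewrite -[- g]scaleN1r kevD kevZ mulN1r. Qed.

Lemma kev_kfunC u v : kev u (kfun v) = (kev v (kfun u))^*%C.
Proof.
rewrite /kev /kfun cj_sum.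
under eq_bigr => p _ do rewrite mulr_sumr.
rewrite exchange_big; apply: eq_bigr => q _; rewrite cjM cjK cj_sum mulr_sumr.
by apply: eq_bigr => p _; rewrite cjM -kerC mulrCA.
Qed.

Lemma kev_ge0 u : 0 <= complex.Re (kev u (kfun u)).
Proof.
rewrite /kev /kfun big_tnth.
under eq_bigr => i _ do rewrite big_tnth mulr_sumr.
under eq_bigr => i _ do under eq_bigr => j _ do rewrite mulrA.
exact: (ker_psd k (fun i => (tnth (in_tuple u) i).1) (fun i => (tnth (in_tuple u) i).2)).
Qed.

Definition knrm u : R := Num.sqrt (complex.Re (kev u (kfun u))).

Lemma knrm_ge0 u : 0 <= knrm u. Proof. exact: sqrtr_ge0. Qed.

Lemma knrm_sqr u : knrm u ^+ 2 = complex.Re (kev u (kfun u)).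
Proof. by rewrite sqr_sqrtr// kev_ge0. Qed.

Lemma kev_cs u v : cn (kev u (kfun v)) <= knrm v * knrm u.
Proof.
rewrite -ler_sqr ?nnegrE ?cn_ge0 ?mulr_ge0 ?knrm_ge0// exprMn !knrm_sqr mulrC.
apply: quadratic_bound => [|z]; first exact: kev_ge0.
have := kev_ge0 (u ++ kscale z v).
rewrite kev_cat kev_scale kfunD kfunZ !kevD !kevZ !creD (kev_kfunC v u).
rewrite !(creM, cimM, creD, cimD, creJ, cimJ) cn_sqr.
have -> : complex.Im (kev v (kfun v)) = 0.
  by have := congr1 (@complex.Im R) (kev_kfunC v v); rewrite cimJ; lra.
by nra.
Qed.

(** The dual norm of f is at most e. It is kept as a relation because a norm is available only after
    the inner product has been extended to limits. *)
Definition kbdd f e := forall w, cn (kev w f) <= e * knrm w.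

Lemma kbddD f g e d : kbdd f e -> kbdd g d -> kbdd (f + g) (e + d).
Proof.
by move=> fe gd w; rewrite kevD mulrDl (le_trans (cnD _ _))// lerD.
Qed.

Lemma kbddZ a f e : kbdd f e -> kbdd (a *: f) (cn a * e).
Proof. by move=> fe w; rewrite kevZ cnM -mulrA ler_wpM2l ?cn_ge0. Qed.

Lemma kbddW f e d : e <= d -> kbdd f e -> kbdd f d.
Proof. by move=> ed fe w; rewrite (le_trans (fe w))// ler_wpM2r ?knrm_ge0. Qed.

Lemma kbddN f e : kbdd f e -> kbdd (- f) e.
Proof. by move/(kbddZ (- 1)); rewrite scaleN1r cnN cnR normr1 mul1r. Qed.

Lemma kbddB f g e d : kbdd f e -> kbdd g d -> kbdd (f - g) (e + d).
Proof. by move=> fe /kbddN; exact: kbddD. Qed.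

Lemma kbdd_kfun u : kbdd (kfun u) (knrm u).
Proof. by move=> w; exact: kev_cs. Qed.

Lemma kbdd0 e : 0 <= e -> kbdd 0 e.
Proof.
move=> e0 w; rewrite (_ : kev w 0 = 0) ?cn0 ?mulr_ge0 ?knrm_ge0//.
by rewrite /kev big1// => p _; rewrite mulr0.
Qed.

(** Since elements are functions on I, combinations of norm zero coincide with 0, so no quotient by
    null vectors is formed, and limits can be found pointwise. *)
Definition kspace_pred : {pred I -> R[i]} :=
  [pred f | `[< forall e, 0 < e -> exists u, kbdd (f - kfun u) e >]].

Record kspace := KSpace { kspace_val :> I -> R[i] ; _ : kspace_val \in kspace_pred }.

HB.instance Definition _ := [isSub for kspace_val].
HB.instance Definition _ := gen_eqMixin kspace.
HB.instance Definition _ := gen_choiceMixin kspace.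

Lemma kspace_submod : submod_closed kspace_pred.
Proof.
split=> [|a f g /asboolP fP /asboolP gP].
  apply/asboolP => e e0; exists [::].
  rewrite [kfun _](_ : _ = 0) ?subr0; first exact/kbdd0/ltW.
  by apply/funext => i; rewrite /kfun big_nil.
apply/asboolP => e e0.
have d0 : 0 < e / (2 * (cn a + 1)) by rewrite divr_gt0// mulr_gt0// ltr_wpDl// cn_ge0.
have e2 : 0 < e / 2 by lra.
have [u fu] := fP _ d0; have [v gv] := gP _ e2.
exists (kscale a u ++ v); rewrite kfunD kfunZ opprD addrACA -scalerBr.
apply: kbddW (kbddD (kbddZ a fu) gv).
have a0 := cn_ge0 a.
suff : cn a * (e / (2 * (cn a + 1))) <= e / 2 by lra.
rewrite [leLHS](_ : _ = e / 2 * (cn a / (cn a + 1))); last by field; lra.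
by rewrite ger_pMr// ler_pdivrMr ?mul1r; lra.
Qed.

HB.instance Definition _ :=
  GRing.isSubmodClosed.Build R[i] (I -> R[i]) kspace_pred kspace_submod.
HB.instance Definition _ := [SubChoice_isSubLmodule of kspace by <:].

Local Notation W := kspace.
Local Notation kv := (@kspace_val).
Implicit Types F G : W.

Lemma kspaceP F e : 0 < e -> exists u, kbdd (kv F - kfun u) e.
Proof. by case: F => f /= /asboolP; apply. Qed.

Lemma kspace_bdd F : exists2 M, 0 <= M & kbdd F M.
Proof.
have [u Fu] := kspaceP F ltr01.
exists (1 + knrm u); first by rewrite addr_ge0 ?knrm_ge0.
by have := kbddD Fu (kbdd_kfun u); rewrite subrK.
Qed.

Lemma knrm_le u e : 0 <= e -> kbdd (kfun u) e -> knrm u <= e.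
Proof.
move=> e0 /(_ u) ue; have := knrm_ge0 u; rewrite le_eqVlt => /predU1P[<-//|u0].
rewrite -(ler_pM2r u0) -expr2 knrm_sqr (le_trans (ler_norm _))//.
by rewrite (le_trans (Re_le_cn _)).
Qed.

Lemma kev_dist u v f g e d M : 0 <= e -> 0 <= d -> 0 <= M ->
  kbdd (f - kfun u) e -> kbdd (f - kfun v) d -> kbdd g M ->
  cn (kev u g - kev v g) <= M * (e + d).
Proof.
move=> e0 d0 M0 fu fv gM.
rewrite (_ : _ - _ = kev (u ++ kscale (-1) v) g); last first.
  by rewrite kev_cat kev_scale cjN conjc1 mulN1r.
rewrite (le_trans (gM _))// ler_wpM2l//; apply: knrm_le; first by rewrite addr_ge0.
rewrite kfunD kfunZ scaleN1r (addrC e).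
have -> : kfun u - kfun v = (f - kfun v) - (f - kfun u); last exact: kbddB.
by rewrite opprB [RHS]addrC addrA subrK.
Qed.

(** The inner product as the limit of [kev u G] when [kfun u] tends to F, with an explicit rate; the
    rate determines s, so [xget] has a definite value. *)
Definition kinner_spec F G (s : R[i]) := forall e M, 0 < e -> 0 <= M ->
  forall u, kbdd (kv F - kfun u) e -> kbdd G M -> cn (s - kev u G) <= e * M.

Lemma kinner_ex F G : exists s, kinner_spec F G s.
Proof.
have [M M0 GM] := kspace_bdd G; have M1 : 0 < M + 1 by lra.
have [e e0|e d _ _ e0 d0 [u Fu <-] [v Fv <-]|s sP] :=
    @complex_net R (fun e => [set kev u G | u in [set u | kbdd (kv F - kfun u) (e / (M + 1))]]).
- have [u Fu] := kspaceP F (divr_gt0 e0 M1).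
  by exists (kev u G), u.
- have e1 : 0 <= e / (M + 1) by rewrite divr_ge0// ltW.
  have d1 : 0 <= d / (M + 1) by rewrite divr_ge0// ltW.
  rewrite (le_trans (kev_dist e1 d1 M0 Fu Fv GM))//.
  rewrite -mulrDl mulrCA ger_pMr ?addr_gt0// ler_pdivrMr//; lra.
exists s => e N e0 N0 u Fu GN; apply/ler_addgt0Pr => d d0.
(* s was built from one particular bound M of G. A further approximation v transfers the estimate to
   an arbitrary bound N. *)
have c0 : 0 < d / ((M + 1) + N) by rewrite divr_gt0//; lra.
set c := d / _ in c0.
have cE : c * ((M + 1) + N) = d by rewrite /c; field; lra.
have [v Fv] := kspaceP F c0.
have h1 : cn (s - kev v G) <= c * (M + 1).
  by apply: sP; [rewrite mulr_gt0|exists v => //; rewrite /= mulfK//; lra].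
have h2 := kev_dist (ltW c0) (ltW e0) N0 Fv Fu GN.
have := cnD (s - kev v G) (kev v G - kev u G); rewrite addrA subrK.
by lra.
Qed.

Definition kinner F G : R[i] := xget 0 (kinner_spec F G).

Lemma kinnerP F G : kinner_spec F G (kinner F G).
Proof. by apply: xgetPex; exact: kinner_ex. Qed.

Lemma kinner_approx F e : 0 < e -> exists u, [/\ kbdd (kv F - kfun u) e &
  forall G M, 0 <= M -> kbdd G M -> cn (kinner F G - kev u G) <= e * M].
Proof.
move=> e0; have [u Fu] := kspaceP F e0; exists u; split=> // G M M0 GM.
exact: kinnerP.
Qed.

Lemma kinner_linear F : linear_for *%R (kinner F).
Proof.
move=> a G H; apply/eqP; rewrite -subr_eq0; apply/eqP.
have [M M0 GM] := kspace_bdd G; have [N N0 HN] := kspace_bdd H.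
apply: (@cn_small_lin _ _ (2 * (cn a * M + N))) => e e0 _.
have [u [_ uP]] := kinner_approx F e0.
have h1 := uP G M M0 GM; have h2 := uP H N N0 HN.
have c0 := cn_ge0 a.
have h3 : cn (kinner F (a *: G + H) - (a * kev u G + kev u H)) <= e * (cn a * M + N).
  rewrite -kevZ -kevD; apply: uP; first by rewrite addr_ge0// mulr_ge0.
  exact/kbddD/HN/kbddZ.
rewrite (_ : _ - _ = (kinner F (a *: G + H) - (a * kev u G + kev u H)) -
  (a * (kinner F G - kev u G) + (kinner F H - kev u H))); last by rewrite /=; ring.
rewrite (le_trans (cnD _ _))// cnN.
have := cnD (a * (kinner F G - kev u G)) (kinner F H - kev u H).
rewrite cnM; have : cn a * cn (kinner F G - kev u G) <= cn a * (e * M) by rewrite ler_wpM2l.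
by lra.
Qed.

Lemma kfun_in u : kfun u \in kspace_pred.
Proof. by apply/asboolP => e e0; exists u; rewrite subrr; exact/kbdd0/ltW. Qed.

Definition kpt u : W := KSpace (kfun_in u).

Lemma kinner_pt u F : kinner (kpt u) F = kev u F.
Proof.
have [M M0 FM] := kspace_bdd F.
apply/eqP; rewrite -subr_eq0; apply/eqP/(@cn_small_lin _ _ M) => e e0 _.
by apply: kinnerP => //; rewrite subrr; exact/kbdd0/ltW.
Qed.

Lemma knrm_bound F M e u : 0 <= e -> 0 <= M -> kbdd F M -> kbdd (kv F - kfun u) e ->
  knrm u <= M + e.
Proof.
move=> e0 M0 FM Fu; apply: knrm_le; first by rewrite addr_ge0.
have -> : kfun u = kv F - (kv F - kfun u); last exact: kbddB.
by rewrite opprB addrC subrK.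
Qed.

Lemma kinnerC F G : kinner G F = (kinner F G)^*%C.
Proof.
have [M M0 FM] := kspace_bdd F; have [N N0 GN] := kspace_bdd G.
apply/eqP; rewrite -subr_eq0; apply/eqP.
apply: (@cn_small_lin _ _ (2 * (M + N + M + N + 2))) => e e0 e1.
have [u [Fu uP]] := kinner_approx F e0; have [v [Gv vP]] := kinner_approx G e0.
have h1 := uP G N N0 GN; have h2 := vP F M M0 FM.
have h3 := Gv u; have h4 := Fu v.
have nu := knrm_bound (ltW e0) M0 FM Fu; have nv := knrm_bound (ltW e0) N0 GN Gv.
rewrite !kevB in h3 h4.
rewrite (_ : _ - _ = (kinner G F - kev v F) + (kev v F - kev v (kfun u))
  - ((kinner F G - kev u G) + (kev u G - kev u (kfun v)))^*%C); last first.
  by rewrite cjD 2!(cjD _ (- _)) !cjN -(kev_kfunC v u); ring.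
rewrite (le_trans (cnD _ _))// cnN cnJ.
have := cnD (kinner G F - kev v F) (kev v F - kev v (kfun u)).
have := cnD (kinner F G - kev u G) (kev u G - kev u (kfun v)).
have := knrm_ge0 u; have := knrm_ge0 v.
by nra.
Qed.

Lemma kinner_Re F : kinner F F = (complex.Re (kinner F F))%:C.
Proof.
apply: complex_eqP => //=.
by have := congr1 (@complex.Im R) (kinnerC F F); rewrite cimJ; lra.
Qed.

Lemma kinner_ge0 F : 0 <= complex.Re (kinner F F).
Proof.
have [M M0 FM] := kspace_bdd F.
apply/ler_addgt0Pl => d d0.
pose e := Num.min 1 (d / (2 * M + 2)).
have e0 : 0 < e by rewrite lt_min ltr01 divr_gt0//; lra.
have e1 : e <= 1 by rewrite ge_min lexx.
have eM : e * (2 * M + 2) <= d by rewrite -ler_pdivlMr ?ge_min ?lexx ?orbT//; lra.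
have [u [Fu uP]] := kinner_approx F e0; have h1 := uP F M M0 FM.
have h2 := Fu u; have nu := knrm_bound (ltW e0) M0 FM Fu.
rewrite kevB in h2.
have := le_trans (Re_le_cn _) h1; have := le_trans (Re_le_cn _) h2.
rewrite !ler_norml !creD !creN => /andP[k1 k2] /andP[k3 k4].
have := kev_ge0 u; have := knrm_ge0 u.
by nra.
Qed.

Definition knorm F : R := Num.sqrt (complex.Re (kinner F F)).

Lemma knorm_sqr F : knorm F ^+ 2 = complex.Re (kinner F F).
Proof. by rewrite sqr_sqrtr// kinner_ge0. Qed.

Lemma knorm_ge0 F : 0 <= knorm F. Proof. exact: sqrtr_ge0. Qed.

Lemma kinnerDr F G H : kinner F (G + H) = kinner F G + kinner F H.
Proof. by have := kinner_linear F 1 G H; rewrite scale1r mul1r. Qed.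

Lemma kinner0r F : kinner F 0 = 0.
Proof. by have := kinnerDr F 0 0; rewrite addr0 => /eqP; rewrite -subr_eq subrr => /eqP. Qed.

Lemma kinnerZr F a G : kinner F (a *: G) = a * kinner F G.
Proof. by have := kinner_linear F a G 0; rewrite kinner0r !addr0. Qed.

Lemma knorm_sqrDZ F G a : knorm (F + a *: G) ^+ 2 =
  knorm F ^+ 2 + 2 * complex.Re (a * kinner F G) + cn a ^+ 2 * knorm G ^+ 2.
Proof.
rewrite !knorm_sqr kinnerDr kinnerZr (kinnerC F (F + _)) (kinnerC G (F + _)).
rewrite !kinnerDr !kinnerZr (kinner_Re F) (kinner_Re G) (kinnerC F G).
by rewrite !(creM, cimM, creD, cimD, creJ, cimJ) /= cn_sqr; ring.
Qed.

Lemma kinner_cs F G : cn (kinner F G) <= knorm F * knorm G.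
Proof.
rewrite -(@ler_pXn2r _ 2) ?nnegrE ?cn_ge0 ?mulr_ge0 ?knorm_ge0// exprMn.
apply: quadratic_bound; first exact: sqr_ge0.
by move=> a; rewrite -knorm_sqrDZ sqr_ge0.
Qed.

Lemma knorm_pt u : knorm (kpt u) = knrm u.
Proof. by rewrite /knorm kinner_pt. Qed.

Lemma kbdd_knorm F : kbdd F (knorm F).
Proof. by move=> w; rewrite -kinner_pt (le_trans (kinner_cs _ _))// mulrC knorm_pt. Qed.

(** Together with [kbdd_knorm] this identifies the Hilbert norm with the dual norm, so that the
    triangle inequality and completeness become statements about [kbdd]. *)
Lemma knorm_le F e : 0 <= e -> kbdd F e -> knorm F <= e.
Proof.
move=> e0 Fe; rewrite -(@ler_pXn2r _ 2) ?nnegrE ?knorm_ge0// knorm_sqr.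
apply/ler_addgt0Pr => d d0.
pose c := Num.min 1 (d / (2 * e + 1)).
have c0 : 0 < c by rewrite lt_min ltr01 divr_gt0//; lra.
have c1 : c <= 1 by rewrite ge_min lexx.
have cM : c * (2 * e + 1) <= d by rewrite -ler_pdivlMr ?ge_min ?lexx ?orbT//; lra.
have [u [Fu uP]] := kinner_approx F c0; have h1 := uP F e e0 Fe.
have nu := knrm_bound (ltW c0) e0 Fe Fu; have h2 := Fe u.
have := cnD (kinner F F - kev u F) (kev u F); rewrite subrK.
have := le_trans (ler_norm _) (Re_le_cn (kinner F F)).
by nra.
Qed.

Lemma knorm_triangle F G : (knorm (F + G))%:C <= (knorm F)%:C + (knorm G)%:C :> R[i].
Proof.
rewrite -rmorphD lecR; apply: knorm_le; first by rewrite addr_ge0 ?knorm_ge0.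
exact: kbddD (kbdd_knorm F) (kbdd_knorm G).
Qed.

Lemma knormZ a F : (knorm (a *: F))%:C = `|a| * (knorm F)%:C :> R[i].
Proof.
rewrite cnE -rmorphM; congr _%:C; apply/eqP.
rewrite -(eqrXn2 (n := 2)) ?knorm_ge0 ?mulr_ge0 ?cn_ge0 ?knorm_ge0//.
have := knorm_sqrDZ 0 F a; rewrite add0r => ->.
by rewrite (kinnerC F 0) knorm_sqr !kinner0r cj0 mulr0 exprMn /= mulr0 !add0r.
Qed.

Lemma knorm_eq0 F : (knorm F)%:C = 0 :> R[i] -> F = 0.
Proof.
move=> /complexI F0; apply/val_inj/funext => i /=.
apply: cn_eq0; apply/le_anti; rewrite cn_ge0 andbT.
have := kbdd_knorm F [:: (1, i)].
by rewrite F0 mul0r kev1.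
Qed.

HB.instance Definition _ :=
  @Lmodule_isNormed.Build R[i] kspace (fun F => (knorm F)%:C)
    knorm_triangle knormZ knorm_eq0.

Lemma nrm_kspace F : nrm F = knorm F. Proof. by []. Qed.

Lemma kspace_complete (X : set_system W) : ProperFilter X -> cauchy X -> cvg X.
Proof.
move=> PX /cauchyP Xc.
pose S (e : R) : set W := [set F | X (ball F e%:C)].
have S0 (e : R) : 0 < e -> S e !=set0 by move=> e0; apply: Xc; rewrite ltcR.
have SS (e d : R) F G : S e F -> S d G -> nrm (F - G) <= e + d.
  move=> SF SG; have [Z []] := filter_ex (filterI SF SG).
  by move=> /ballC FZ /ballC GZ; exact: nrm_close FZ GZ.
pose n i := knrm [:: (1, i)].
have evi i F : F i = kev [:: (1, i)] F by rewrite kev1.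
have /choice[f fP] : forall i, exists s, forall e : R, 0 < e -> forall F, S e F ->
    cn (s - F i) <= e * n i.
  move=> i; have n0 : 0 < n i + 1 by rewrite ltr_wpDl ?knrm_ge0.
  have [e e0|e d _ _ e0 d0 [F SF <-] [G SG <-]|s sP] :=
      @complex_net R (fun e => [set F i | F in S (e / (n i + 1))]).
  - by have [F SF] := S0 _ (divr_gt0 e0 n0); exists (F i), F.
  - have := SS _ _ _ _ SF SG; rewrite nrm_kspace => FG.
    rewrite !evi -kevB; apply: le_trans (kbdd_knorm (F - G) _) _.
    rewrite -/(n i) (@le_trans _ _ ((e / (n i + 1) + d / (n i + 1)) * n i))//.
      by rewrite ler_wpM2r ?knrm_ge0.
    rewrite -mulrDl mulrAC -mulrA ger_pMr ?addr_gt0// ler_pdivrMr//; lra.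
  exists s => e e0 F SF; apply/ler_addgt0Pr => d d0.
  have c0 : 0 < d / (2 * n i + 1) by rewrite divr_gt0//; have := knrm_ge0 [:: (1, i)]; rewrite -/(n i); lra.
  set c := d / _ in c0.
  have ni : 0 <= n i by exact: knrm_ge0.
  have cE : c * (2 * n i + 1) = d by rewrite /c; field; lra.
  have [G SG] := S0 _ c0.
  have h1 : cn (s - G i) <= c * (n i + 1).
    by apply: sP; [rewrite mulr_gt0|exists G => //; rewrite mulfK//; lra].
  have h2 : cn (G i - F i) <= (c + e) * n i.
    rewrite !evi -kevB; apply: le_trans (kbdd_knorm (G - F) _) _; rewrite ler_wpM2r//.
    by have := SS _ _ _ _ SG SF.
  by have := cnD (s - G i) (G i - F i); rewrite addrA subrK; lra.
have fS (e : R) F : 0 < e -> S e F -> kbdd (f - F) e.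
  move=> e0 SF w.
  (* A fixed w involves finitely many points, so pointwise closeness controls [kev w] up to a
     constant N depending on w; finer approximations G then remove N from the estimate. *)
  have [N N0 NP] : exists2 N, 0 <= N & forall (d : R) G, 0 < d -> S d G ->
      cn (kev w (f - G)) <= d * N.
    exists (\sum_(p <- w) cn p.1 * n p.2).
      by rewrite sumr_ge0// => p _; rewrite mulr_ge0 ?cn_ge0 ?knrm_ge0.
    move=> d G d0 SG; rewrite /kev mulr_sumr.
    elim/big_ind2: _ => [|a b c e' ? ?|p _]; first by rewrite cn0.
      by rewrite (le_trans (cnD _ _))// lerD.
    by rewrite cnM cnJ mulrCA ler_wpM2l ?cn_ge0// fP.
  apply/ler_addgt0Pr => d d0.
  have w0 := knrm_ge0 w.
  have c0 : 0 < d / (N + knrm w + 1) by rewrite divr_gt0//; lra.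
  set c := d / _ in c0.
  have cE : c * (N + knrm w + 1) = d by rewrite /c; field; lra.
  have [G SG] := S0 _ c0.
  have h1 := NP _ _ c0 SG.
  have h2 : cn (kev w (kv G - kv F)) <= _ := kbdd_knorm (G - F) w.
  have h3 : knorm (G - F) * knrm w <= (c + e) * knrm w.
    by rewrite ler_wpM2r//; have := SS _ _ _ _ SG SF.
  have := cnD (kev w (f - G)) (kev w (kv G - kv F)); rewrite -kevD addrA subrK.
  by lra.
have fin : f \in kspace_pred.
  apply/asboolP => e e0; have e2 : 0 < e / 2 by lra.
  have [F SF] := S0 _ e2; have [u Fu] := kspaceP F e2; exists u.
  have := kbddD (fS _ _ e2 SF) Fu; rewrite addrA subrK.
  by apply: kbddW; lra.
apply/cvg_ex; exists (KSpace fin) => A /nbhs_ballP[eps /= /posC[e0 eE] eA].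
move: e0 eE; move: (complex.Re eps) => e e0 eE.
have e2 : 0 < e / 2 by lra.
have [F SF] := S0 _ e2.
have XF := SF; apply: filterS XF => G /ballC FG; apply: eA; rewrite eE; apply/ballC.
rewrite (splitr e); apply: nrm_closer FG.
by apply: (@knorm_le (KSpace fin - F)); [exact: (ltW e2)|exact: (fS _ _ e2 SF)].
Qed.

HB.instance Definition _ := Uniform_isComplete.Build kspace kspace_complete.

Lemma kinner_norm F : kinner F F = `|F| ^+ 2.
Proof. by rewrite kinner_Re -knorm_sqr nrmE nrm_kspace -rmorphXn. Qed.

HB.instance Definition _ := CompleteNormedModule_isHilbert.Build R kspace
  kinner_linear kinnerC kinner_norm.

Lemma kernel_hilbert : exists (H : hilbertType R) (e : I -> H),
  (forall i j, inner (e i) (e j) = ker k i j) /\ clspan (range e) = setT.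
Proof.
exists kspace, (fun i => kpt [:: (1, i)]); split=> [i j|].
  by rewrite [inner _ _]kinner_pt kev1 /= /kfun big_seq1 /= mul1r.
apply/seteqP; split=> // F _; apply/closureE => e e0.
have [u Fu] := kspaceP F (divr_gt0 e0 (ltr0Sn R 1)).
exists (kpt u).
  have -> : kpt u = \sum_(q <- u) q.1 *: kpt [:: (1, q.2)].
    apply/val_inj/funext => i /=.
    rewrite (_ : kspace_val _ = \sum_(q <- u) q.1 *: kfun [:: (1, q.2)]).
      rewrite fct_sumE; apply: eq_bigr => q _.
      by rewrite fctE /kfun big_seq1 /= mul1r.
    by apply: (big_morph (@kspace_val)) => //.
  elim/big_rec: _ => [|q x _ IH]; first exact: linspan0.
  by apply: linspanP => //; apply: sub_linspan; exists q.2.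
apply: (@le_lt_trans _ _ (e / 2)); last by lra.
by apply: knorm_le => //; rewrite divr_ge0// ltW.
Qed.

End KernelSpace.

Section GramKernels.
Variables (R : realType).
Implicit Types E H K L G : hilbertType R.

Lemma gram_sum E H n (xi : 'I_n -> bop E H) (x : 'I_n -> E) :
  \sum_i \sum_j inner (x i) (adj (xi i) (xi j (x j))) =
  (nrm (\sum_i xi i (x i)) ^+ 2)%:C.
Proof.
rewrite -inner_sqr inner_suml; apply: eq_bigr => i _.
by rewrite inner_sumr; apply: eq_bigr => j _; rewrite adjP.
Qed.

Lemma psd_gram E H n (xi : 'I_n -> bop E H) : psd (fun i j => adj (xi i) \ob xi j).
Proof.
split=> [i j|x]; first by rewrite adjM adjK.
by have -> := gram_sum xi x; rewrite sqr_ge0.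
Qed.

(** The quadratic form at x is ||S||^2 ||v||^2 - ||S v||^2 with v the sum of the xi_i x_i. In this
    form a norm bound can be a factor of an entrywise product. *)
Lemma psd_contract E H K n (xi : 'I_n -> bop E H) (S : bop H K) :
  psd (fun i j => (nrm S ^+ 2)%:C *: (adj (xi i) \ob xi j) -
    (adj (S \ob xi i) \ob (S \ob xi j))).
Proof.
split=> [i j|x]; first by rewrite adjB adjZ !adjM !adjK conjc_real.
under eq_bigr => i _ do under eq_bigr => j _ do rewrite bopD bopN bopZ innerBr innerZr.
under eq_bigr => i _ do rewrite sumrB -mulr_sumr.
rewrite sumrB -mulr_sumr.
have -> := gram_sum xi x; have -> := gram_sum (fun i => S \ob xi i) x.
rewrite creD creN creMR /= subr_ge0.
have -> : \sum_i S (xi i (x i)) = S (\sum_i xi i (x i)) by rewrite bop_sumr.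
by rewrite -exprMn ler_sqr ?nnegrE ?mulr_ge0 ?nrm_ge0// nrm_bop.
Qed.

Lemma psd_const E K n (T : bop E K) :
  @psd R E 'I_n (fun _ _ => (nrm T ^+ 2)%:C *: idop E - (adj T \ob T)).
Proof.
have := @psd_contract _ _ _ n (fun _ => idop E) T.
by rewrite adj1 !compop1.
Qed.

(** The entrywise product of a Gram matrix with the constant matrix ||T||^2 - T^* T. Taken at T =
    eta it bounds the ket of eta, and at T in the commutant of the Gram operators it bounds
    [rho]. *)
Lemma gram_contract E H K n (xi : 'I_n -> bop E H) (T : bop E K) (x : 'I_n -> E) :
  (forall i j, (adj (xi i) \ob xi j) \ob (adj T \ob T) = (adj T \ob T) \ob (adj (xi i) \ob xi j)) ->
  complex.Re (\sum_i \sum_j inner (x i) (adj (xi i) (xi j (adj T (T (x j)))))) <=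
  nrm T ^+ 2 * nrm (\sum_i xi i (x i)) ^+ 2.
Proof.
move=> comm; rewrite -subr_ge0.
apply: (le_trans (@schur_psd R E 'I_n _ _ (psd_gram xi) (@psd_const E K n T) _ x)).
  by move=> i j l m; rewrite compDl compDr compNl compNr compZl compZr comp1op compop1 comm.
rewrite [leRHS](_ : _ = complex.Re ((nrm T ^+ 2)%:C * (nrm (\sum_i xi i (x i)) ^+ 2)%:C -
  \sum_i \sum_j inner (x i) (adj (xi i) (xi j (adj T (T (x j))))))); last first.
  by rewrite creD creN creMR.
rewrite -gram_sum mulr_sumr -sumrB le_eqVlt; apply/orP; left; apply/eqP.
congr complex.Re; apply: eq_bigr => i _; rewrite mulr_sumr -sumrB; apply: eq_bigr => j _.
by rewrite bopD bopN bopZ idopE /= !linearB /= !linearZ /= innerBr innerZr.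
Qed.

End GramKernels.

(** * The relative tensor product *)

Section RelativeTensor.
Variables (R : realType).
Implicit Types E H K L G : hilbertType R.

(** What the construction of the relative tensor product rests on, with the base left out: the Gram
    operators of the two families commute. For modules of opposite kinds this is the commutation of
    the two algebras of the base ([compat_mod]). *)
Definition compat E H K (beta : set (bop E H)) (gamma : set (bop E K)) : Prop :=
  [/\ closed_subspace beta, closed_subspace gamma,
      clspan (vecprod beta) = setT, clspan (vecprod gamma) = setT &
      forall xi xi' eta eta', beta xi -> beta xi' -> gamma eta -> gamma eta' ->
      (adj xi \ob xi') \ob (adj eta \ob eta') = (adj eta \ob eta') \ob (adj xi \ob xi')].

Lemma total_mono H (A B : set H) : clspan A = setT -> A `<=` B -> clspan B = setT.
Proof.
by move=> tA AB; apply/seteqP; split=> // x _; apply: (clspan_mono AB); rewrite tA.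
Qed.

Lemma compatC E H K (beta : set (bop E H)) (gamma : set (bop E K)) :
  compat beta gamma -> compat gamma beta.
Proof.
by move=> [? ? ? ? c]; split=> // xi xi' eta eta' ? ? ? ?; rewrite c.
Qed.

Lemma rtp_ex E H K (beta : set (bop E H)) (gamma : set (bop E K)) :
  compat beta gamma -> exists D, is_rtp beta gamma D.
Proof.
move=> [cb cg tb tg comm].
pose P (x : bop E H * E * bop E K) := beta x.1.1 /\ gamma x.2.
pose I := {x | P x}.
pose k (i j : I) : R[i] := inner (sval i).1.2
  ((adj (sval i).1.1 \ob (sval j).1.1 \ob adj (sval i).2 \ob (sval j).2) (sval j).1.2).
have kC i j : k j i = (k i j)^*%C.
  case: i j => [[[xi z] eta] [/= bi gi]] [[[xi' z'] eta'] [/= bj gj]].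
  rewrite /k /= [RHS](_ : _ = inner ((adj xi \ob xi' \ob adj eta \ob eta') z') z).
    by rewrite -[RHS]/(inner (((adj xi \ob xi') \ob (adj eta \ob eta')) z') z) comm//=
      !adjP !adjK.
  by rewrite -innerC.
have kp n (c : 'I_n -> R[i]) (a : 'I_n -> I) :
    0 <= complex.Re (\sum_i \sum_j (c i)^*%C * c j * k (a i) (a j)).
  have := @schur_psd R E 'I_n _ _ (psd_gram (fun i => (sval (a i)).1.1))
    (psd_gram (fun i => (sval (a i)).2)) _ (fun i => c i *: (sval (a i)).1.2).
  under eq_bigr => i _ do under eq_bigr => j _ do rewrite /= !linearZ /= innerZl innerZr mulrA.
  apply=> i j l m; apply: comm; [case: (svalP (a i))|case: (svalP (a j))|
    case: (svalP (a l))|case: (svalP (a m))] => //.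
have [G [e [ek te]]] := kernel_hilbert (PsdKernel kC kp).
(* The kernel lives on the admissible triples only. Other triples get the value 0, about which
   [is_rtp] says nothing. *)
exists (@RtpData R E H K G (fun xi z eta =>
  if pselect (P (xi, z, eta)) is left p then e (exist _ (xi, z, eta) p) else 0)).
split=> [xi z eta xi' z' eta' bx bx' gx gx'|].
  rewrite /=; case: pselect => [p|[]//]; case: pselect => [p'|[]//].
  by rewrite ek.
rewrite -te; congr clspan; apply/seteqP; split.
  move=> _ [xi [z [eta [bx gx ->]]]] /=; case: pselect => [p|[]//].
  by exists (exist _ _ p).
move=> _ [[[[xi z] eta] p] _ <-]; exists xi, z, eta; have [/= bx gx] := p; split=> //.
by case: pselect => [p'|[]//]; rewrite (Prop_irrelevance p' p).
Qed.

Section Spec.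
Variables (E H K : hilbertType R) (beta : set (bop E H)) (gamma : set (bop E K)).
Hypothesis bg : compat beta gamma.

Lemma rtp_pickP : is_rtp beta gamma (rtp_pick beta gamma).
Proof.
rewrite /rtp_pick; case: pselect => [e|[]]; last exact: rtp_ex.
exact: (projT2 (cid e)).
Qed.

Lemma tens_inner xi z eta xi' z' eta' : beta xi -> beta xi' -> gamma eta -> gamma eta' ->
  inner (tens beta gamma xi z eta) (tens beta gamma xi' z' eta') =
  inner z (adj xi (xi' (adj eta (eta' z')))).
Proof. by case: rtp_pickP => h _; exact: h. Qed.

Definition tens_index : set (bop E H * E * bop E K) := [set x | beta x.1.1 /\ gamma x.2].

Lemma tens_total :
  clspan [set tens beta gamma x.1.1 x.1.2 x.2 | x in tens_index] = setT.
Proof.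
case: rtp_pickP => _ <-; congr clspan; apply/seteqP; split.
  by move=> _ [[[xi z] eta] [/= bx gx] <-]; exists xi, z, eta.
by move=> _ [xi [z [eta [bx gx ->]]]]; exists (xi, z, eta).
Qed.

Lemma tens_inner_comm xi z eta xi' z' eta' : beta xi -> beta xi' -> gamma eta -> gamma eta' ->
  inner (tens beta gamma xi z eta) (tens beta gamma xi' z' eta') =
  inner z (adj eta (eta' (adj xi (xi' z')))).
Proof.
move=> bx bx' gx gx'; rewrite tens_inner//; congr inner.
by case: bg => _ _ _ _ /(_ xi xi' eta eta' bx bx' gx gx') /(congr1 (fun T => bop_fun T z')).
Qed.

End Spec.

(** The inner product of elementary tensors may be computed with either pair of Gram operators
    first, since they commute; hence the exchange of factors is isometric. *)
Lemma flip_ex E H K (beta : set (bop E H)) (gamma : set (bop E K)) : compat beta gamma ->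
  unitary_op (flip beta gamma) /\ forall xi z eta, beta xi -> gamma eta ->
    flip beta gamma (tens beta gamma xi z eta) = tens gamma beta eta z xi.
Proof.
move=> bg; have gb := compatC bg.
pose e (x : bop E H * E * bop E K) := tens beta gamma x.1.1 x.1.2 x.2.
pose f (x : bop E H * E * bop E K) := tens gamma beta x.2 x.1.2 x.1.1.
have [|||T Te uT] := @unitary_ext R _ (tens_index beta gamma) _ _ e f.
- exact: tens_total.
- rewrite -(tens_total gb); congr clspan; apply/seteqP; split.
    by move=> _ [[[xi z] eta] [/= bx gx] <-]; exists (eta, z, xi).
  by move=> _ [[[xi z] eta] [/= bx gx] <-]; exists (eta, z, xi).
- move=> [[xi z] eta] [[xi' z'] eta'] [/= bx gx] [/= bx' gx'].
  by rewrite /e /f /= tens_inner// tens_inner_comm.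
have flT : (fun S : bop (rtp beta gamma) (rtp gamma beta) => forall xi z eta, beta xi -> gamma eta ->
    S (tens beta gamma xi z eta) = tens gamma beta eta z xi) (flip beta gamma).
  rewrite /flip; apply: (@xgetPex _ 0 [set S : bop (rtp beta gamma) (rtp gamma beta) | forall xi z eta, beta xi -> gamma eta ->
    S (tens beta gamma xi z eta) = tens gamma beta eta z xi]).
  by exists T => xi z eta bx gx; apply: (Te (xi, z, eta)).
split=> //; suff -> : flip beta gamma = T by [].
apply: (total_ext (tens_total bg)) => _ [[[xi z] eta] [/= bx gx] <-].
by rewrite flT//; symmetry; apply: (Te (xi, z, eta)).
Qed.

Lemma flip_unitary E H K (beta : set (bop E H)) (gamma : set (bop E K)) :
  compat beta gamma -> unitary_op (flip beta gamma).
Proof. by case/flip_ex. Qed.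

Lemma flip_tens E H K (beta : set (bop E H)) (gamma : set (bop E K)) xi z eta :
  compat beta gamma -> beta xi -> gamma eta ->
  flip beta gamma (tens beta gamma xi z eta) = tens gamma beta eta z xi.
Proof. by case/flip_ex => _; apply. Qed.

Lemma ket2_ex E H K (beta : set (bop E H)) (gamma : set (bop E K)) eta :
  compat beta gamma -> gamma eta -> forall xi, beta xi -> forall z,
  ket2 beta gamma eta (xi z) = tens beta gamma xi z eta.
Proof.
move=> bg gx; rewrite /ket2.
apply: (@xgetPex _ 0 [set T : bop H (rtp beta gamma) |
  forall xi, beta xi -> forall z, T (xi z) = tens beta gamma xi z eta]).
pose e (x : bop E H * E) := x.1 x.2.
pose f (x : bop E H * E) := tens beta gamma x.1 x.2 eta.
case: (bg) => cb cg tb tg comm.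
have [||n c a ba|T Te _] := @ext_op R _ [set x : bop E H * E | beta x.1] _ _ e f (nrm eta).
- exact: nrm_ge0.
- rewrite -tb; congr clspan; apply/seteqP; split.
    by move=> _ [[xi z] /= bx <-]; exists xi => //; exists z.
  by move=> _ [xi bx [z _ <-]]; exists (xi, z).
- rewrite -(@ler_pXn2r _ 2) ?nnegrE ?mulr_ge0 ?nrm_ge0// exprMn.
  have := @gram_contract R E H K n (fun i => (a i).1) eta (fun i => c i *: (a i).2).
  under [\sum_i _ (_ *: _)]eq_bigr => i _ do rewrite linearZ /=.
  rewrite -/(nrm _); move=> h; apply: le_trans (h _); last first.
    by move=> i j; apply: comm => //; exact: ba.
  rewrite -Re_inner_sqr inner_suml le_eqVlt; apply/orP; left; apply/eqP; congr complex.Re.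
  apply: eq_bigr => i _; rewrite inner_sumr; apply: eq_bigr => j _.
  rewrite !innerZl !innerZr tens_inner//; try exact: ba.
  by rewrite !linearZ /= innerZr.
by exists T => xi bx z; apply: (Te (xi, z)).
Qed.

Lemma ket1_ex E H K (beta : set (bop E H)) (gamma : set (bop E K)) xi :
  compat beta gamma -> beta xi -> forall eta, gamma eta -> forall z,
  ket1 beta gamma xi (eta z) = tens beta gamma xi z eta.
Proof.
move=> bg bx; rewrite /ket1.
apply: (@xgetPex _ 0 [set T : bop K (rtp beta gamma) |
  forall eta, gamma eta -> forall z, T (eta z) = tens beta gamma xi z eta]).
exists (flip gamma beta \ob ket2 gamma beta xi) => eta gx z.
by rewrite /= ket2_ex ?flip_tens//; exact: compatC.
Qed.

(** Commutation with the Gram operators is what makes xi z |-> xi (T z) well defined; for a module,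
    every T in the opposite algebra has it ([mod_cent]). *)
Definition cent E H (alpha : set (bop E H)) (T : bop E E) : Prop :=
  forall xi xi', alpha xi -> alpha xi' ->
  (adj xi \ob xi') \ob T = T \ob (adj xi \ob xi').

Lemma cent_adj E H (alpha : set (bop E H)) T : cent alpha T -> cent alpha (adj T).
Proof.
move=> cT xi xi' ax ax'; have := congr1 (@adj _ _ _) (cT xi' xi ax' ax).
by rewrite !adjM !adjK.
Qed.

Lemma cent_comp E H (alpha : set (bop E H)) S T : cent alpha S -> cent alpha T ->
  cent alpha (S \ob T).
Proof.
by move=> cS cT xi xi' ax ax'; rewrite compopA cS// -compopA cT// compopA.
Qed.

Lemma rho_ex E H (alpha : set (bop E H)) (T : bop E E) :
  clspan (vecprod alpha) = setT -> cent alpha T ->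
  exists2 S : bop H H, (forall xi, alpha xi -> S \ob xi = xi \ob T) & nrm S <= nrm T.
Proof.
move=> ta cT.
pose e (x : bop E H * E) := x.1 x.2.
pose f (x : bop E H * E) := x.1 (T x.2).
have [||n c a ba|S Se nS] := @ext_op R _ [set x : bop E H * E | alpha x.1] _ _ e f (nrm T).
- exact: nrm_ge0.
- rewrite -ta; congr clspan; apply/seteqP; split.
    by move=> _ [[xi' z'] /= bx <-]; exists xi' => //; exists z'.
  by move=> _ [xi' bx [z' _ <-]]; exists (xi', z').
- rewrite -(@ler_pXn2r _ 2) ?nnegrE ?mulr_ge0 ?nrm_ge0// exprMn.
  have := @gram_contract R E H E n (fun i => (a i).1) T (fun i => c i *: (a i).2).
  under [\sum_i _ (_ *: _)]eq_bigr => i _ do rewrite linearZ /=.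
  move=> h; apply: le_trans (h _); last first.
    move=> i j; apply: (cent_comp (cent_adj cT) cT); exact: ba.
  rewrite -Re_inner_sqr inner_suml le_eqVlt; apply/orP; left; apply/eqP; congr complex.Re.
  apply: eq_bigr => i _; rewrite inner_sumr; apply: eq_bigr => j _.
  rewrite /f !linearZ /= !innerZl !innerZr !adjP; congr (_ * (_ * _)).
  have h' := congr1 (fun U => bop_fun U (T (a j).2)) (cent_adj cT (ba i) (ba j)).
  exact: (congr1 (inner _) (esym h')).
exists S; last by apply: nrm_bop_le => //; exact: nrm_ge0.
by move=> xi ax; apply: bopP => z; apply: (Se (xi, z)).
Qed.

Lemma rho_uniq E H (alpha : set (bop E H)) (T : bop E E) (S : bop H H) :
  clspan (vecprod alpha) = setT ->
  (forall xi, alpha xi -> S \ob xi = xi \ob T) -> rho alpha T = S.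
Proof.
move=> ta ST; apply: (vecprod_ext ta) => xi ax; rewrite ST//.
apply: bopP => z; rewrite /rho.
apply: (@xgetPex _ 0 [set S : bop H H |
    forall xi, alpha xi -> forall z, S (xi z) = xi (T z)] _ xi ax z).
by exists S => xi' bx z'; rewrite -compopE ST.
Qed.

Lemma rhoE E H (alpha : set (bop E H)) (T : bop E E) xi :
  clspan (vecprod alpha) = setT -> cent alpha T -> alpha xi ->
  rho alpha T \ob xi = xi \ob T.
Proof.
by move=> ta cT ax; have [S ST _] := rho_ex ta cT; rewrite (rho_uniq ta ST) ST.
Qed.

Lemma nrm_rho E H (alpha : set (bop E H)) (T : bop E E) :
  clspan (vecprod alpha) = setT -> cent alpha T -> nrm (rho alpha T) <= nrm T.
Proof. by move=> ta cT; have [S ST nS] := rho_ex ta cT; rewrite (rho_uniq ta ST). Qed.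

Lemma adj_rho E H (alpha : set (bop E H)) (T : bop E E) :
  clspan (vecprod alpha) = setT -> cent alpha T ->
  adj (rho alpha T) = rho alpha (adj T).
Proof.
move=> ta cT; symmetry; apply: rho_uniq => // xi ax.
apply: bopP => z; apply: (total_inner ta) => _ [xi' ax' [w _ <-]].
rewrite /= -adjP -[rho _ _ (xi' w)]/((rho alpha T \ob xi') w) rhoE//= !adjP.
exact: (congr1 (fun U => inner w (bop_fun U z)) (esym (cent_adj cT ax' ax))).
Qed.

Section Kets.
Variables (E H K : hilbertType R) (beta : set (bop E H)) (gamma : set (bop E K)).
Hypothesis bg : compat beta gamma.

Let tb : clspan (vecprod beta) = setT. Proof. by case: bg. Qed.
Let tg : clspan (vecprod gamma) = setT. Proof. by case: bg. Qed.

Lemma compat_cent xi xi' : beta xi -> beta xi' -> cent gamma (adj xi \ob xi').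
Proof. by move=> bx bx' eta eta' gx gx'; case: bg => _ _ _ _ ->. Qed.

Lemma compat_cent' eta eta' : gamma eta -> gamma eta' -> cent beta (adj eta \ob eta').
Proof. by move=> gx gx' xi xi' bx bx'; case: bg => _ _ _ _ ->. Qed.

Lemma ket12 xi eta : beta xi -> gamma eta ->
  ket1 beta gamma xi \ob eta = ket2 beta gamma eta \ob xi.
Proof. by move=> bx gx; apply: bopP => z; rewrite /= ket1_ex// ket2_ex. Qed.

Lemma rtp_total : clspan (vecprod (opprod (ket1 beta gamma @` beta) gamma)) = setT.
Proof.
apply: total_mono (tens_total bg) _ => _ [[[xi z] eta] [/= bx gx] <-].
exists (ket1 beta gamma xi \ob eta); last by exists z => //; rewrite /= ket1_ex.
by exists (ket1 beta gamma xi); [exists xi|exists eta].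
Qed.

Lemma rtp_ext L (S T : bop (rtp beta gamma) L) :
  (forall xi eta, beta xi -> gamma eta ->
    S \ob (ket1 beta gamma xi \ob eta) = T \ob (ket1 beta gamma xi \ob eta)) -> S = T.
Proof.
move=> ST; apply: (vecprod_ext rtp_total) => _ [_ [xi bx <-] [eta gx <-]].
exact: (ST _ _ bx gx).
Qed.

Lemma rtp_ext1 L (S T : bop (rtp beta gamma) L) :
  (forall xi, beta xi -> S \ob ket1 beta gamma xi = T \ob ket1 beta gamma xi) -> S = T.
Proof. by move=> ST; apply: rtp_ext => xi eta bx gx; rewrite !compopA ST//. Qed.

Lemma rtp_ext2 L (S T : bop (rtp beta gamma) L) :
  (forall eta, gamma eta -> S \ob ket2 beta gamma eta = T \ob ket2 beta gamma eta) -> S = T.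
Proof. by move=> ST; apply: rtp_ext => xi eta bx gx; rewrite ket12// !compopA ST//. Qed.

Lemma total_ket1 : clspan (vecprod (ket1 beta gamma @` beta)) = setT.
Proof.
apply: total_mono rtp_total _ => _ [_ [_ [xi bx <-] [eta gx <-]] [z _ <-]].
by exists (ket1 beta gamma xi); [exists xi|exists (eta z)].
Qed.

Lemma total_ket2 : clspan (vecprod (ket2 beta gamma @` gamma)) = setT.
Proof.
apply: total_mono rtp_total _ => _ [_ [_ [xi bx <-] [eta gx <-]] [z _ <-]].
exists (ket2 beta gamma eta); [by exists eta|exists (xi z) => //].
by rewrite -compopE -ket12.
Qed.

Lemma ket1_uniq xi (T : bop K (rtp beta gamma)) : beta xi ->
  (forall eta, gamma eta -> T \ob eta = ket2 beta gamma eta \ob xi) ->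
  T = ket1 beta gamma xi.
Proof. by move=> bx h; apply: (vecprod_ext tg) => eta gx; rewrite h// ket12. Qed.

Lemma ket2_uniq eta (T : bop H (rtp beta gamma)) : gamma eta ->
  (forall xi, beta xi -> T \ob xi = ket1 beta gamma xi \ob eta) ->
  T = ket2 beta gamma eta.
Proof. by move=> bx h; apply: (vecprod_ext tb) => xi gx; rewrite h// ket12. Qed.

Lemma ket1_adj xi xi' : beta xi -> beta xi' ->
  adj (ket1 beta gamma xi) \ob ket1 beta gamma xi' = rho gamma (adj xi \ob xi').
Proof.
move=> bx bx'; symmetry; apply: rho_uniq => // eta gx.
apply: bopP => z; apply: (total_inner tg) => _ [eta' gx' [w _ <-]].
rewrite /= -adjP !ket1_ex// tens_inner_comm//.
by rewrite [RHS]adjP.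
Qed.

Lemma ket2_adj eta eta' : gamma eta -> gamma eta' ->
  adj (ket2 beta gamma eta) \ob ket2 beta gamma eta' = rho beta (adj eta \ob eta').
Proof.
move=> gx gx'; symmetry; apply: rho_uniq => // xi bx.
apply: bopP => z; apply: (total_inner tb) => _ [xi' bx' [w _ <-]].
rewrite /= -adjP !ket2_ex// tens_inner//.
by rewrite [RHS]adjP.
Qed.

End Kets.

Lemma flip_ket1 E H K (beta : set (bop E H)) (gamma : set (bop E K)) xi :
  compat beta gamma -> beta xi ->
  flip beta gamma \ob ket1 beta gamma xi = ket2 gamma beta xi.
Proof.
move=> bg bx; have gb := compatC bg; apply: ket2_uniq => // eta gx.
by apply: bopP => z; rewrite /= !ket1_ex// flip_tens.
Qed.

Lemma flip_ket2 E H K (beta : set (bop E H)) (gamma : set (bop E K)) eta :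
  compat beta gamma -> gamma eta ->
  flip beta gamma \ob ket2 beta gamma eta = ket1 gamma beta eta.
Proof.
move=> bg bx; have gb := compatC bg; apply: ket1_uniq => // xi gx.
by apply: bopP => z; rewrite /= !ket2_ex// flip_tens.
Qed.

Lemma semiP E H K (alpha : set (bop E H)) (beta : set (bop E K)) T xi :
  semimorphism alpha beta T -> alpha xi -> beta (T \ob xi).
Proof. by move=> sT ax; apply: sT; exists xi. Qed.

Section TensorOperators.
Variables (E H H' K K' : hilbertType R).
Variables (beta : set (bop E H)) (gamma : set (bop E K)).
Variables (beta' : set (bop E H')) (gamma' : set (bop E K')).

(** The bound ||S|| is positivity of the entrywise product of the matrix of [psd_contract] with the
    Gram matrix of the eta's. The two compatibilities supply commutation for the xi's and for the
    operators S xi. *)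
Lemma tens_op_left (S : bop H H') : compat beta gamma -> compat beta' gamma ->
  semimorphism beta beta' S ->
  exists2 U : bop (rtp beta gamma) (rtp beta' gamma),
    (forall xi z eta, beta xi -> gamma eta ->
      U (tens beta gamma xi z eta) = tens beta' gamma (S \ob xi) z eta) &
    nrm U <= nrm S.
Proof.
move=> bg bg' sS.
pose e (x : bop E H * E * bop E K) := tens beta gamma x.1.1 x.1.2 x.2.
pose f (x : bop E H * E * bop E K) := tens beta' gamma (S \ob x.1.1) x.1.2 x.2.
have [||n c a Pa|U Ue US] := @ext_op R _ (tens_index beta gamma) _ _ e f (nrm S).
- exact: nrm_ge0.
- exact: tens_total.
- rewrite -(@ler_pXn2r _ 2) ?nnegrE ?mulr_ge0 ?nrm_ge0// exprMn.
  have b1 i : beta (a i).1.1 by case: (Pa i).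
  have g1 i : gamma (a i).2 by case: (Pa i).
  have b2 i : beta' (S \ob (a i).1.1) by exact: (semiP sS (b1 i)).
  have h := @schur_psd R E 'I_n _ _ (psd_contract (fun i => (a i).1.1) S)
    (psd_gram (fun i => (a i).2)) _ (fun i => c i *: (a i).1.2).
  rewrite -subr_ge0; apply: (le_trans (h _)).
    move=> i j l m; rewrite compDl compDr compNl compNr compZl compZr.
    rewrite (compat_cent' bg (g1 l) (g1 m) (b1 i) (b1 j)).
    by rewrite (compat_cent' bg' (g1 l) (g1 m) (b2 i) (b2 j)).
  rewrite -!Re_inner_sqr -creMR -creN -creD le_eqVlt; apply/orP; left; apply/eqP.
  congr complex.Re; rewrite !inner_suml mulr_sumr -sumrB; apply: eq_bigr => i _.
  rewrite !inner_sumr mulr_sumr -sumrB; apply: eq_bigr => j _.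
  rewrite !innerZl !innerZr !tens_inner//.
  by rewrite bopD bopN bopZ innerBr innerZr /= !bopZr !innerZr; ring.
exists U; last by apply: nrm_bop_le => //; exact: nrm_ge0.
by move=> xi z eta bx gx; apply: (Ue (xi, z, eta)).
Qed.

End TensorOperators.

(** S acts first, then T conjugated by flips, so the intermediate pair [beta'], [gamma] has to be
    compatible too. *)
Lemma tens_op_ex E H H' K K' (beta : set (bop E H)) (gamma : set (bop E K))
  (beta' : set (bop E H')) (gamma' : set (bop E K')) (S : bop H H') (T : bop K K') :
  compat beta gamma -> compat beta' gamma -> compat beta' gamma' ->
  semimorphism beta beta' S -> semimorphism gamma gamma' T ->
  exists2 U : bop (rtp beta gamma) (rtp beta' gamma'),
    (forall xi z eta, beta xi -> gamma eta ->
      U (tens beta gamma xi z eta) = tens beta' gamma' (S \ob xi) z (T \ob eta)) &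
    nrm U <= nrm S * nrm T.
Proof.
move=> c1 c2 c3 sS sT.
have [U1 U1e U1n] := tens_op_left c1 c2 sS.
have [U2 U2e U2n] := tens_op_left (compatC c2) (compatC c3) sT.
exists (flip gamma' beta' \ob U2 \ob flip beta' gamma \ob U1).
  move=> xi z eta bx gx; have bx' := semiP sS bx; have gx' := semiP sT gx.
  by rewrite /= U1e// flip_tens// U2e// flip_tens//; exact: compatC.
have nf A B F G (al : set (bop A F)) (be : set (bop A G)) (W : bop B _) : compat al be ->
    nrm (flip al be \ob W) <= nrm W.
  move=> c; apply: nrm_bop_le => [|x]; first exact: nrm_ge0.
  by rewrite /= nrm_isometry ?nrm_bop//; case: (flip_unitary c).
rewrite -!compopA (le_trans (nf _ _ _ _ _ _ _ (compatC c3)))//.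
rewrite (le_trans (nrm_comp _ _))// mulrC ler_pM ?nrm_ge0//.
by rewrite (le_trans (nf _ _ _ _ _ _ _ c2)).
Qed.

End RelativeTensor.

(** * Calculus of tensor products of operators, associativity and exchange of factors *)

Ltac semi := solve [apply: semiP; eassumption].

Section TensorCalculus.
Variables (R : realType) (E : hilbertType R).
Implicit Types F G H K L : hilbertType R.

Lemma compat_total1 H K (beta : set (bop E H)) (gamma : set (bop E K)) :
  compat beta gamma -> clspan (vecprod beta) = setT.
Proof. by case. Qed.

Lemma compat_total2 H K (beta : set (bop E H)) (gamma : set (bop E K)) :
  compat beta gamma -> clspan (vecprod gamma) = setT.
Proof. by case. Qed.

Lemma semi_id H (alpha : set (bop E H)) : semimorphism alpha alpha (idop H).
Proof. by move=> _ [xi ax <-]; rewrite comp1op. Qed.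

Lemma semi_comp F H K L (alpha : set (bop F H)) (beta : set (bop F K)) (gamma : set (bop F L))
    (S : bop K L) (T : bop H K) :
  semimorphism alpha beta T -> semimorphism beta gamma S -> semimorphism alpha gamma (S \ob T).
Proof. by move=> sT sS _ [xi ax <-]; rewrite -compopA; apply: (semiP sS); exact: (semiP sT ax). Qed.

Lemma semi_rho H K (alpha : set (bop E H)) (beta : set (bop E K)) (S : bop H K) (T : bop E E) :
  clspan (vecprod alpha) = setT -> clspan (vecprod beta) = setT ->
  cent alpha T -> cent beta T -> semimorphism alpha beta S ->
  S \ob rho alpha T = rho beta T \ob S.
Proof.
move=> ta tb ca cb sS; apply: (vecprod_ext ta) => xi ax.
by rewrite -!compopA rhoE// [RHS]rhoE// ?compopA//; semi.
Qed.

Lemma adj_comp4 F0 F G H (A A' : bop G H) (B : bop F G) (B' : bop F0 G) :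
  adj (A \ob B) \ob (A' \ob B') = adj B \ob ((adj A \ob A') \ob B').
Proof. by rewrite adjM !compopA. Qed.

(** Operator-valued form of [unitary_ext]: total families are compared through A_i^* A_j. With kets
    as families it produces associativity, the exchange of the last two factors and the unit
    isomorphisms. *)
Lemma unitary_family I (P : set I) K G G' (A : I -> bop K G) (B : I -> bop K G') :
  clspan (vecprod (A @` P)) = setT -> clspan (vecprod (B @` P)) = setT ->
  (forall i j, P i -> P j -> adj (A i) \ob A j = adj (B i) \ob B j) ->
  exists2 U : bop G G', (forall i, P i -> U \ob A i = B i) & unitary_op U.
Proof.
move=> tA tB AB.
have tot (G0 : hilbertType R) (D : I -> bop K G0) : clspan (vecprod (D @` P)) = setT ->
    clspan [set D x.1 x.2 | x in [set x : I * K | P x.1]] = setT.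
  move=> tD; apply: total_mono tD _ => _ [_ [i Pi <-] [z _ <-]].
  by exists (i, z).
have [|||U UA uU] := @unitary_ext R _ [set x : I * K | P x.1] _ _
  (fun x => A x.1 x.2) (fun x => B x.1 x.2).
- exact: tot.
- exact: tot.
- move=> [i x] [j y] /= Pi Pj; rewrite !adjP -!compopE.
  by rewrite AB.
by exists U => // i Pi; apply: bopP => z; apply: (UA (i, z)).
Qed.

Section TensOp.
Variables (H H' K K' : hilbertType R).
Variables (beta : set (bop E H)) (gamma : set (bop E K)).
Variables (beta' : set (bop E H')) (gamma' : set (bop E K')).
Hypotheses (c1 : compat beta gamma) (c2 : compat beta' gamma) (c3 : compat beta' gamma').
Variables (S : bop H H') (T : bop K K').
Hypotheses (sS : semimorphism beta beta' S) (sT : semimorphism gamma gamma' T).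

Lemma tens_opE xi z eta : beta xi -> gamma eta ->
  tens_op beta gamma beta' gamma' S T (tens beta gamma xi z eta) =
  tens beta' gamma' (S \ob xi) z (T \ob eta).
Proof.
move: xi z eta; rewrite /tens_op; apply: (@xgetPex _ 0 [set U : bop _ _ |
    forall xi z eta, beta xi -> gamma eta ->
      U (tens beta gamma xi z eta) = tens beta' gamma' (S \ob xi) z (T \ob eta)]).
by have [U UE _] := tens_op_ex c1 c2 c3 sS sT; exists U.
Qed.

Lemma tens_op_ket1 xi : beta xi ->
  tens_op beta gamma beta' gamma' S T \ob ket1 beta gamma xi =
  ket1 beta' gamma' (S \ob xi) \ob T.
Proof.
move=> bx; apply: (vecprod_ext (compat_total2 c1)) => eta gx; apply: bopP => z.
rewrite /= ket1_ex// tens_opE// -(compopE T) ket1_ex//; semi.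
Qed.

Lemma tens_op_ket2 eta : gamma eta ->
  tens_op beta gamma beta' gamma' S T \ob ket2 beta gamma eta =
  ket2 beta' gamma' (T \ob eta) \ob S.
Proof.
move=> gx; apply: (vecprod_ext (compat_total1 c1)) => xi bx; apply: bopP => z.
rewrite /= ket2_ex// tens_opE// -(compopE S) ket2_ex//; semi.
Qed.

Lemma nrm_tens_op : nrm (tens_op beta gamma beta' gamma' S T) <= nrm S * nrm T.
Proof.
have [U UE nU] := tens_op_ex c1 c2 c3 sS sT; suff -> : tens_op _ _ _ _ S T = U by [].
apply: (total_ext (tens_total c1)) => _ [[[xi z] eta] [/= bx gx] <-].
by rewrite UE// tens_opE.
Qed.

End TensOp.

(** On semi-morphisms the one-sided operators reduce to [tens_op], so that one set of laws serves
    for all; [tens_rE] is the other side. *)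
Lemma tens_lE H H' K (beta : set (bop E H)) (gamma : set (bop E K))
    (beta' : set (bop E H')) (S : bop H H') :
  compat beta gamma -> compat beta' gamma -> semimorphism beta beta' S ->
  tens_l beta gamma beta' S = tens_op beta gamma beta' gamma S (idop K).
Proof.
move=> c1 c2 sS; have sK := @semi_id K gamma.
apply: (rtp_ext2 c1) => eta gx; rewrite tens_op_ket2// comp1op; move: eta gx.
rewrite /tens_l; apply: (@xgetPex _ 0 [set T : bop _ _ |
    forall eta, gamma eta -> T \ob ket2 beta gamma eta = ket2 beta' gamma eta \ob S]).
by exists (tens_op beta gamma beta' gamma S (idop K)) => eta gx; rewrite tens_op_ket2// comp1op.
Qed.

Lemma tens_rE H K K' (beta : set (bop E H)) (gamma : set (bop E K))
    (gamma' : set (bop E K')) (T : bop K K') :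
  compat beta gamma -> compat beta gamma' -> semimorphism gamma gamma' T ->
  tens_r beta gamma gamma' T = tens_op beta gamma beta gamma' (idop H) T.
Proof.
move=> c1 c2 sS; have sK := @semi_id H beta.
apply: (rtp_ext1 c1) => eta gx; rewrite tens_op_ket1// comp1op; move: eta gx.
rewrite /tens_r; apply: (@xgetPex _ 0 [set T : bop _ _ |
    forall xi, beta xi -> T \ob ket1 beta gamma xi = ket1 beta gamma' xi \ob _]).
by exists (tens_op beta gamma beta gamma' (idop H) T) => eta gx; rewrite tens_op_ket1// comp1op.
Qed.

Lemma tens_op_id H K (beta : set (bop E H)) (gamma : set (bop E K)) :
  compat beta gamma -> tens_op beta gamma beta gamma (idop H) (idop K) = idop _.
Proof.
move=> c; apply: (rtp_ext1 c) => xi bx.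
by rewrite tens_op_ket1 ?comp1op ?compop1//; exact: semi_id.
Qed.

Lemma tens_op_comp H H' H'' K K' K'' (beta : set (bop E H)) (gamma : set (bop E K))
    (beta' : set (bop E H')) (gamma' : set (bop E K'))
    (beta'' : set (bop E H'')) (gamma'' : set (bop E K''))
    (S' : bop H' H'') (T' : bop K' K'') (S : bop H H') (T : bop K K') :
  compat beta gamma -> compat beta' gamma -> compat beta' gamma' ->
  compat beta'' gamma -> compat beta'' gamma' -> compat beta'' gamma'' ->
  semimorphism beta beta' S -> semimorphism gamma gamma' T ->
  semimorphism beta' beta'' S' -> semimorphism gamma' gamma'' T' ->
  tens_op beta' gamma' beta'' gamma'' S' T' \ob tens_op beta gamma beta' gamma' S T =
  tens_op beta gamma beta'' gamma'' (S' \ob S) (T' \ob T).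
Proof.
move=> c1 c2 c3 c4 c5 c6 sS sT sS' sT'; apply: (rtp_ext1 c1) => xi bx.
rewrite -compopA tens_op_ket1// compopA tens_op_ket1//; last semi.
by rewrite tens_op_ket1 ?compopA//; apply: semi_comp; eassumption.
Qed.

Lemma rtp_coext1 H K L (beta : set (bop E H)) (gamma : set (bop E K))
    (A B : bop L (rtp beta gamma)) : compat beta gamma ->
  (forall xi, beta xi -> adj (ket1 beta gamma xi) \ob A = adj (ket1 beta gamma xi) \ob B) -> A = B.
Proof.
move=> c AB; rewrite -[A]adjK -[B]adjK; congr adj; apply: (rtp_ext1 c) => xi bx.
by have := congr1 (@adj _ _ _) (AB xi bx); rewrite !adjM !adjK.
Qed.

(** Between kets of xi and xi' the claim becomes T^* rho ((S xi)^* xi') = rho (xi^* S^* xi') T^*, an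
    instance of [semi_rho] for the adjoint of T. *)
Lemma adj_tens_op H H' K K' (beta : set (bop E H)) (gamma : set (bop E K))
    (beta' : set (bop E H')) (gamma' : set (bop E K')) (S : bop H H') (T : bop K K') :
  compat beta gamma -> compat beta' gamma -> compat beta gamma' -> compat beta' gamma' ->
  morphism beta beta' S -> morphism gamma gamma' T ->
  adj (tens_op beta gamma beta' gamma' S T) =
  tens_op beta' gamma' beta gamma (adj S) (adj T).
Proof.
move=> c1 c2 c3 c4 [sS sS'] [sT sT'].
apply: (rtp_coext1 c1) => xi bx; apply: (rtp_ext1 c4) => xi' bx'.
rewrite -adjM tens_op_ket1// adjM -!compopA tens_op_ket1//.
rewrite ket1_adj//; last semi.
rewrite (compopA (adj (ket1 _ _ xi))) ket1_adj//; last semi.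
rewrite compopA adjM; apply: semi_rho => //.
- exact: compat_total2 c4.
- exact: compat_total2 c1.
- by rewrite -adjM; apply: (compat_cent c4) => //; semi.
- by rewrite -compopA; apply: (compat_cent c1) => //; semi.
Qed.

Lemma morphism_adj F H K (alpha : set (bop F H)) (beta : set (bop F K)) (S : bop H K) :
  morphism alpha beta S -> morphism beta alpha (adj S).
Proof. by move=> [s s']; split=> //; rewrite adjK. Qed.

Lemma morphism_comp F H K L (alpha : set (bop F H)) (beta : set (bop F K)) (gamma : set (bop F L))
    (S : bop K L) (T : bop H K) :
  morphism alpha beta T -> morphism beta gamma S -> morphism alpha gamma (S \ob T).
Proof.
by move=> [s1 s2] [t1 t2]; split; rewrite ?adjM; apply: semi_comp; eassumption.
Qed.

Lemma morphism_id F H (alpha : set (bop F H)) : morphism alpha alpha (idop H).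
Proof. by split; rewrite ?adj1 => _ [xi ax <-]; rewrite comp1op. Qed.

Lemma unitary_morphismP F H K (alpha : set (bop F H)) (beta : set (bop F K)) (U : bop H K) :
  unitary_op U -> (morphism alpha beta U <-> opimage U alpha = beta).
Proof.
move=> [U1 U2]; split=> [[sU sU']|<-].
  apply/seteqP; split=> // xi bx; exists (adj U \ob xi); last by rewrite compopA U2 comp1op.
  semi.
split=> // _ [_ [xi ax <-] <-].
by rewrite compopA U1 comp1op.
Qed.

Lemma unitary_tens_op H H' K K' (beta : set (bop E H)) (gamma : set (bop E K))
    (beta' : set (bop E H')) (gamma' : set (bop E K')) (S : bop H H') (T : bop K K') :
  compat beta gamma -> compat beta' gamma -> compat beta gamma' -> compat beta' gamma' ->
  morphism beta beta' S -> morphism gamma gamma' T -> unitary_op S -> unitary_op T ->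
  unitary_op (tens_op beta gamma beta' gamma' S T).
Proof.
move=> c1 c2 c3 c4 mS mT [S1 S2] [T1 T2]; have [sS sS'] := mS; have [sT sT'] := mT.
by split; rewrite adj_tens_op// tens_op_comp// ?S1 ?S2 ?T1 ?T2 tens_op_id.
Qed.

Section Linear.
Variables (H H' K K' : hilbertType R).
Variables (beta : set (bop E H)) (gamma : set (bop E K)).
Variables (beta' : set (bop E H')) (gamma' : set (bop E K')).
Hypotheses (c1 : compat beta gamma) (c2 : compat beta' gamma) (c3 : compat beta' gamma').

Lemma closedD F L (a : set (bop F L)) x y : closed_subspace a -> a x -> a y -> a (x + y).
Proof. by move=> /csubP[_ aD _] ax ay; have := aD 1 x y ax ay; rewrite scale1r. Qed.

Lemma closedZ F L (a : set (bop F L)) c x : closed_subspace a -> a x -> a (c *: x).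
Proof. by move=> /csubP[a0 aD _] ax; have := aD c x 0 ax a0; rewrite addr0. Qed.

Lemma semiDZ F L L' (a : set (bop F L)) (b : set (bop F L')) c (S T : bop L L') : closed_subspace b ->
  semimorphism a b S -> semimorphism a b T -> semimorphism a b (c *: S + T).
Proof.
move=> cb sS sT _ [xi ax <-]; rewrite compDl compZl; apply: closedD => //.
  by apply: closedZ => //; semi.
semi.
Qed.

Lemma ket1D c xi xi' : beta xi -> beta xi' ->
  ket1 beta gamma (c *: xi + xi') = c *: ket1 beta gamma xi + ket1 beta gamma xi'.
Proof.
have [cb _ tb tg _] := c1; move=> bx bx'.
symmetry; apply: (ket1_uniq c1); first by apply: closedD => //; exact: closedZ.
by move=> eta gx; rewrite compDl compZl compDr compZr !ket12.
Qed.

Lemma ket2D c eta eta' : gamma eta -> gamma eta' ->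
  ket2 beta gamma (c *: eta + eta') = c *: ket2 beta gamma eta + ket2 beta gamma eta'.
Proof.
have [_ cb tb tg _] := c1; move=> bx bx'.
symmetry; apply: (ket2_uniq c1); first by apply: closedD => //; exact: closedZ.
by move=> xi gx; rewrite compDl compZl compDr compZr -!ket12.
Qed.

Lemma tens_op_linear_l c (S S' : bop H H') (T : bop K K') :
  semimorphism beta beta' S -> semimorphism beta beta' S' -> semimorphism gamma gamma' T ->
  tens_op beta gamma beta' gamma' (c *: S + S') T =
  c *: tens_op beta gamma beta' gamma' S T + tens_op beta gamma beta' gamma' S' T.
Proof.
move=> sS sS' sT; have [cb _ _ _ _] := c2; have sD := semiDZ (c := c) cb sS sS'.
apply: (rtp_ext2 c1) => eta gx.
by rewrite compDl compZl !tens_op_ket2// compDr compZr.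
Qed.

Lemma tens_op_linear_r c (S : bop H H') (T T' : bop K K') :
  semimorphism beta beta' S -> semimorphism gamma gamma' T -> semimorphism gamma gamma' T' ->
  tens_op beta gamma beta' gamma' S (c *: T + T') =
  c *: tens_op beta gamma beta' gamma' S T + tens_op beta gamma beta' gamma' S T'.
Proof.
move=> sS sT sT'; have [_ cb _ _ _] := c3; have sD := semiDZ (c := c) cb sT sT'.
apply: (rtp_ext1 c1) => eta gx.
by rewrite compDl compZl !tens_op_ket1// compDr compZr.
Qed.

End Linear.

(* [stable beta gamma eps]: the operators rho_gamma(beta^* beta) act on eps. *)
Definition stable H K F (beta : set (bop E H)) (gamma : set (bop E K)) (eps : set (bop F K)) :=
  forall xi xi', beta xi -> beta xi' -> semimorphism eps eps (rho gamma (adj xi \ob xi')).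

Lemma semi_ket1 F H K (beta : set (bop E H)) (gamma : set (bop E K)) (delta : set (bop F K)) xi :
  beta xi -> semimorphism delta (rtri beta gamma delta) (ket1 beta gamma xi).
Proof. by move=> bx _ [eta dx <-]; apply: sub_opprod => //; exists xi. Qed.

Lemma semi_ket2 F H K (beta : set (bop E H)) (gamma : set (bop E K)) (alpha : set (bop F H)) eta :
  gamma eta -> semimorphism alpha (ltri beta gamma alpha) (ket2 beta gamma eta).
Proof. by move=> bx _ [xi dx <-]; apply: sub_opprod => //; exists eta. Qed.

Section Assoc.
Variables (H K L : hilbertType R).
Variables (beta : set (bop E H)) (gamma eps : set (bop E K)) (phi : set (bop E L)).
Hypotheses (c1 : compat beta gamma) (c2 : compat eps phi).
Hypotheses (c3 : compat (rtri beta gamma eps) phi) (c4 : compat beta (ltri eps phi gamma)).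
Hypothesis st : stable beta gamma eps.

Let te : clspan (vecprod eps) = setT. Proof. exact: compat_total1 c2. Qed.
Let tg : clspan (vecprod gamma) = setT. Proof. exact: compat_total2 c1. Qed.

Lemma rho_comm_stable xi xi' chi chi' : beta xi -> beta xi' -> phi chi -> phi chi' ->
  rho gamma (adj xi \ob xi') \ob rho eps (adj chi \ob chi') =
  rho eps (adj chi \ob chi') \ob rho gamma (adj xi \ob xi').
Proof.
move=> bx bx' px px'; apply: semi_rho => //; try exact: (compat_cent' c2 px px').
exact: st.
Qed.

(** On either side, the Gram operators of the products of two kets are an operator rho_gamma times
    an operator rho_eps, in opposite orders; these commute by [stable], so [unitary_family]
    applies. *)
Lemma assoc_ex : unitary_op (assoc beta gamma eps phi) /\
  forall xi chi, beta xi -> phi chi ->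
  assoc beta gamma eps phi \ob (ket2 (rtri beta gamma eps) phi chi \ob ket1 beta gamma xi) =
  ket1 beta (ltri eps phi gamma) xi \ob ket2 eps phi chi.
Proof.
pose P : set (bop E H * bop E L) := [set x | beta x.1 /\ phi x.2].
pose A (x : bop E H * bop E L) := ket2 (rtri beta gamma eps) phi x.2 \ob ket1 beta gamma x.1.
pose B (x : bop E H * bop E L) := ket1 beta (ltri eps phi gamma) x.1 \ob ket2 eps phi x.2.
have tA : clspan (vecprod (A @` P)) = setT.
  apply: total_mono (total_opprod (total_ket2 c3) (total_ket1 c1)) _.
  move=> _ [_ [_ [chi px <-] [_ [xi bx <-] <-]] [z _ <-]].
  by exists (A (xi, chi)); [exists (xi, chi)|exists z].
have tB : clspan (vecprod (B @` P)) = setT.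
  apply: total_mono (total_opprod (total_ket1 c4) (total_ket2 c2)) _.
  move=> _ [_ [_ [xi bx <-] [_ [chi px <-] <-]] [z _ <-]].
  by exists (B (xi, chi)); [exists (xi, chi)|exists z].
have [|U UA uU] := unitary_family tA tB.
  move=> [xi chi] [xi' chi'] [/= bx px] [/= bx' px'].
  rewrite /A /B /= !adj_comp4 ket2_adj// ket1_adj//.
  have e1 := semi_rho te (compat_total1 c3) (compat_cent' c2 px px')
    (compat_cent' c3 px px') (semi_ket1 (gamma := gamma) (delta := eps) bx').
  have e2 := semi_rho tg (compat_total2 c4) (compat_cent c1 bx bx')
    (compat_cent c4 bx bx') (semi_ket2 (beta := eps) (alpha := gamma) px').
  rewrite -e1 -e2 !compopA ket1_adj// ket2_adj//.
  exact: rho_comm_stable.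
suff -> : assoc beta gamma eps phi = U.
  by split=> // xi chi bx px; apply: (UA (xi, chi)).
apply: (rtp_ext2 c3) => chi px; apply: (rtp_ext1 c1) => xi bx.
rewrite -!compopA (UA (xi, chi))//; move: xi chi bx px.
rewrite /assoc; apply: (@xgetPex _ 0 [set A : bop _ _ |
    forall xi chi, beta xi -> phi chi ->
      A \ob (ket2 (rtri beta gamma eps) phi chi \ob ket1 beta gamma xi) =
      ket1 beta (ltri eps phi gamma) xi \ob ket2 eps phi chi]).
by exists U => xi chi bx px; apply: (UA (xi, chi)).
Qed.

Lemma assoc_unitary : unitary_op (assoc beta gamma eps phi).
Proof. by case: assoc_ex. Qed.

Lemma assoc_ket xi chi : beta xi -> phi chi ->
  assoc beta gamma eps phi \ob (ket2 (rtri beta gamma eps) phi chi \ob ket1 beta gamma xi) =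
  ket1 beta (ltri eps phi gamma) xi \ob ket2 eps phi chi.
Proof. by case: assoc_ex => _; apply. Qed.

Lemma assoc_ket2 chi : phi chi ->
  assoc beta gamma eps phi \ob ket2 (rtri beta gamma eps) phi chi =
  tens_op beta gamma beta (ltri eps phi gamma) (idop H) (ket2 eps phi chi).
Proof.
move=> px; apply: (rtp_ext1 c1) => xi bx.
rewrite -compopA assoc_ket// tens_op_ket1 ?comp1op//; first exact: semi_id.
exact: semi_ket2.
Qed.

Lemma assoc_ket1 xi : beta xi ->
  assoc beta gamma eps phi \ob
    tens_op eps phi (rtri beta gamma eps) phi (ket1 beta gamma xi) (idop L) =
  ket1 beta (ltri eps phi gamma) xi.
Proof.
move=> bx; apply: (rtp_ext2 c2) => chi px.
rewrite -compopA tens_op_ket2 ?comp1op ?assoc_ket//; last exact: semi_id.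
exact: semi_ket1.
Qed.

Lemma assocV_ket1 xi : beta xi ->
  adj (assoc beta gamma eps phi) \ob ket1 beta (ltri eps phi gamma) xi =
  tens_op eps phi (rtri beta gamma eps) phi (ket1 beta gamma xi) (idop L).
Proof. by move=> bx; rewrite -assoc_ket1// compopA assoc_unitary.1 comp1op. Qed.

Lemma assocV_ket2 chi : phi chi ->
  adj (assoc beta gamma eps phi) \ob
    tens_op beta gamma beta (ltri eps phi gamma) (idop H) (ket2 eps phi chi) =
  ket2 (rtri beta gamma eps) phi chi.
Proof. by move=> bx; rewrite -assoc_ket2// compopA assoc_unitary.1 comp1op. Qed.

End Assoc.

Section TensOpStructure.
Variables (F H H' K K' : hilbertType R).
Variables (beta : set (bop E H)) (gamma : set (bop E K)).
Variables (beta' : set (bop E H')) (gamma' : set (bop E K')).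
Hypotheses (c1 : compat beta gamma) (c2 : compat beta' gamma) (c3 : compat beta' gamma').
Variables (S : bop H H') (T : bop K K').
Hypotheses (sS : semimorphism beta beta' S) (sT : semimorphism gamma gamma' T).

Lemma semi_clspan G G' (A : set (bop F G)) (B : set (bop F G')) (U : bop G G') :
  closed_subspace B -> (forall xi, A xi -> B (U \ob xi)) -> semimorphism (clspan A) B U.
Proof. by move=> cB AB _ [xi Axi <-]; exact: (compl_map cB AB). Qed.

Lemma semi_tens_op_ltri (alpha : set (bop F H)) (alpha' : set (bop F H')) :
  semimorphism alpha alpha' S ->
  semimorphism (ltri beta gamma alpha) (ltri beta' gamma' alpha')
    (tens_op beta gamma beta' gamma' S T).
Proof.
move=> sA; apply: semi_clspan; first exact: clspan_closed.
move=> _ [_ [eta gx <-] [xi ax <-]]; rewrite compopA tens_op_ket2// -compopA.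
by apply: sub_opprod; [exists (T \ob eta) => //; semi|semi].
Qed.

Lemma semi_tens_op_rtri (delta : set (bop F K)) (delta' : set (bop F K')) :
  semimorphism delta delta' T ->
  semimorphism (rtri beta gamma delta) (rtri beta' gamma' delta')
    (tens_op beta gamma beta' gamma' S T).
Proof.
move=> sA; apply: semi_clspan; first exact: clspan_closed.
move=> _ [_ [xi gx <-] [eta ax <-]]; rewrite compopA tens_op_ket1// -compopA.
by apply: sub_opprod; [exists (S \ob xi) => //; semi|semi].
Qed.

End TensOpStructure.

Lemma assoc_natural H H' K K' L L' (beta : set (bop E H)) (gamma eps : set (bop E K))
    (phi : set (bop E L)) (beta' : set (bop E H')) (gamma' eps' : set (bop E K'))
    (phi' : set (bop E L')) (S : bop H H') (T : bop K K') (U : bop L L') :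
  compat beta gamma -> compat eps phi ->
  compat (rtri beta gamma eps) phi -> compat beta (ltri eps phi gamma) ->
  stable beta gamma eps ->
  compat beta' gamma' -> compat eps' phi' ->
  compat (rtri beta' gamma' eps') phi' -> compat beta' (ltri eps' phi' gamma') ->
  stable beta' gamma' eps' ->
  compat beta' gamma -> compat eps' phi -> compat (rtri beta' gamma' eps') phi ->
  compat beta' (ltri eps phi gamma) ->
  semimorphism beta beta' S -> semimorphism gamma gamma' T ->
  semimorphism eps eps' T -> semimorphism phi phi' U ->
  assoc beta' gamma' eps' phi' \ob
    tens_op (rtri beta gamma eps) phi (rtri beta' gamma' eps') phi'
      (tens_op beta gamma beta' gamma' S T) U =
  tens_op beta (ltri eps phi gamma) beta' (ltri eps' phi' gamma')
    S (tens_op eps phi eps' phi' T U) \ob assoc beta gamma eps phi.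
Proof.
move=> c1 c2 c3 c4 st c1' c2' c3' c4' st' d1 d2 d3 d4 sS sT sT' sU.
have s1 := semi_tens_op_rtri c1 d1 c1' sS sT sT'.
have s2 := semi_tens_op_ltri c2 d2 c2' sT' sU sT.
apply: (rtp_ext2 c3) => chi px; apply: (rtp_ext1 c1) => xi bx.
have px' : phi' (U \ob chi) by semi.
have bx' : beta' (S \ob xi) by semi.
rewrite -!compopA (compopA (tens_op _ _ _ _ _ U)) tens_op_ket2// -compopA tens_op_ket1//.
rewrite (compopA (ket2 _ _ _)) (compopA (assoc _ _ _ _)) [in LHS]assoc_ket//.
rewrite [in RHS]assoc_ket// [in RHS]compopA tens_op_ket1// -!compopA; congr (_ \ob _).
by rewrite tens_op_ket2.
Qed.

Section Flip23.
Variables (H K L : hilbertType R).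
Variables (beta1 beta2 : set (bop E H)) (gamma1 : set (bop E K)) (gamma2 : set (bop E L)).
Hypotheses (c1 : compat beta1 gamma1) (c2 : compat beta2 gamma2).
Hypotheses (c3 : compat (ltri beta1 gamma1 beta2) gamma2)
  (c4 : compat (ltri beta2 gamma2 beta1) gamma1).
Hypothesis st : stable gamma1 beta1 beta2.

Let te : clspan (vecprod beta1) = setT. Proof. exact: compat_total1 c1. Qed.
Let tg : clspan (vecprod beta2) = setT. Proof. exact: compat_total1 c2. Qed.

Lemma flip23_ex : unitary_op (flip23 beta1 gamma1 beta2 gamma2) /\
  forall eta chi, gamma1 eta -> gamma2 chi ->
  flip23 beta1 gamma1 beta2 gamma2 \ob
    (ket2 (ltri beta1 gamma1 beta2) gamma2 chi \ob ket2 beta1 gamma1 eta) =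
  ket2 (ltri beta2 gamma2 beta1) gamma1 eta \ob ket2 beta2 gamma2 chi.
Proof.
pose P : set (bop E K * bop E L) := [set x | gamma1 x.1 /\ gamma2 x.2].
pose A (x : bop E K * bop E L) := ket2 (ltri beta1 gamma1 beta2) gamma2 x.2 \ob ket2 beta1 gamma1 x.1.
pose B (x : bop E K * bop E L) := ket2 (ltri beta2 gamma2 beta1) gamma1 x.1 \ob ket2 beta2 gamma2 x.2.
have tA : clspan (vecprod (A @` P)) = setT.
  apply: total_mono (total_opprod (total_ket2 c3) (total_ket2 c1)) _.
  move=> _ [_ [_ [chi px <-] [_ [xi bx <-] <-]] [z _ <-]].
  by exists (A (xi, chi)); [exists (xi, chi)|exists z].
have tB : clspan (vecprod (B @` P)) = setT.
  apply: total_mono (total_opprod (total_ket2 c4) (total_ket2 c2)) _.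
  move=> _ [_ [_ [xi bx <-] [_ [chi px <-] <-]] [z _ <-]].
  by exists (B (xi, chi)); [exists (xi, chi)|exists z].
have [|U UA uU] := unitary_family tA tB.
  move=> [xi chi] [xi' chi'] [/= bx px] [/= bx' px'].
  rewrite /A /B /= !adj_comp4 !ket2_adj//.
  have e1 := semi_rho tg (compat_total1 c3) (compat_cent' c2 px px')
    (compat_cent' c3 px px') (semi_ket2 (beta := beta1) (alpha := beta2) bx').
  have e2 := semi_rho te (compat_total1 c4) (compat_cent' c1 bx bx')
    (compat_cent' c4 bx bx') (semi_ket2 (beta := beta2) (alpha := beta1) px').
  rewrite -e1 -e2 !compopA !ket2_adj//; apply: semi_rho => //.
  - exact: (compat_cent' c2 px px').
  - exact: (compat_cent' c2 px px').
  - exact: st.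
suff -> : flip23 beta1 gamma1 beta2 gamma2 = U.
  by split=> // xi chi bx px; apply: (UA (xi, chi)).
apply: (rtp_ext2 c3) => chi px; apply: (rtp_ext2 c1) => xi bx.
rewrite -!compopA (UA (xi, chi))//; move: xi chi bx px.
rewrite /flip23; apply: (@xgetPex _ 0 [set S : bop _ _ |
    forall eta chi, gamma1 eta -> gamma2 chi ->
      S \ob (ket2 (ltri beta1 gamma1 beta2) gamma2 chi \ob
             ket2 beta1 gamma1 eta) =
      ket2 (ltri beta2 gamma2 beta1) gamma1 eta \ob ket2 beta2 gamma2 chi]).
by exists U => xi chi bx px; apply: (UA (xi, chi)).
Qed.

Lemma flip23_unitary : unitary_op (flip23 beta1 gamma1 beta2 gamma2).
Proof. by case: flip23_ex. Qed.

Lemma flip23_ket eta chi : gamma1 eta -> gamma2 chi ->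
  flip23 beta1 gamma1 beta2 gamma2 \ob
    (ket2 (ltri beta1 gamma1 beta2) gamma2 chi \ob ket2 beta1 gamma1 eta) =
  ket2 (ltri beta2 gamma2 beta1) gamma1 eta \ob ket2 beta2 gamma2 chi.
Proof. by case: flip23_ex => _; apply. Qed.

Lemma flip23_ket2 chi : gamma2 chi ->
  flip23 beta1 gamma1 beta2 gamma2 \ob ket2 (ltri beta1 gamma1 beta2) gamma2 chi =
  tens_op beta1 gamma1 (ltri beta2 gamma2 beta1) gamma1 (ket2 beta2 gamma2 chi) (idop K).
Proof.
move=> px; apply: (rtp_ext2 c1) => eta gx.
rewrite -compopA flip23_ket// tens_op_ket2 ?comp1op//; last exact: semi_id.
exact: semi_ket2.
Qed.

End Flip23.

End TensorCalculus.

(** * Module structures *)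

Section ClosedFamilies.
Variable R : realType.
Implicit Types E F G H K L : hilbertType R.

Lemma adj_clspan H K (A : set (bop H K)) : @adj R H K @` clspan A = clspan (@adj R H K @` A).
Proof.
apply/seteqP; split.
  move=> _ [T AT <-]; apply: (adj_map (clspan_closed _) _ AT) => S AS.
  by apply: sub_clspan; exists S.
move=> T AT; exists (adj T); last by rewrite adjK.
by apply: (adj_map (clspan_closed _) _ AT) => _ [S AS <-]; rewrite adjK; exact: sub_clspan.
Qed.

Lemma adj_opprod H K L (A : set (bop K L)) (B : set (bop H K)) :
  @adj R H L @` opprod A B = opprod (@adj R H K @` B) (@adj R K L @` A).
Proof.
apply/seteqP; split.
  move=> _ [_ [S AS [T BT <-]] <-]; rewrite adjM; exists (adj T); first by exists T.
  by exists (adj S) => //; exists S.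
move=> _ [_ [T BT <-] [_ [S AS <-] <-]]; exists (S \ob T); last by rewrite adjM.
by exists S => //; exists T.
Qed.

(* A map f, linear and bounded only on the closed subspace A. *)
Lemma clspan_map_on H K H' K' (A : set (bop H K)) (f : bop H K -> bop H' K') (M : R)
    (Y : set (bop H K)) (B : set (bop H' K')) :
  closed_subspace A -> closed_subspace B -> Y `<=` A ->
  (forall c x y, A x -> A y -> f (c *: x + y) = c *: f x + f y) ->
  (forall x, A x -> nrm (f x) <= M * nrm x) ->
  (forall y, Y y -> B (f y)) -> forall x, clspan Y x -> B (f x).
Proof.
move=> /csubP[A0 AD cA] /csubP[B0 BD cB] YA fD fM YB x cx.
have f0 : f 0 = 0.
  have := fD 1 0 0 A0 A0; rewrite !scale1r addr0 => /eqP.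
  by rewrite -subr_eq subrr => /eqP.
suff : A x /\ B (f x) by case.
have AN a : A a -> A (- a) by move=> Aa; have := AD (-1) a 0 Aa A0; rewrite scaleN1r addr0.
apply: (clspan_min (B := [set x | A x /\ B (f x)])) cx.
  apply/csubP; split=> [|c u v [Au Bu] [Av Bv]|u cu] /=.
  - by rewrite f0.
  - by rewrite fD//; split; [exact: AD|exact: BD].
  - have Au : A u by apply: cA; apply: closure_subset cu => ? [].
    split=> //; apply: cB; apply/closureE => e e0.
    have M0 : 0 < `|M| + 1 by rewrite ltr_wpDl.
    have [v [Av Bv] uv] := (closureE _ _).1 cu _ (divr_gt0 e0 M0).
    exists (f v) => //.
    have -> : f u - f v = f (u - v).
      by rewrite addrC -scaleN1r -fD// scaleN1r addrC.
    have Auv : A (u - v) by have := AD 1 u (- v) Au (AN _ Av); rewrite scale1r.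
    rewrite (le_lt_trans (fM _ Auv))//.
    move: uv; rewrite ltr_pdivlMr// => uv; have := nrm_ge0 (u - v).
    by have := ler_norm M; nra.
by move=> u Yu; split; [exact: YA|exact: YB].
Qed.

End ClosedFamilies.

Section Modules.
Variables (R : realType) (b : cstar_base R).
Notation E := (bK b).
Implicit Types F G H K L : hilbertType R.

(** The boolean chooses between the two algebras of the base, so that [negb] exchanges them and each
    rule is proved once for both kinds of modules. *)
Definition alg (k : bool) : set (bop E E) := if k then bB b else bBd b.

Lemma alg_nondeg k : nondegenerate_cstar_algebra (alg k).
Proof. by case: k; [exact: bB_cstar|exact: bBd_cstar]. Qed.

Lemma alg_closed k : closed_subspace (alg k).
Proof. by case: (alg_nondeg k). Qed.

Lemma algJ k S : alg k S -> alg k (adj S).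
Proof. by case: (alg_nondeg k) => _ _ + _; apply. Qed.

Lemma alg_comm k S T : alg k S -> alg (~~ k) T -> S \ob T = T \ob S.
Proof. by case: k => /= kS kT; [exact: b_commute|symmetry; exact: b_commute]. Qed.

(* Kind [true]: C*-b-module; kind [false]: C*-b^dagger-module. *)
Definition modk k H (alpha : set (bop E H)) : Prop :=
  [/\ closed_subspace alpha,
      clspan (vecprod alpha) = setT,
      clspan (opprod alpha (alg k)) = alpha
    & clspan (opprod (@adj _ _ _ @` alpha) alpha) = alg k].

Definition stab k H F (alpha : set (bop E H)) (beta : set (bop F H)) : Prop :=
  clspan (opprod (rho alpha @` alg (~~ k)) beta) = beta.

Section ModFacts.
Variables (k : bool) (H : hilbertType R) (alpha : set (bop E H)).
Hypothesis ma : modk k alpha.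

Lemma mod_closed : closed_subspace alpha. Proof. by case: ma. Qed.
Lemma mod_total : clspan (vecprod alpha) = setT. Proof. by case: ma. Qed.

Lemma mod_gram xi xi' : alpha xi -> alpha xi' -> alg k (adj xi \ob xi').
Proof. by move=> ax ax'; case: ma => _ _ _ <-; apply: sub_opprod => //; exists xi. Qed.

Lemma mod_mul xi T : alpha xi -> alg k T -> alpha (xi \ob T).
Proof. by move=> ax kT; case: ma => _ _ <- _; apply: sub_opprod. Qed.

Lemma mod_cent T : alg (~~ k) T -> cent alpha T.
Proof. by move=> kT xi xi' ax ax'; apply: (alg_comm _ kT); exact: mod_gram. Qed.

Lemma mod_rhoE T xi : alg (~~ k) T -> alpha xi -> rho alpha T \ob xi = xi \ob T.
Proof. by move=> kT ax; apply: rhoE => //; [exact: mod_total|exact: mod_cent]. Qed.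

Lemma mod_adj_rho T : alg (~~ k) T -> adj (rho alpha T) = rho alpha (adj T).
Proof. by move=> kT; apply: adj_rho; [exact: mod_total|exact: mod_cent]. Qed.

Lemma mod_rho_linear c S T : alg (~~ k) S -> alg (~~ k) T ->
  rho alpha (c *: S + T) = c *: rho alpha S + rho alpha T.
Proof.
move=> kS kT; apply: rho_uniq => [|xi ax]; first exact: mod_total.
by rewrite compDl compZl compDr compZr !mod_rhoE.
Qed.

Lemma mod_nrm_rho T : alg (~~ k) T -> nrm (rho alpha T) <= nrm T.
Proof. by move=> kT; apply: nrm_rho; [exact: mod_total|exact: mod_cent]. Qed.

Lemma stab_semi F (beta : set (bop F H)) T : stab k alpha beta -> alg (~~ k) T ->
  semimorphism beta beta (rho alpha T).
Proof.
move=> st kT _ [xi bx <-]; rewrite -st; exact: sub_opprod.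
Qed.

Lemma stab_morphism F (beta : set (bop F H)) T : stab k alpha beta -> alg (~~ k) T ->
  morphism beta beta (rho alpha T).
Proof.
move=> st kT; split; first exact: stab_semi.
by rewrite mod_adj_rho//; apply: stab_semi => //; exact: algJ.
Qed.

Lemma rho_clspan F (Y : set (bop E E)) (beta : set (bop F H)) : Y `<=` alg (~~ k) ->
  clspan (opprod (rho alpha @` clspan Y) beta) = clspan (opprod (rho alpha @` Y) beta).
Proof.
move=> Yk; apply/seteqP; split; apply: clspan_sub; last first.
  move=> _ [_ [T YT <-] [xi bx <-]]; apply: sub_opprod => //; exists T => //.
  exact: sub_clspan.
move=> _ [_ [T YT <-] [xi bx <-]].
rewrite -opprod_clspanl; apply: sub_opprod => //.
apply: (@clspan_map_on R _ _ _ _ (alg (~~ k)) _ 1 Y) => //.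
- exact: alg_closed.
- exact: clspan_closed.
- by move=> c S S' kS kS'; rewrite mod_rho_linear.
- by move=> S kS; rewrite mul1r mod_nrm_rho.
- by move=> S YS; apply: sub_clspan; exists S.
Qed.

End ModFacts.

Lemma compat_mod k H K (beta : set (bop E H)) (gamma : set (bop E K)) :
  modk k beta -> modk (~~ k) gamma -> compat beta gamma.
Proof.
move=> mb mg; split; try exact: mod_closed mb; try exact: mod_closed mg;
  try exact: mod_total mb; try exact: mod_total mg.
move=> xi xi' eta eta' bx bx' gx gx'.
exact: (alg_comm (mod_gram mb bx bx') (mod_gram mg gx gx')).
Qed.

Lemma stable_mod k H K F (beta : set (bop E H)) (gamma : set (bop E K)) (eps : set (bop F K)) :
  modk (~~ k) beta -> modk k gamma -> stab k gamma eps -> stable beta gamma eps.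
Proof.
by move=> mb mg st xi xi' bx bx'; apply: (stab_semi st); exact: (mod_gram mb).
Qed.

(* The common part of the proofs that alpha <| gamma and beta |> delta are
   module structures: kets is |gamma>_2, resp. |beta>_1. *)
Lemma fiber_mod k j H G (beta alpha : set (bop E H)) (kets : set (bop H G)) (Y : set (bop E E)) :
  modk k beta -> modk j alpha -> stab k beta alpha ->
  clspan (vecprod kets) = setT -> clspan Y = alg (~~ k) ->
  opprod (@adj _ _ _ @` kets) kets = rho beta @` Y ->
  modk j (clspan (opprod kets alpha)).
Proof.
move=> mb ma st tk Yk kk; split.
- exact: clspan_closed.
- apply: (total_vecprod (A := opprod kets alpha)).
    by move=> T kT; apply: sub_clspan; exact: sub_clspan.
  by apply: total_opprod => //; exact: mod_total ma.
- rewrite opprod_clspanl -opprodA -opprod_clspanr.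
  by case: ma => _ _ -> _.
- rewrite adj_clspan opprod_clspanl opprod_clspanr adj_opprod.
  rewrite -opprodA (opprodA (@adj _ _ _ @` kets)) kk -opprod_clspanr.
  rewrite -(rho_clspan mb) ?Yk; last by rewrite -Yk; exact: sub_clspan.
  by rewrite st; case: ma.
Qed.

Section RelativeTensorModules.
Variables (k : bool) (H K : hilbertType R).
Variables (beta : set (bop E H)) (gamma : set (bop E K)).
Hypotheses (mb : modk k beta) (mg : modk (~~ k) gamma).

Let bg : compat beta gamma := compat_mod mb mg.
Let gb : compat gamma beta := compatC bg.

Lemma gram_alg (l : bool) L (a : set (bop E L)) : modk l a ->
  clspan (opprod (@adj _ _ _ @` a) a) = alg l.
Proof. by case. Qed.

Lemma mod_ltri j (alpha : set (bop E H)) : modk j alpha -> stab k beta alpha ->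
  modk j (ltri beta gamma alpha).
Proof.
move=> ma st; apply: (fiber_mod mb ma st (total_ket2 bg) (gram_alg mg)).
apply/seteqP; split.
  move=> _ [_ [_ [eta gx <-] <-] [_ [eta' gx' <-] <-]]; rewrite ket2_adj//.
  exists (adj eta \ob eta') => //; exists (adj eta); first by exists eta.
  by exists eta'.
move=> _ [_ [_ [eta gx <-] [eta' gx' <-]] <-]; exists (adj (ket2 beta gamma eta)).
  by exists (ket2 beta gamma eta) => //; exists eta.
by exists (ket2 beta gamma eta'); [exists eta'|rewrite ket2_adj].
Qed.

Lemma mod_rtri j (delta : set (bop E K)) : modk j delta -> stab (~~ k) gamma delta ->
  modk j (rtri beta gamma delta).
Proof.
move=> ma st.
have Yk : clspan (opprod (@adj _ _ _ @` beta) beta) = alg (~~ ~~ k).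
  by rewrite negbK; exact: gram_alg.
apply: (fiber_mod mg ma st (total_ket1 bg) Yk).
apply/seteqP; split.
  move=> _ [_ [_ [eta gx <-] <-] [_ [eta' gx' <-] <-]]; rewrite ket1_adj//.
  exists (adj eta \ob eta') => //; exists (adj eta); first by exists eta.
  by exists eta'.
move=> _ [_ [_ [eta gx <-] [eta' gx' <-]] <-]; exists (adj (ket1 beta gamma eta)).
  by exists (ket1 beta gamma eta) => //; exists eta.
by exists (ket1 beta gamma eta'); [exists eta'|rewrite ket1_adj].
Qed.

Lemma nrm_ket1 xi : beta xi -> nrm (ket1 beta gamma xi) <= nrm xi.
Proof.
move=> bx; rewrite -ler_sqr ?nnegrE ?nrm_ge0// -!nrm_cstar ket1_adj//.
by apply: (mod_nrm_rho mg); rewrite negbK; exact: (mod_gram mb bx bx).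
Qed.

Lemma nrm_ket2 eta : gamma eta -> nrm (ket2 beta gamma eta) <= nrm eta.
Proof.
move=> bx; rewrite -ler_sqr ?nnegrE ?nrm_ge0// -!nrm_cstar ket2_adj//.
by apply: (mod_nrm_rho mb); exact: (mod_gram mg bx bx).
Qed.

(** Used where [beta] is itself a closed span, such as [rtri beta gamma eps]: kets of generators
    then suffice. Linearity and the norm bound of kets are available within [beta], hence the
    restriction on Z. *)
Lemma ket1_clspan F (Z : set (bop E H)) (delta : set (bop F K)) : Z `<=` beta ->
  clspan (opprod (ket1 beta gamma @` clspan Z) delta) =
  clspan (opprod (ket1 beta gamma @` Z) delta).
Proof.
move=> Zb; apply/seteqP; split; apply: clspan_sub; last first.
  move=> _ [_ [T YT <-] [xi bx <-]]; apply: sub_opprod => //; exists T => //.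
  exact: sub_clspan.
move=> _ [_ [T YT <-] [xi bx <-]].
rewrite -opprod_clspanl; apply: sub_opprod => //.
apply: (@clspan_map_on R _ _ _ _ beta _ 1 Z) => //.
- exact: mod_closed mb.
- exact: clspan_closed.
- by move=> c S S' kS kS'; exact: (ket1D bg).
- by move=> S kS; rewrite mul1r nrm_ket1.
- by move=> S YS; apply: sub_clspan; exists S.
Qed.

Lemma ket2_clspan F (Z : set (bop E K)) (alpha : set (bop F H)) : Z `<=` gamma ->
  clspan (opprod (ket2 beta gamma @` clspan Z) alpha) =
  clspan (opprod (ket2 beta gamma @` Z) alpha).
Proof.
move=> Zb; apply/seteqP; split; apply: clspan_sub; last first.
  move=> _ [_ [T YT <-] [xi bx <-]]; apply: sub_opprod => //; exists T => //.
  exact: sub_clspan.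
move=> _ [_ [T YT <-] [xi bx <-]].
rewrite -opprod_clspanl; apply: sub_opprod => //.
apply: (@clspan_map_on R _ _ _ _ gamma _ 1 Z) => //.
- exact: mod_closed mg.
- exact: clspan_closed.
- by move=> c S S' kS kS'; exact: (ket2D bg).
- by move=> S kS; rewrite mul1r nrm_ket2.
- by move=> S YS; apply: sub_clspan; exists S.
Qed.

Section LeftRho.
Variables (j : bool) (alpha : set (bop E H)).
Hypotheses (ma : modk j alpha) (sa : stab k beta alpha).
Let ml := mod_ltri ma sa.

Lemma rho_ltri_ket2 T eta : alg (~~ j) T -> gamma eta ->
  rho (ltri beta gamma alpha) T \ob ket2 beta gamma eta = ket2 beta gamma eta \ob rho alpha T.
Proof.
move=> jT gx; symmetry; apply: semi_rho.
- exact: mod_total ma.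
- exact: mod_total ml.
- exact: (mod_cent ma jT).
- exact: (mod_cent ml jT).
- exact: semi_ket2.
Qed.

Lemma rho_ltri_ket1 T xi : stab j alpha beta -> alg (~~ j) T -> beta xi ->
  rho (ltri beta gamma alpha) T \ob ket1 beta gamma xi =
  ket1 beta gamma (rho alpha T \ob xi).
Proof.
move=> st jT bx; have sT := stab_semi st jT; apply: (ket1_uniq bg); first by semi.
by move=> eta gx; rewrite -compopA ket12// compopA rho_ltri_ket2// compopA.
Qed.

(** In the names [stab_ll] to [stab_rl] the first letter tells which factor carries the acting
    structure, the second which carries the structure acted upon. Moving [rho] past a ket reduces
    each case to a stability within one factor. *)
Lemma stab_ll F (alpha' : set (bop F H)) : stab j alpha alpha' ->
  stab j (ltri beta gamma alpha) (ltri beta gamma alpha').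
Proof.
move=> st; rewrite /stab /ltri opprod_clspanr opprodA.
rewrite (_ : opprod (rho _ @` _) _ =
  opprod (ket2 beta gamma @` gamma) (rho alpha @` alg (~~ j))); last first.
  apply/seteqP; split.
    move=> _ [_ [T jT <-] [_ [eta gx <-] <-]]; rewrite rho_ltri_ket2//.
    by exists (ket2 beta gamma eta); [exists eta|exists (rho alpha T) => //; exists T].
  move=> _ [_ [eta gx <-] [_ [T jT <-] <-]]; rewrite -rho_ltri_ket2//.
  by exists (rho (ltri beta gamma alpha) T); [exists T|exists (ket2 beta gamma eta) => //; exists eta].
by rewrite -opprodA -opprod_clspanr st.
Qed.

Lemma stab_lr F (delta : set (bop F K)) : stab j alpha beta ->
  stab j (ltri beta gamma alpha) (rtri beta gamma delta).
Proof.
move=> st; rewrite /stab /rtri opprod_clspanr opprodA.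
rewrite (_ : opprod (rho _ @` _) _ =
  ket1 beta gamma @` (opprod (rho alpha @` alg (~~ j)) beta)); last first.
  apply/seteqP; split.
    move=> _ [_ [T jT <-] [_ [eta gx <-] <-]]; rewrite rho_ltri_ket1//.
    by exists (rho alpha T \ob eta) => //; exists (rho alpha T); [exists T|exists eta].
  move=> _ [_ [_ [T jT <-] [xi bx <-]] <-]; rewrite -rho_ltri_ket1//.
  by exists (rho (ltri beta gamma alpha) T); [exists T|exists (ket1 beta gamma xi) => //; exists xi].
rewrite -ket1_clspan ?st// => _ [_ [T jT <-] [xi bx <-]].
by have sT := stab_semi st jT; semi.
Qed.

End LeftRho.

Section RightRho.
Variables (j : bool) (delta : set (bop E K)).
Hypotheses (md : modk j delta) (sd : stab (~~ k) gamma delta).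
Let mr := mod_rtri md sd.

Lemma rho_rtri_ket1 T xi : alg (~~ j) T -> beta xi ->
  rho (rtri beta gamma delta) T \ob ket1 beta gamma xi = ket1 beta gamma xi \ob rho delta T.
Proof.
move=> jT gx; symmetry; apply: semi_rho.
- exact: mod_total md.
- exact: mod_total mr.
- exact: (mod_cent md jT).
- exact: (mod_cent mr jT).
- exact: semi_ket1.
Qed.

Lemma rho_rtri_ket2 T eta : stab j delta gamma -> alg (~~ j) T -> gamma eta ->
  rho (rtri beta gamma delta) T \ob ket2 beta gamma eta =
  ket2 beta gamma (rho delta T \ob eta).
Proof.
move=> st jT bx; have sT := stab_semi st jT; apply: (ket2_uniq bg); first by semi.
by move=> xi gx; rewrite -compopA -ket12// compopA rho_rtri_ket1// compopA.
Qed.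

Lemma stab_rr F (delta' : set (bop F K)) : stab j delta delta' ->
  stab j (rtri beta gamma delta) (rtri beta gamma delta').
Proof.
move=> st; rewrite /stab /rtri opprod_clspanr opprodA.
rewrite (_ : opprod (rho _ @` _) _ =
  opprod (ket1 beta gamma @` beta) (rho delta @` alg (~~ j))); last first.
  apply/seteqP; split.
    move=> _ [_ [T jT <-] [_ [eta gx <-] <-]]; rewrite rho_rtri_ket1//.
    by exists (ket1 beta gamma eta); [exists eta|exists (rho delta T) => //; exists T].
  move=> _ [_ [eta gx <-] [_ [T jT <-] <-]]; rewrite -rho_rtri_ket1//.
  by exists (rho (rtri beta gamma delta) T); [exists T|exists (ket1 beta gamma eta) => //; exists eta].
by rewrite -opprodA -opprod_clspanr st.
Qed.

Lemma stab_rl F (alpha : set (bop F H)) : stab j delta gamma ->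
  stab j (rtri beta gamma delta) (ltri beta gamma alpha).
Proof.
move=> st; rewrite /stab /ltri opprod_clspanr opprodA.
rewrite (_ : opprod (rho _ @` _) _ =
  ket2 beta gamma @` (opprod (rho delta @` alg (~~ j)) gamma)); last first.
  apply/seteqP; split.
    move=> _ [_ [T jT <-] [_ [eta gx <-] <-]]; rewrite rho_rtri_ket2//.
    by exists (rho delta T \ob eta) => //; exists (rho delta T); [exists T|exists eta].
  move=> _ [_ [_ [T jT <-] [xi bx <-]] <-]; rewrite -rho_rtri_ket2//.
  by exists (rho (rtri beta gamma delta) T); [exists T|exists (ket2 beta gamma xi) => //; exists xi].
rewrite -ket2_clspan ?st// => _ [_ [T jT <-] [xi bx <-]].
by have sT := stab_semi st jT; semi.
Qed.

End RightRho.
End RelativeTensorModules.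

End Modules.

(** * How flips, tensor products and associativity transport module structures *)

Section StructureRules.
Variables (R : realType) (b : cstar_base R).
Notation E := (bK b).
Implicit Types F G H K L : hilbertType R.

Lemma clspan_image F G G' (U : bop G G') (A : set (bop F G)) (B : set (bop F G')) :
  unitary_op U -> opimage U A = B -> opimage U (clspan A) = clspan B.
Proof. by move=> uU <-; exact: opimage_clspan. Qed.

Lemma ltri_ltri H K L F (b1 : set (bop E H)) (g1 : set (bop E K))
    (b2 : set (bop E (rtp b1 g1))) (g2 : set (bop E L)) (a : set (bop F H)) :
  ltri b2 g2 (ltri b1 g1 a) =
  clspan (opprod (opprod (ket2 b2 g2 @` g2) (ket2 b1 g1 @` g1)) a).
Proof. by rewrite /ltri opprod_clspanr opprodA. Qed.

Lemma ltri_rtri H K L F (b1 : set (bop E H)) (g1 : set (bop E K))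
    (b2 : set (bop E (rtp b1 g1))) (g2 : set (bop E L)) (a : set (bop F K)) :
  ltri b2 g2 (rtri b1 g1 a) =
  clspan (opprod (opprod (ket2 b2 g2 @` g2) (ket1 b1 g1 @` b1)) a).
Proof. by rewrite /ltri opprod_clspanr opprodA. Qed.

Lemma rtri_ltri H K L F (b1 : set (bop E H)) (b2 : set (bop E K)) (g2 : set (bop E L))
    (g1 : set (bop E (rtp b2 g2))) (a : set (bop F K)) :
  rtri b1 g1 (ltri b2 g2 a) =
  clspan (opprod (opprod (ket1 b1 g1 @` b1) (ket2 b2 g2 @` g2)) a).
Proof. by rewrite /rtri opprod_clspanr opprodA. Qed.

Lemma rtri_rtri H K L F (b1 : set (bop E H)) (b2 : set (bop E K)) (g2 : set (bop E L))
    (g1 : set (bop E (rtp b2 g2))) (a : set (bop F L)) :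
  rtri b1 g1 (rtri b2 g2 a) =
  clspan (opprod (opprod (ket1 b1 g1 @` b1) (ket1 b2 g2 @` b2)) a).
Proof. by rewrite /rtri opprod_clspanr opprodA. Qed.

Lemma opimage_opprod F G G' H (U : bop G G') (A : set (bop H G)) (B : set (bop F H)) :
  opimage U (opprod A B) = opprod (opimage U A) B.
Proof.
apply/seteqP; split.
  move=> _ [_ [S AS [T BT <-]] <-]; exists (U \ob S); first by exists S.
  by exists T => //; rewrite compopA.
move=> _ [_ [S AS <-] [T BT <-]]; exists (S \ob T); last by rewrite compopA.
by exists S => //; exists T.
Qed.

Section Flip.
Variables (k : bool) (H K : hilbertType R).
Variables (beta : set (bop E H)) (gamma : set (bop E K)).
Hypothesis c : compat beta gamma.

Lemma morphism_flip_l F (alpha : set (bop F H)) :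
  morphism (ltri beta gamma alpha) (rtri gamma beta alpha) (flip beta gamma).
Proof.
apply/unitary_morphismP; first exact: flip_unitary.
apply: clspan_image; first exact: flip_unitary.
rewrite opimage_opprod; congr opprod; apply/seteqP; split.
  by move=> _ [_ [eta gx <-] <-]; rewrite flip_ket2//; exists eta.
move=> _ [eta gx <-]; exists (ket2 beta gamma eta); first by exists eta.
by rewrite flip_ket2.
Qed.

Lemma morphism_flip_r F (delta : set (bop F K)) :
  morphism (rtri beta gamma delta) (ltri gamma beta delta) (flip beta gamma).
Proof.
apply/unitary_morphismP; first exact: flip_unitary.
apply: clspan_image; first exact: flip_unitary.
rewrite opimage_opprod; congr opprod; apply/seteqP; split.
  by move=> _ [_ [eta gx <-] <-]; rewrite flip_ket1//; exists eta.
move=> _ [eta gx <-]; exists (ket1 beta gamma eta); first by exists eta.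
by rewrite flip_ket1.
Qed.

End Flip.

Section TensOpRules.
Variables (F H H' K K' : hilbertType R).
Variables (beta : set (bop E H)) (gamma : set (bop E K)).
Variables (beta' : set (bop E H')) (gamma' : set (bop E K')).
Hypotheses (c1 : compat beta gamma) (c2 : compat beta' gamma)
  (c3 : compat beta gamma') (c4 : compat beta' gamma').
Variables (S : bop H H') (T : bop K K').
Hypotheses (mS : morphism beta beta' S) (mT : morphism gamma gamma' T).

Lemma morphism_tens_op_ltri (alpha : set (bop F H)) (alpha' : set (bop F H')) :
  morphism alpha alpha' S ->
  morphism (ltri beta gamma alpha) (ltri beta' gamma' alpha')
    (tens_op beta gamma beta' gamma' S T).
Proof.
move=> [sA sA']; have [s s'] := mS; have [t t'] := mT; split.
  exact: semi_tens_op_ltri.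
by rewrite adj_tens_op//; exact: semi_tens_op_ltri.
Qed.

Lemma morphism_tens_op_rtri (delta : set (bop F K)) (delta' : set (bop F K')) :
  morphism delta delta' T ->
  morphism (rtri beta gamma delta) (rtri beta' gamma' delta')
    (tens_op beta gamma beta' gamma' S T).
Proof.
move=> [sA sA']; have [s s'] := mS; have [t t'] := mT; split.
  exact: semi_tens_op_rtri.
by rewrite adj_tens_op//; exact: semi_tens_op_rtri.
Qed.

End TensOpRules.

Section AssocRules.
Variables (k l : bool) (F H K L : hilbertType R).
Variables (beta : set (bop E H)) (gamma eps : set (bop E K)) (phi : set (bop E L)).
Hypotheses (mb : modk k beta) (mg : modk (~~ k) gamma).
Hypotheses (me : modk l eps) (mp : modk (~~ l) phi).
Hypotheses (sge : stab (~~ k) gamma eps) (seg : stab l eps gamma).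

Let c1 : compat beta gamma := compat_mod mb mg.
Let c2 : compat eps phi := compat_mod me mp.
Let mr : modk l (rtri beta gamma eps) := mod_rtri mb mg me sge.
Let ml : modk (~~ k) (ltri eps phi gamma) := mod_ltri me mp mg seg.
Let c3 : compat (rtri beta gamma eps) phi := compat_mod mr mp.
Let c4 : compat beta (ltri eps phi gamma) := compat_mod mb ml.
Let st : stable beta gamma eps.
Proof.
have mb' : modk (~~ ~~ k) beta by rewrite negbK.
exact: stable_mod mb' mg sge.
Qed.

Let uA : unitary_op (assoc beta gamma eps phi).
Proof. exact: assoc_unitary. Qed.

(** The suffixes l, m, r tell which of the three factors carries the structure. In each case both
    sides are spanned by products of two kets, and associativity maps one set of products onto the
    other. *)
Lemma morphism_assoc_l (a : set (bop F H)) :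
  morphism (ltri (rtri beta gamma eps) phi (ltri beta gamma a))
    (ltri beta (ltri eps phi gamma) a) (assoc beta gamma eps phi).
Proof.
apply/unitary_morphismP => //; rewrite ltri_ltri [RHS](ket2_clspan mb ml); last first.
  exact: sub_clspan.
apply: clspan_image => //; rewrite opimage_opprod; congr opprod.
have h chi eta : phi chi -> gamma eta -> assoc beta gamma eps phi \ob
    (ket2 (rtri beta gamma eps) phi chi \ob ket2 beta gamma eta) =
    ket2 beta (ltri eps phi gamma) (ket2 eps phi chi \ob eta).
  move=> px gx; rewrite compopA assoc_ket2// tens_op_ket2 ?compop1//.
    exact: semi_id.
  exact: semi_ket2.
apply/seteqP; split.
  move=> _ [_ [_ [chi px <-] [_ [eta gx <-] <-]] <-]; rewrite h//.
  exists (ket2 eps phi chi \ob eta) => //.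
  by exists (ket2 eps phi chi); [exists chi|exists eta].
move=> _ [_ [_ [chi px <-] [eta gx <-]] <-].
exists (ket2 (rtri beta gamma eps) phi chi \ob ket2 beta gamma eta); last by rewrite h.
exists (ket2 (rtri beta gamma eps) phi chi); first by exists chi.
by exists (ket2 beta gamma eta) => //; exists eta.
Qed.

Lemma morphism_assoc_m (a : set (bop F K)) :
  morphism (ltri (rtri beta gamma eps) phi (rtri beta gamma a))
    (rtri beta (ltri eps phi gamma) (ltri eps phi a)) (assoc beta gamma eps phi).
Proof.
apply/unitary_morphismP => //; rewrite ltri_rtri rtri_ltri.
apply: clspan_image => //; rewrite opimage_opprod; congr opprod.
apply/seteqP; split.
  move=> _ [_ [_ [chi px <-] [_ [xi bx <-] <-]] <-]; rewrite assoc_ket//.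
  exists (ket1 beta (ltri eps phi gamma) xi); first by exists xi.
  by exists (ket2 eps phi chi) => //; exists chi.
move=> _ [_ [xi bx <-] [_ [chi px <-] <-]].
exists (ket2 (rtri beta gamma eps) phi chi \ob ket1 beta gamma xi); last by rewrite assoc_ket.
exists (ket2 (rtri beta gamma eps) phi chi); first by exists chi.
by exists (ket1 beta gamma xi) => //; exists xi.
Qed.

Lemma assoc_ket11 xi e : beta xi -> eps e -> assoc beta gamma eps phi \ob
    ket1 (rtri beta gamma eps) phi (ket1 beta gamma xi \ob e) =
  ket1 beta (ltri eps phi gamma) xi \ob ket1 eps phi e.
Proof.
move=> bx ex; apply: (vecprod_ext (mod_total mp)) => chi px.
have bex : rtri beta gamma eps (ket1 beta gamma xi \ob e) by apply: sub_opprod => //; exists xi.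
by rewrite -!compopA (ket12 c3)// (ket12 c2)// (compopA (ket2 _ _ chi)) compopA assoc_ket// compopA.
Qed.

Lemma morphism_assoc_r (a : set (bop F L)) :
  morphism (rtri (rtri beta gamma eps) phi a)
    (rtri beta (ltri eps phi gamma) (rtri eps phi a)) (assoc beta gamma eps phi).
Proof.
have e : rtri (rtri beta gamma eps) phi a = clspan (opprod (ket1 (rtri beta gamma eps) phi @`
    (opprod (ket1 beta gamma @` beta) eps)) a).
  by apply: (ket1_clspan mr mp); exact: sub_clspan.
apply/unitary_morphismP => //; rewrite rtri_rtri e.
apply: clspan_image => //; rewrite opimage_opprod; congr opprod.
apply/seteqP; split.
  move=> _ [_ [_ [_ [xi bx <-] [z ex <-]] <-] <-]; rewrite assoc_ket11//.
  exists (ket1 beta (ltri eps phi gamma) xi); first by exists xi.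
  by exists (ket1 eps phi z) => //; exists z.
move=> _ [_ [xi bx <-] [_ [z ex <-] <-]].
exists (ket1 (rtri beta gamma eps) phi (ket1 beta gamma xi \ob z)); last by rewrite assoc_ket11.
exists (ket1 beta gamma xi \ob z) => //.
by exists (ket1 beta gamma xi); [exists xi|exists z].
Qed.

End AssocRules.

Section Flip23Rules.
Variables (k l : bool) (F H K L : hilbertType R).
Variables (b1 b2 : set (bop E H)) (g1 : set (bop E K)) (g2 : set (bop E L)).
Hypotheses (mb1 : modk k b1) (mg1 : modk (~~ k) g1).
Hypotheses (mb2 : modk l b2) (mg2 : modk (~~ l) g2).
Hypotheses (s12 : stab k b1 b2) (s21 : stab l b2 b1).

Let c1 : compat b1 g1 := compat_mod mb1 mg1.
Let c2 : compat b2 g2 := compat_mod mb2 mg2.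
Let m2 : modk l (ltri b1 g1 b2) := mod_ltri mb1 mg1 mb2 s12.
Let m1 : modk k (ltri b2 g2 b1) := mod_ltri mb2 mg2 mb1 s21.
Let c3 : compat (ltri b1 g1 b2) g2 := compat_mod m2 mg2.
Let c4 : compat (ltri b2 g2 b1) g1 := compat_mod m1 mg1.
Let st : stable g1 b1 b2.
Proof. exact: stable_mod mg1 mb1 s12. Qed.

Let uF : unitary_op (flip23 b1 g1 b2 g2).
Proof. exact: flip23_unitary. Qed.

Lemma morphism_flip23_r (h : set (bop F K)) :
  morphism (ltri (ltri b1 g1 b2) g2 (rtri b1 g1 h)) (rtri (ltri b2 g2 b1) g1 h)
    (flip23 b1 g1 b2 g2).
Proof.
apply/unitary_morphismP => //; rewrite ltri_rtri [RHS](ket1_clspan m1 mg1); last first.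
  exact: sub_clspan.
apply: clspan_image => //; rewrite opimage_opprod; congr opprod.
have hk chi xi : g2 chi -> b1 xi -> flip23 b1 g1 b2 g2 \ob
    (ket2 (ltri b1 g1 b2) g2 chi \ob ket1 b1 g1 xi) =
    ket1 (ltri b2 g2 b1) g1 (ket2 b2 g2 chi \ob xi).
  move=> px gx; rewrite compopA flip23_ket2// tens_op_ket1 ?compop1//.
    exact: semi_ket2.
  exact: semi_id.
apply/seteqP; split.
  move=> _ [_ [_ [chi px <-] [_ [xi gx <-] <-]] <-]; rewrite hk//.
  exists (ket2 b2 g2 chi \ob xi) => //.
  by exists (ket2 b2 g2 chi); [exists chi|exists xi].
move=> _ [_ [_ [chi px <-] [xi gx <-]] <-].
exists (ket2 (ltri b1 g1 b2) g2 chi \ob ket1 b1 g1 xi); last by rewrite hk.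
exists (ket2 (ltri b1 g1 b2) g2 chi); first by exists chi.
by exists (ket1 b1 g1 xi) => //; exists xi.
Qed.

Lemma flip23_ket21 eta xi : g1 eta -> b2 xi -> flip23 b1 g1 b2 g2 \ob
    ket1 (ltri b1 g1 b2) g2 (ket2 b1 g1 eta \ob xi) =
  ket2 (ltri b2 g2 b1) g1 eta \ob ket1 b2 g2 xi.
Proof.
move=> gx bx; apply: (vecprod_ext (mod_total mg2)) => chi px.
have bex : ltri b1 g1 b2 (ket2 b1 g1 eta \ob xi) by apply: sub_opprod => //; exists eta.
by rewrite -!compopA (ket12 c3)// (ket12 c2)// (compopA (ket2 _ _ chi)) compopA flip23_ket// compopA.
Qed.

Lemma morphism_flip23_rl (a : set (bop F L)) :
  morphism (rtri (ltri b1 g1 b2) g2 a) (ltri (ltri b2 g2 b1) g1 (rtri b2 g2 a))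
    (flip23 b1 g1 b2 g2).
Proof.
have e : rtri (ltri b1 g1 b2) g2 a = clspan (opprod (ket1 (ltri b1 g1 b2) g2 @`
    (opprod (ket2 b1 g1 @` g1) b2)) a).
  by apply: (ket1_clspan m2 mg2); exact: sub_clspan.
apply/unitary_morphismP => //; rewrite ltri_rtri e.
apply: clspan_image => //; rewrite opimage_opprod; congr opprod.
apply/seteqP; split.
  move=> _ [_ [_ [_ [eta gx <-] [xi bx <-]] <-] <-]; rewrite flip23_ket21//.
  exists (ket2 (ltri b2 g2 b1) g1 eta); first by exists eta.
  by exists (ket1 b2 g2 xi) => //; exists xi.
move=> _ [_ [eta gx <-] [_ [xi bx <-] <-]].
exists (ket1 (ltri b1 g1 b2) g2 (ket2 b1 g1 eta \ob xi)); last by rewrite flip23_ket21.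
exists (ket2 b1 g1 eta \ob xi) => //.
by exists (ket2 b1 g1 eta); [exists eta|exists xi].
Qed.

End Flip23Rules.
End StructureRules.

(** Discharges compatibility, module and stability conditions by recursion on the shape of the
    structures. The kinds of the factors cannot be read off the goal, so both are tried. *)
Ltac mk := cbn [negb]; first [ eassumption | lazymatch goal with
  | |- compat _ _ => first
      [ apply: (@compat_mod _ _ true); [mk|mk] | apply: (@compat_mod _ _ false); [mk|mk] ]
  | |- stable _ _ _ => first
      [ apply: (@stable_mod _ _ true); [mk|mk|mk] | apply: (@stable_mod _ _ false); [mk|mk|mk] ]
  | |- modk _ (ltri _ _ _) => first
      [ apply: (@mod_ltri _ _ true); [mk|mk|mk|mk] | apply: (@mod_ltri _ _ false); [mk|mk|mk|mk] ]
  | |- modk _ (rtri _ _ _) => first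
      [ apply: (@mod_rtri _ _ true); [mk|mk|mk|mk] | apply: (@mod_rtri _ _ false); [mk|mk|mk|mk] ]
  | |- stab _ (ltri _ _ _) (ltri _ _ _) => first
      [ apply: (@stab_ll _ _ true); [mk|mk|mk|mk|mk] | apply: (@stab_ll _ _ false); [mk|mk|mk|mk|mk] ]
  | |- stab _ (ltri _ _ _) (rtri _ _ _) => first
      [ apply: (@stab_lr _ _ true); [mk|mk|mk|mk|mk] | apply: (@stab_lr _ _ false); [mk|mk|mk|mk|mk] ]
  | |- stab _ (rtri _ _ _) (rtri _ _ _) => first
      [ apply: (@stab_rr _ _ true); [mk|mk|mk|mk|mk] | apply: (@stab_rr _ _ false); [mk|mk|mk|mk|mk] ]
  | |- stab _ (rtri _ _ _) (ltri _ _ _) => first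
      [ apply: (@stab_rl _ _ true); [mk|mk|mk|mk|mk] | apply: (@stab_rl _ _ false); [mk|mk|mk|mk|mk] ]
  end ].

Ltac sm := first
  [ eassumption | exact: semi_id | apply: semi_ket1; eassumption | apply: semi_ket2; eassumption
  | match goal with h : morphism _ _ ?T |- semimorphism _ _ ?T => exact: (proj1 h) end
  | match goal with h : morphism _ _ ?T |- semimorphism _ _ (adj ?T) => exact: (proj2 h) end
  | apply: semi_tens_op_ltri; [mk|mk|mk|sm|sm|sm]
  | apply: semi_tens_op_rtri; [mk|mk|mk|sm|sm|sm]
  | match goal with h : _ |- semimorphism _ _ (_ \ob ?T) =>
      match type of h with semimorphism _ ?c T => apply: (semi_comp h); sm end end ].

Ltac mor := first
  [ eassumption | exact: morphism_id
  | apply: morphism_tens_op_ltri; [mk|mk|mk|mk|mor|mor|mor]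
  | apply: morphism_tens_op_rtri; [mk|mk|mk|mk|mor|mor|mor] ].

(* A sealed copy of [leg13], since unification otherwise unfolds it. *)
Definition xleg13 (R : realType) (E K L H : hilbertType R) (hdelta gamma : set (bop E K))
    (eps : set (bop E L)) (alpha beta : set (bop E H))
    (X : bop (rtp hdelta alpha) (rtp gamma beta)) :
    bop (rtp hdelta (rtri eps beta alpha)) (rtp (ltri hdelta eps gamma) beta) :=
  locked (leg13 eps X).

Lemma xleg13K (R : realType) (E K L H : hilbertType R) (hdelta gamma : set (bop E K))
    (eps : set (bop E L)) (alpha beta : set (bop E H))
    (X : bop (rtp hdelta alpha) (rtp gamma beta)) : leg13 eps X = xleg13 eps X.
Proof. by rewrite /xleg13 -lock. Qed.

(** * Action on the first and third factor *)

Section Leg13.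
Variables (R : realType) (b : cstar_base R).
Notation E := (bK b).
Variables (K H : hilbertType R) (gamma delta : set (bop E K)) (alpha beta : set (bop E H)).
Hypotheses (mg : modk true gamma) (md : modk false delta).
Hypotheses (sgd : stab true gamma delta) (sdg : stab false delta gamma).
Hypotheses (ma : modk true alpha) (mb : modk false beta).
Hypotheses (sab : stab true alpha beta) (sba : stab false beta alpha).
Variable X : bop (rtp delta alpha) (rtp gamma beta).
Hypotheses (uX : unitary_op X) (mX : morphism (rtri delta alpha beta) (ltri gamma beta delta) X).

Section One.
Variables (L : hilbertType R) (eps : set (bop E L)).
Hypothesis me : modk true eps.

Lemma leg13E : xleg13 eps X = flip23 gamma beta delta eps
  \ob tens_op (rtri delta alpha beta) eps (ltri gamma beta delta) eps X (idop L)
  \ob adj (assoc delta alpha beta eps)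
  \ob tens_op delta (rtri eps beta alpha) delta (ltri beta eps alpha) (idop K) (flip eps beta).
Proof.
rewrite -xleg13K /leg13 tens_lE ?tens_rE //; try mk; try exact: (proj1 mX).
by apply: (proj1 (morphism_flip_r _ _)); mk.
Qed.

(** Freezing the middle factor at eta turns the operator on the first and third factors into X
    itself. Together with [leg13_ext] this determines it, and replaces its definition in the
    equations that follow. *)
Lemma leg13_ket eta : eps eta ->
  xleg13 eps X \ob tens_op delta alpha delta (rtri eps beta alpha) (idop K) (ket1 eps beta eta) =
  tens_op gamma beta (ltri delta eps gamma) beta (ket2 delta eps eta) (idop H) \ob X.
Proof.
move=> ex; have [sX sX'] := mX.
have mf : morphism (rtri eps beta alpha) (ltri beta eps alpha) (flip eps beta).
  by apply: morphism_flip_r; mk.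
rewrite leg13E -!compopA tens_op_comp; try mk; try sm.
rewrite comp1op flip_ket1//; try mk.
rewrite assocV_ket2//; try mk.
rewrite tens_op_ket2//; try mk; try sm.
rewrite comp1op compopA flip23_ket2//; mk.
Qed.

Lemma leg13_ext G (A B : bop (rtp delta (rtri eps beta alpha)) G) :
  (forall eta, eps eta ->
    A \ob tens_op delta alpha delta (rtri eps beta alpha) (idop K) (ket1 eps beta eta) =
    B \ob tens_op delta alpha delta (rtri eps beta alpha) (idop K) (ket1 eps beta eta)) ->
  A = B.
Proof.
move=> AB; apply: rtp_ext1; first by mk.
move=> xi dx; apply: rtp_ext1; first by mk.
move=> eta ex.
have h : ket1 delta (rtri eps beta alpha) xi \ob ket1 eps beta eta =
    tens_op delta alpha delta (rtri eps beta alpha) (idop K) (ket1 eps beta eta) \ob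
    ket1 delta alpha xi.
  by rewrite tens_op_ket1 ?comp1op//; try mk; try sm.
by rewrite -!compopA h !compopA AB.
Qed.

Lemma leg13_unitary : unitary_op (xleg13 eps X).
Proof.
have mf : morphism (rtri eps beta alpha) (ltri beta eps alpha) (flip eps beta).
  by apply: morphism_flip_r; mk.
rewrite leg13E; apply: unitary_comp; first apply: unitary_comp; first apply: unitary_comp.
- by apply: flip23_unitary; mk.
- by apply: unitary_tens_op; try mk; try mor; split; rewrite ?adj1 ?comp1op.
- by apply: unitary_adj; apply: assoc_unitary; mk.
- apply: unitary_tens_op; try mk; try mor; first by split; rewrite ?adj1 ?comp1op.
  by apply: flip_unitary; mk.
Qed.

Lemma morphism_leg13_l : morphism (ltri delta alpha gamma) (rtri gamma beta alpha) X ->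
  morphism (ltri delta (rtri eps beta alpha) gamma) (rtri (ltri delta eps gamma) beta alpha)
    (xleg13 eps X).
Proof.
move=> mX'.
have mf : morphism (rtri eps beta alpha) (ltri beta eps alpha) (flip eps beta).
  by apply: morphism_flip_r; mk.
rewrite leg13E.
apply: (morphism_comp (beta := ltri delta (ltri beta eps alpha) gamma)); first by mor.
apply: (morphism_comp (beta := ltri (rtri delta alpha beta) eps (ltri delta alpha gamma))).
  by apply/morphism_adj/(@morphism_assoc_l _ _ false false); mk.
apply: (morphism_comp (beta := ltri (ltri gamma beta delta) eps (rtri gamma beta alpha))); first by mor.
by apply: (@morphism_flip23_r _ _ true false); mk.
Qed.

Lemma morphism_leg13_m (phi : set (bop E L)) :
  morphism (rtri delta (rtri eps beta alpha) (ltri eps beta phi))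
    (ltri (ltri delta eps gamma) beta (rtri delta eps phi)) (xleg13 eps X).
Proof.
have mf : morphism (rtri eps beta alpha) (ltri beta eps alpha) (flip eps beta).
  by apply: morphism_flip_r; mk.
have mf' : morphism (ltri eps beta phi) (rtri beta eps phi) (flip eps beta).
  by apply: morphism_flip_l; mk.
rewrite leg13E.
apply: (morphism_comp (beta := rtri delta (ltri beta eps alpha) (rtri beta eps phi))); first by mor.
apply: (morphism_comp (beta := rtri (rtri delta alpha beta) eps phi)).
  by apply/morphism_adj/(@morphism_assoc_r _ _ false false); mk.
apply: (morphism_comp (beta := rtri (ltri gamma beta delta) eps phi)); first by mor.
by apply: (@morphism_flip23_rl _ _ true false); mk.
Qed.

Lemma morphism_leg13_r (hbeta : set (bop E H)) :
  morphism (rtri delta alpha hbeta) (rtri gamma beta hbeta) X ->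
  morphism (rtri delta (rtri eps beta alpha) (rtri eps beta hbeta))
    (rtri (ltri delta eps gamma) beta hbeta) (xleg13 eps X).
Proof.
move=> mX'.
have mf : morphism (rtri eps beta alpha) (ltri beta eps alpha) (flip eps beta).
  by apply: morphism_flip_r; mk.
have mf' : morphism (rtri eps beta hbeta) (ltri beta eps hbeta) (flip eps beta).
  by apply: morphism_flip_r; mk.
rewrite leg13E.
apply: (morphism_comp (beta := rtri delta (ltri beta eps alpha) (ltri beta eps hbeta))); first by mor.
apply: (morphism_comp (beta := ltri (rtri delta alpha beta) eps (rtri delta alpha hbeta))).
  by apply/morphism_adj/(@morphism_assoc_m _ _ false false); mk.
apply: (morphism_comp (beta := ltri (ltri gamma beta delta) eps (rtri gamma beta hbeta))); first by mor.
by apply: (@morphism_flip23_r _ _ true false); mk.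
Qed.

End One.

Lemma leg13_natural L L' (eps : set (bop E L)) (eps' : set (bop E L')) (T : bop L L') :
  modk true eps -> modk true eps' -> semimorphism eps eps' T ->
  xleg13 eps' X \ob tens_op delta (rtri eps beta alpha) delta (rtri eps' beta alpha) (idop K)
      (tens_op eps beta eps' beta T (idop H)) =
  tens_op (ltri delta eps gamma) beta (ltri delta eps' gamma) beta
    (tens_op delta eps delta eps' (idop K) T) (idop H) \ob xleg13 eps X.
Proof.
move=> me me' sT; apply: (leg13_ext me) => eta ex.
have ex' : eps' (T \ob eta) by semi.
rewrite -compopA tens_op_comp; try mk; try sm.
rewrite tens_op_ket1//; try mk; try sm.
rewrite comp1op compop1 leg13_ket// -compopA leg13_ket//.
rewrite compopA tens_op_comp; try mk; try sm.
rewrite tens_op_ket2//; try mk; try sm.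
by rewrite comp1op compop1.
Qed.

End Leg13.

(* Equations between composites, for rewriting inside right-associated composites. *)
Section Recompose.
Variable R : realType.

Lemma comp21 (F G H : hilbertType R) (A : bop G H) (B : bop F G) (C : bop F H) :
  A \ob B = C -> forall (J : hilbertType R) (W : bop J F), A \ob (B \ob W) = C \ob W.
Proof. by move=> e J W; rewrite compopA e. Qed.

Lemma comp22 (F G G' H : hilbertType R) (A : bop G H) (B : bop F G) (C : bop G' H) (D : bop F G') :
  A \ob B = C \ob D -> forall (J : hilbertType R) (W : bop J F),
  A \ob (B \ob W) = C \ob (D \ob W).
Proof. by move=> e J W; rewrite !compopA e. Qed.

Lemma comp31 (F G H K : hilbertType R) (A : bop H K) (B : bop G H) (C : bop F G) (D : bop F K) :
  A \ob (B \ob C) = D -> forall (J : hilbertType R) (W : bop J F),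
  A \ob (B \ob (C \ob W)) = D \ob W.
Proof. by move=> <- J W; rewrite !compopA. Qed.

Lemma comp41 (F G H K L : hilbertType R) (A : bop K L) (B : bop H K) (C : bop G H) (D : bop F G)
  (T : bop F L) :
  A \ob (B \ob (C \ob D)) = T -> forall (J : hilbertType R) (W : bop J F),
  A \ob (B \ob (C \ob (D \ob W))) = T \ob W.
Proof. by move=> <- J W; rewrite !compopA. Qed.
End Recompose.

(** * The tensor product of representations *)

Section RepFacts.
Variables (R : realType) (b : cstar_base R).
Notation E := (bK b).
Variables (H : hilbertType R) (hbeta alpha beta : set (bop E H)).
Variable V : bop (rtp hbeta alpha) (rtp alpha beta).

(** The conditions on the module and on V recast for proof search: equalities of structures become
    morphism properties of the unitary V, and every structure is given with its kind. *)
Record base_facts : Prop := BaseFacts {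
  bf_a : modk true alpha ; bf_b : modk false beta ; bf_h : modk false hbeta ;
  bf_ab : stab true alpha beta ; bf_ba : stab false beta alpha ;
  bf_ah : stab true alpha hbeta ; bf_ha : stab false hbeta alpha ;
  bf_bh : stab false beta hbeta ; bf_hb : stab false hbeta beta ;
  bf_V : unitary_op V ;
  bf_V1 : morphism (ltri hbeta alpha alpha) (rtri alpha beta alpha) V ;
  bf_V2 : morphism (rtri hbeta alpha beta) (ltri alpha beta hbeta) V ;
  bf_V3 : morphism (rtri hbeta alpha hbeta) (rtri alpha beta hbeta) V ;
  bf_V4 : morphism (ltri hbeta alpha beta) (ltri alpha beta beta) V
}.

Record rep_facts (K : hilbertType R) (gamma delta : set (bop E K))
    (X : bop (rtp delta alpha) (rtp gamma beta)) : Prop := RepFacts {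
  rf_g : modk true gamma ; rf_d : modk false delta ;
  rf_gd : stab true gamma delta ; rf_dg : stab false delta gamma ;
  rf_X : unitary_op X ;
  rf_X1 : morphism (ltri delta alpha gamma) (rtri gamma beta alpha) X ;
  rf_X2 : morphism (rtri delta alpha beta) (ltri gamma beta delta) X ;
  rf_X3 : morphism (rtri delta alpha hbeta) (rtri gamma beta hbeta) X ;
  rf_pentagon :
    tens_op gamma (ltri hbeta alpha beta) gamma (ltri alpha beta beta) (idop K) V
    \ob assoc gamma beta hbeta alpha
    \ob tens_op (rtri delta alpha hbeta) alpha (rtri gamma beta hbeta) alpha X (idop H)
    = assoc gamma beta alpha beta
      \ob tens_op (ltri delta alpha gamma) beta (rtri gamma beta alpha) beta X (idop H)
      \ob xleg13 alpha X
      \ob tens_op delta (ltri hbeta alpha alpha) delta (rtri alpha beta alpha) (idop K) V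
      \ob assoc delta alpha hbeta alpha
}.

Lemma pentagon_eqE K (gamma delta : set (bop E K)) (X : bop (rtp delta alpha) (rtp gamma beta)) :
  base_facts -> modk true gamma -> modk false delta -> stab true gamma delta ->
  stab false delta gamma ->
  morphism (ltri delta alpha gamma) (rtri gamma beta alpha) X ->
  morphism (rtri delta alpha hbeta) (rtri gamma beta hbeta) X ->
  pentagon_eq X V =
  (tens_op gamma (ltri hbeta alpha beta) gamma (ltri alpha beta beta) (idop K) V
    \ob assoc gamma beta hbeta alpha
    \ob tens_op (rtri delta alpha hbeta) alpha (rtri gamma beta hbeta) alpha X (idop H)
    = assoc gamma beta alpha beta
      \ob tens_op (ltri delta alpha gamma) beta (rtri gamma beta alpha) beta X (idop H)
      \ob xleg13 alpha X
      \ob tens_op delta (ltri hbeta alpha alpha) delta (rtri alpha beta alpha) (idop K) V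
      \ob assoc delta alpha hbeta alpha).
Proof.
move=> [? ? ? ? ? ? ? ? ? ? [? _] [? _] [? _] [? _]] ? ? ? ? [? _] [? _].
by rewrite /pentagon_eq xleg13K !tens_rE ?tens_lE//; mk.
Qed.

Hypothesis bf : base_facts.

Section Box.
Variables (K L : hilbertType R) (gamma delta : set (bop E K)) (eps phi : set (bop E L)).
Variables (X : bop (rtp delta alpha) (rtp gamma beta)) (Y : bop (rtp phi alpha) (rtp eps beta)).
Hypotheses (rX : rep_facts X) (rY : rep_facts Y).

(** The operator of [box] for representations given as loose data, sealed so that unification does
    not unfold it. *)
Definition boxop : bop (rtp (rtri delta eps phi) alpha) (rtp (ltri delta eps gamma) beta) :=
  locked (leg13 eps X
     \ob tens_r delta (ltri phi alpha eps) (rtri eps beta alpha) Y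
     \ob assoc delta eps phi alpha).

Let ma : modk true alpha. Proof. exact: bf_a. Qed.
Let mb : modk false beta. Proof. exact: bf_b. Qed.
Let mh : modk false hbeta. Proof. exact: bf_h. Qed.
Let sab : stab true alpha beta. Proof. exact: bf_ab. Qed.
Let sba : stab false beta alpha. Proof. exact: bf_ba. Qed.
Let sah : stab true alpha hbeta. Proof. exact: bf_ah. Qed.
Let sha : stab false hbeta alpha. Proof. exact: bf_ha. Qed.
Let sbh : stab false beta hbeta. Proof. exact: bf_bh. Qed.
Let shb : stab false hbeta beta. Proof. exact: bf_hb. Qed.
Let uV : unitary_op V. Proof. exact: bf_V. Qed.
Let mV1 : morphism (ltri hbeta alpha alpha) (rtri alpha beta alpha) V. Proof. exact: bf_V1. Qed.
Let mV2 : morphism (rtri hbeta alpha beta) (ltri alpha beta hbeta) V. Proof. exact: bf_V2. Qed.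
Let mV3 : morphism (rtri hbeta alpha hbeta) (rtri alpha beta hbeta) V. Proof. exact: bf_V3. Qed.
Let mV4 : morphism (ltri hbeta alpha beta) (ltri alpha beta beta) V. Proof. exact: bf_V4. Qed.
Let mg : modk true gamma. Proof. exact: rf_g rX. Qed.
Let md : modk false delta. Proof. exact: rf_d rX. Qed.
Let sgd : stab true gamma delta. Proof. exact: rf_gd rX. Qed.
Let sdg : stab false delta gamma. Proof. exact: rf_dg rX. Qed.
Let uX : unitary_op X. Proof. exact: rf_X rX. Qed.
Let mX1 : morphism (ltri delta alpha gamma) (rtri gamma beta alpha) X. Proof. exact: rf_X1 rX. Qed.
Let mX2 : morphism (rtri delta alpha beta) (ltri gamma beta delta) X. Proof. exact: rf_X2 rX. Qed.
Let mX3 : morphism (rtri delta alpha hbeta) (rtri gamma beta hbeta) X. Proof. exact: rf_X3 rX. Qed.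
Let me : modk true eps. Proof. exact: rf_g rY. Qed.
Let mp : modk false phi. Proof. exact: rf_d rY. Qed.
Let sep : stab true eps phi. Proof. exact: rf_gd rY. Qed.
Let spe : stab false phi eps. Proof. exact: rf_dg rY. Qed.
Let uY : unitary_op Y. Proof. exact: rf_X rY. Qed.
Let mY1 : morphism (ltri phi alpha eps) (rtri eps beta alpha) Y. Proof. exact: rf_X1 rY. Qed.
Let mY2 : morphism (rtri phi alpha beta) (ltri eps beta phi) Y. Proof. exact: rf_X2 rY. Qed.
Let mY3 : morphism (rtri phi alpha hbeta) (rtri eps beta hbeta) Y. Proof. exact: rf_X3 rY. Qed.

Local Notation gamma' := (ltri delta eps gamma).
Local Notation delta' := (rtri delta eps phi).
Local Notation Z := boxop.

Let mg' : modk true gamma'. Proof. by mk. Qed.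
Let md' : modk false delta'. Proof. by mk. Qed.
Let sgd' : stab true gamma' delta'. Proof. by mk. Qed.
Let sdg' : stab false delta' gamma'. Proof. by mk. Qed.

Lemma boxopE : Z = xleg13 eps X
  \ob tens_op delta (ltri phi alpha eps) delta (rtri eps beta alpha) (idop K) Y
  \ob assoc delta eps phi alpha.
Proof. by rewrite /boxop -lock tens_rE ?xleg13K//; try mk; sm. Qed.

Let uL : unitary_op (xleg13 eps X).
Proof. by apply: leg13_unitary. Qed.

Let mL1 : morphism (ltri delta (rtri eps beta alpha) gamma) (rtri gamma' beta alpha) (xleg13 eps X).
Proof. by apply: morphism_leg13_l. Qed.

Let mL2 : morphism (rtri delta (rtri eps beta alpha) (ltri eps beta phi))
  (ltri gamma' beta delta') (xleg13 eps X).
Proof. by apply: morphism_leg13_m. Qed.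

Let mL3 : morphism (rtri delta (rtri eps beta alpha) (rtri eps beta hbeta))
  (rtri gamma' beta hbeta) (xleg13 eps X).
Proof. by apply: morphism_leg13_r. Qed.

Lemma boxop_unitary : unitary_op Z.
Proof.
rewrite boxopE; apply: unitary_comp; first apply: unitary_comp => //.
  by apply: unitary_tens_op; try mk; try mor; split; rewrite ?adj1 ?comp1op.
by apply: assoc_unitary; mk.
Qed.

Lemma boxop_gamma_alpha : morphism (ltri delta' alpha gamma') (rtri gamma' beta alpha) Z.
Proof.
rewrite boxopE; apply: (morphism_comp (beta := ltri delta (ltri phi alpha eps) gamma)).
  by apply: (@morphism_assoc_l _ _ false false); mk.
by apply: morphism_comp mL1; mor.
Qed.

Lemma boxop_delta_beta : morphism (rtri delta' alpha beta) (ltri gamma' beta delta') Z.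
Proof.
rewrite boxopE; apply: (morphism_comp (beta := rtri delta (ltri phi alpha eps) (rtri phi alpha beta))).
  by apply: (@morphism_assoc_r _ _ false false); mk.
by apply: morphism_comp mL2; mor.
Qed.

Lemma boxop_delta_hbeta : morphism (rtri delta' alpha hbeta) (rtri gamma' beta hbeta) Z.
Proof.
rewrite boxopE; apply: (morphism_comp (beta := rtri delta (ltri phi alpha eps) (rtri phi alpha hbeta))).
  by apply: (@morphism_assoc_r _ _ false false); mk.
by apply: morphism_comp mL3; mor.
Qed.

Let mZ1 := boxop_gamma_alpha.
Let mZ2 := boxop_delta_beta.
Let mZ3 := boxop_delta_hbeta.
Let uZ := boxop_unitary.

Local Notation P xi := (xleg13 eps X \ob ket1 delta (rtri eps beta alpha) xi).

(** With the first factor frozen at xi, the product operator is Y followed by an operator built from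
    X alone; this is what isolates Y in the pentagon. *)
Lemma boxop_ket xi : delta xi ->
  Z \ob tens_op phi alpha delta' alpha (ket1 delta eps xi) (idop H) = P xi \ob Y.
Proof.
move=> dx; rewrite boxopE -!compopA assoc_ket1//; try mk.
by rewrite tens_op_ket1 ?comp1op ?compopA//; try mk; sm.
Qed.

Lemma boxop_assocV : Z \ob adj (assoc delta eps phi alpha) =
  xleg13 eps X \ob tens_op delta (ltri phi alpha eps) delta (rtri eps beta alpha) (idop K) Y.
Proof.
by rewrite boxopE -!compopA (assoc_unitary _ _ _ _ _).2 ?compop1//; mk.
Qed.

(* The pentagon for X [box] Y is tested on the slices |xi>_1: there it reduces to
   the pentagon for Y and, after slicing once more over eps, to that for X. *)
Lemma boxop_ext G (A B : bop (rtp (rtri delta' alpha hbeta) alpha) G) :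
  (forall xi, delta xi ->
    A \ob tens_op (rtri phi alpha hbeta) alpha (rtri delta' alpha hbeta) alpha
      (tens_op phi alpha delta' alpha (ket1 delta eps xi) (idop H)) (idop H) =
    B \ob tens_op (rtri phi alpha hbeta) alpha (rtri delta' alpha hbeta) alpha
      (tens_op phi alpha delta' alpha (ket1 delta eps xi) (idop H)) (idop H)) -> A = B.
Proof.
move=> AB; apply: rtp_ext2; first by mk.
move=> chi ax; apply: rtp_ext2; first by mk.
move=> kap kx; apply: rtp_ext1; first by mk.
move=> xi dx.
have h : ket2 (rtri delta' alpha hbeta) alpha chi \ob
    (ket2 delta' alpha kap \ob ket1 delta eps xi) =
    tens_op (rtri phi alpha hbeta) alpha (rtri delta' alpha hbeta) alpha
      (tens_op phi alpha delta' alpha (ket1 delta eps xi) (idop H)) (idop H) \ob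
    (ket2 (rtri phi alpha hbeta) alpha chi \ob ket2 phi alpha kap).
  rewrite [RHS]compopA tens_op_ket2//; try mk; try sm.
  rewrite comp1op -[RHS]compopA; congr (_ \ob _).
  by rewrite tens_op_ket2 ?comp1op//; try mk; sm.
by rewrite -!compopA h !compopA AB.
Qed.

Let J xi := tens_op (rtri phi alpha hbeta) alpha (rtri delta' alpha hbeta) alpha
      (tens_op phi alpha delta' alpha (ket1 delta eps xi) (idop H)) (idop H).

Let sP xi : delta xi -> semimorphism (rtri eps beta hbeta) (rtri gamma' beta hbeta) (P xi).
Proof. by move=> dx; apply: semi_comp (proj1 mL3); sm. Qed.

Lemma boxop_l_slice xi : delta xi ->
  tens_op (rtri delta' alpha hbeta) alpha (rtri gamma' beta hbeta) alpha Z (idop H) \ob J xi =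
  tens_op (rtri eps beta hbeta) alpha (rtri gamma' beta hbeta) alpha (P xi) (idop H) \ob
  tens_op (rtri phi alpha hbeta) alpha (rtri eps beta hbeta) alpha Y (idop H).
Proof.
move=> dx; have s1 := sP dx.
rewrite /J tens_op_comp; try mk; try sm.
by rewrite boxop_ket// tens_op_comp//; try mk; sm.
Qed.

Lemma assoc_slice xi : delta xi ->
  assoc delta' alpha hbeta alpha \ob J xi =
  tens_op phi (ltri hbeta alpha alpha) delta' (ltri hbeta alpha alpha)
    (ket1 delta eps xi) (idop _) \ob assoc phi alpha hbeta alpha.
Proof.
move=> dx; rewrite /J assoc_natural; try mk; try sm.
by rewrite tens_op_id//; mk.
Qed.

Lemma V_slice xi : delta xi ->
  tens_op delta' (ltri hbeta alpha alpha) delta' (rtri alpha beta alpha) (idop _) V \ob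
    tens_op phi (ltri hbeta alpha alpha) delta' (ltri hbeta alpha alpha)
      (ket1 delta eps xi) (idop _) =
  tens_op phi (rtri alpha beta alpha) delta' (rtri alpha beta alpha)
      (ket1 delta eps xi) (idop _) \ob
    tens_op phi (ltri hbeta alpha alpha) phi (rtri alpha beta alpha) (idop _) V.
Proof.
move=> dx; rewrite !tens_op_comp; try mk; try sm.
by rewrite !comp1op !compop1.
Qed.

Let mA : morphism (ltri delta (ltri phi alpha eps) gamma) (ltri delta' alpha gamma')
  (adj (assoc delta eps phi alpha)).
Proof. by apply/morphism_adj/(@morphism_assoc_l _ _ false false); mk. Qed.

(** Skipping a middle factor [H], the product representation acts by Y skipping that factor, then by
    X skipping both L and that factor; the adjoint of associativity restores the bracketing. *)
Lemma leg13_boxop_slice xi : delta xi ->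
  xleg13 alpha Z \ob tens_op phi (rtri alpha beta alpha) delta' (rtri alpha beta alpha)
      (ket1 delta eps xi) (idop _) =
  tens_op (ltri delta (ltri phi alpha eps) gamma) beta (ltri delta' alpha gamma') beta
      (adj (assoc delta eps phi alpha)) (idop _) \ob
    (xleg13 (ltri phi alpha eps) X \ob (ket1 delta (rtri (ltri phi alpha eps) beta alpha) xi \ob
    xleg13 alpha Y)).
Proof.
move=> dx; have mW : modk true (ltri phi alpha eps) by mk.
apply: (leg13_ext mp ma mb sba ma) => kap ax; rewrite -!compopA.
rewrite leg13_ket// tens_op_comp; try mk; try sm.
rewrite comp1op compop1.
have -> : tens_op phi alpha delta' (rtri alpha beta alpha) (ket1 delta eps xi) (ket1 alpha beta kap) =
    tens_op delta' alpha delta' (rtri alpha beta alpha) (idop _) (ket1 alpha beta kap) \ob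
    tens_op phi alpha delta' alpha (ket1 delta eps xi) (idop _).
  by rewrite tens_op_comp ?comp1op ?compop1//; try mk; sm.
rewrite compopA leg13_ket// -compopA boxop_ket//.
have e1 : ket1 delta (rtri (ltri phi alpha eps) beta alpha) xi \ob
    tens_op eps beta (ltri phi alpha eps) beta (ket2 phi alpha kap) (idop H) =
    tens_op delta (rtri eps beta alpha) delta (rtri (ltri phi alpha eps) beta alpha) (idop _)
      (tens_op eps beta (ltri phi alpha eps) beta (ket2 phi alpha kap) (idop H)) \ob
    ket1 delta (rtri eps beta alpha) xi.
  by rewrite tens_op_ket1 ?comp1op//; try mk; sm.
rewrite (comp22 e1) (comp22 (leg13_natural mg md sgd sdg ma mb sab sba mX2 me mW _)); last by sm.
have e2 : tens_op (ltri delta (ltri phi alpha eps) gamma) beta (ltri delta' alpha gamma') beta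
      (adj (assoc delta eps phi alpha)) (idop _) \ob
   tens_op gamma' beta (ltri delta (ltri phi alpha eps) gamma) beta
     (tens_op delta eps delta (ltri phi alpha eps) (idop K) (ket2 phi alpha kap)) (idop H) =
   tens_op gamma' beta (ltri delta' alpha gamma') beta (ket2 delta' alpha kap) (idop _).
  rewrite tens_op_comp; try mk; try sm.
  by rewrite assocV_ket2 ?comp1op//; mk.
by rewrite (comp21 e2) -!compopA.
Qed.

(** [leg13_natural] carries Y past the leg operator of X, which brings it next to the other factors
    of its own pentagon. *)
Lemma boxop_l_leg13_slice xi : delta xi ->
  tens_op (ltri delta' alpha gamma') beta (rtri gamma' beta alpha) beta Z (idop H) \ob
  (tens_op (ltri delta (ltri phi alpha eps) gamma) beta (ltri delta' alpha gamma') beta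
      (adj (assoc delta eps phi alpha)) (idop _) \ob
    (xleg13 (ltri phi alpha eps) X \ob ket1 delta (rtri (ltri phi alpha eps) beta alpha) xi)) =
  tens_op (ltri delta (rtri eps beta alpha) gamma) beta (rtri gamma' beta alpha) beta
    (xleg13 eps X) (idop H) \ob (xleg13 (rtri eps beta alpha) X \ob
  (ket1 delta (rtri (rtri eps beta alpha) beta alpha) xi \ob
  tens_op (ltri phi alpha eps) beta (rtri eps beta alpha) beta Y (idop H))).
Proof.
move=> dx; have mW : modk true (ltri phi alpha eps) by mk.
have mW' : modk true (rtri eps beta alpha) by mk.
rewrite compopA tens_op_comp; try mk; try sm.
rewrite boxop_assocV comp1op.
have e1 : tens_op (ltri delta (ltri phi alpha eps) gamma) beta (rtri gamma' beta alpha) beta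
   (xleg13 eps X \ob tens_op delta (ltri phi alpha eps) delta (rtri eps beta alpha) (idop K) Y)
     (idop H) =
   tens_op (ltri delta (rtri eps beta alpha) gamma) beta (rtri gamma' beta alpha) beta
     (xleg13 eps X) (idop H) \ob
   tens_op (ltri delta (ltri phi alpha eps) gamma) beta (ltri delta (rtri eps beta alpha) gamma) beta
     (tens_op delta (ltri phi alpha eps) delta (rtri eps beta alpha) (idop K) Y) (idop H).
  by rewrite tens_op_comp ?comp1op//; try mk; sm.
rewrite e1 -compopA.
rewrite -(comp22 (leg13_natural mg md sgd sdg ma mb sab sba mX2 mW mW' _)); last by sm.
by rewrite tens_op_ket1 ?comp1op//; try mk; sm.
Qed.

(** What remains of the pentagon once the one for Y has been used. Inserting eta from [eps] into the
    second factor and pulling it out by naturality leaves the pentagon for X. *)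
Lemma pentagon_slice xi : delta xi ->
  tens_op gamma' (ltri hbeta alpha beta) gamma' (ltri alpha beta beta) (idop _) V \ob
    (assoc gamma' beta hbeta alpha \ob
    tens_op (rtri eps beta hbeta) alpha (rtri gamma' beta hbeta) alpha (P xi) (idop H)) =
  assoc gamma' beta alpha beta \ob
    (tens_op (ltri delta (rtri eps beta alpha) gamma) beta (rtri gamma' beta alpha) beta
    (xleg13 eps X) (idop H) \ob (xleg13 (rtri eps beta alpha) X \ob
    (ket1 delta (rtri (rtri eps beta alpha) beta alpha) xi \ob
    (adj (assoc eps beta alpha beta) \ob
    (tens_op eps (ltri hbeta alpha beta) eps (ltri alpha beta beta) (idop _) V \ob
    assoc eps beta hbeta alpha))))).
Proof.
move=> dx; have mW' : modk true (rtri eps beta alpha) by mk.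
have s1 := sP dx.
apply: rtp_ext2; first by mk.
move=> chi ax; apply: rtp_ext1; first by mk.
move=> eta ex.
pose Q := tens_op hbeta alpha (rtri eps beta hbeta) alpha (ket1 eps beta eta) (idop H).
have hQ : ket2 (rtri eps beta hbeta) alpha chi \ob ket1 eps beta eta =
    Q \ob ket2 hbeta alpha chi.
  by rewrite /Q tens_op_ket2 ?comp1op//; try mk; sm.
rewrite -[LHS]compopA -[RHS]compopA hQ !compopA; congr (_ \ob _); rewrite -!compopA.
have eP : P xi \ob ket1 eps beta eta =
    tens_op gamma beta gamma' beta (ket2 delta eps eta) (idop H) \ob
    (X \ob ket1 delta alpha xi).
  rewrite -compopA.
  have -> : ket1 delta (rtri eps beta alpha) xi \ob ket1 eps beta eta =
      tens_op delta alpha delta (rtri eps beta alpha) (idop K) (ket1 eps beta eta) \ob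
      ket1 delta alpha xi.
    by rewrite tens_op_ket1 ?comp1op//; try mk; sm.
  by rewrite compopA leg13_ket// compopA.
have s2 : semimorphism hbeta (rtri gamma beta hbeta) (X \ob ket1 delta alpha xi).
  by apply: semi_comp (proj1 mX3); sm.
have l1 : tens_op (rtri eps beta hbeta) alpha (rtri gamma' beta hbeta) alpha (P xi) (idop H) \ob Q =
    tens_op (rtri gamma beta hbeta) alpha (rtri gamma' beta hbeta) alpha
      (tens_op gamma beta gamma' beta (ket2 delta eps eta) (idop H)) (idop H) \ob
    (tens_op (rtri delta alpha hbeta) alpha (rtri gamma beta hbeta) alpha X (idop H) \ob
     tens_op hbeta alpha (rtri delta alpha hbeta) alpha (ket1 delta alpha xi) (idop H)).
  rewrite /Q tens_op_comp; try mk; try sm.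
  by rewrite eP comp1op !tens_op_comp ?comp1op//; try mk; sm.
rewrite l1.
have l2 : assoc gamma' beta hbeta alpha \ob
    tens_op (rtri gamma beta hbeta) alpha (rtri gamma' beta hbeta) alpha
      (tens_op gamma beta gamma' beta (ket2 delta eps eta) (idop H)) (idop H) =
    tens_op gamma (ltri hbeta alpha beta) gamma' (ltri hbeta alpha beta)
      (ket2 delta eps eta) (idop _) \ob assoc gamma beta hbeta alpha.
  rewrite assoc_natural; try mk; try sm.
  by rewrite tens_op_id//; mk.
rewrite (comp22 l2).
have l3 : tens_op gamma' (ltri hbeta alpha beta) gamma' (ltri alpha beta beta) (idop _) V \ob
    tens_op gamma (ltri hbeta alpha beta) gamma' (ltri hbeta alpha beta)
      (ket2 delta eps eta) (idop _) =
    tens_op gamma (ltri alpha beta beta) gamma' (ltri alpha beta beta)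
      (ket2 delta eps eta) (idop _) \ob
    tens_op gamma (ltri hbeta alpha beta) gamma (ltri alpha beta beta) (idop _) V.
  rewrite !tens_op_comp; try mk; try sm.
  by rewrite !comp1op !compop1.
rewrite (comp22 l3).
have := rf_pentagon rX; rewrite -!compopA => pX.
rewrite (comp31 pX) -!compopA.
(* On the other side the ket of eta, inserted at the far right, is now moved leftwards through all
   the factors. *)
have r1 : assoc eps beta hbeta alpha \ob Q = ket1 eps (ltri hbeta alpha beta) eta.
  by rewrite /Q assoc_ket1//; mk.
rewrite r1.
rewrite tens_op_ket1//; try mk; try sm.
rewrite comp1op (comp21 (assocV_ket1 _ _ _ _ _ ex)); try mk.
have r2 : ket1 delta (rtri (rtri eps beta alpha) beta alpha) xi \ob
    tens_op alpha beta (rtri eps beta alpha) beta (ket1 eps beta eta) (idop H) =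
    tens_op delta (rtri alpha beta alpha) delta (rtri (rtri eps beta alpha) beta alpha) (idop _)
      (tens_op alpha beta (rtri eps beta alpha) beta (ket1 eps beta eta) (idop H)) \ob
    ket1 delta (rtri alpha beta alpha) xi.
  by rewrite tens_op_ket1 ?comp1op//; try mk; sm.
rewrite (comp22 r2) (comp22 (leg13_natural mg md sgd sdg ma mb sab sba mX2 ma mW' _)); last by sm.
have r3 : tens_op (ltri delta (rtri eps beta alpha) gamma) beta (rtri gamma' beta alpha) beta
    (xleg13 eps X) (idop H) \ob
    tens_op (ltri delta alpha gamma) beta (ltri delta (rtri eps beta alpha) gamma) beta
      (tens_op delta alpha delta (rtri eps beta alpha) (idop K) (ket1 eps beta eta)) (idop H) =
    tens_op (rtri gamma beta alpha) beta (rtri gamma' beta alpha) beta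
      (tens_op gamma beta gamma' beta (ket2 delta eps eta) (idop H)) (idop H) \ob
    tens_op (ltri delta alpha gamma) beta (rtri gamma beta alpha) beta X (idop H).
  rewrite tens_op_comp; try mk; try sm.
  by rewrite leg13_ket// tens_op_comp//; try mk; sm.
rewrite (comp22 r3).
have r4 : assoc gamma' beta alpha beta \ob
    tens_op (rtri gamma beta alpha) beta (rtri gamma' beta alpha) beta
      (tens_op gamma beta gamma' beta (ket2 delta eps eta) (idop H)) (idop H) =
    tens_op gamma (ltri alpha beta beta) gamma' (ltri alpha beta beta)
      (ket2 delta eps eta) (idop _) \ob assoc gamma beta alpha beta.
  rewrite assoc_natural; try mk; try sm.
  by rewrite tens_op_id//; mk.
rewrite (comp22 r4) assoc_ket1//; try mk.
by rewrite tens_op_ket1 ?comp1op//; try mk; sm.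
Qed.

Lemma boxop_pentagon :
  tens_op gamma' (ltri hbeta alpha beta) gamma' (ltri alpha beta beta) (idop _) V
    \ob assoc gamma' beta hbeta alpha
    \ob tens_op (rtri delta' alpha hbeta) alpha (rtri gamma' beta hbeta) alpha Z (idop H)
    = assoc gamma' beta alpha beta
      \ob tens_op (ltri delta' alpha gamma') beta (rtri gamma' beta alpha) beta Z (idop H)
      \ob xleg13 alpha Z
      \ob tens_op delta' (ltri hbeta alpha alpha) delta' (rtri alpha beta alpha) (idop _) V
      \ob assoc delta' alpha hbeta alpha.
Proof.
apply: boxop_ext => xi dx; rewrite -/(J xi) -!compopA.
rewrite boxop_l_slice// assoc_slice// (comp22 (V_slice dx)) (comp22 (leg13_boxop_slice dx)) -!compopA.
have s5 := boxop_l_leg13_slice dx.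
rewrite (comp41 s5) -!compopA.
have := rf_pentagon rY; rewrite -!compopA => pY.
(* The pentagon for Y, solved for the factors that the slicing has collected at the right end. *)
have eY : tens_op (ltri phi alpha eps) beta (rtri eps beta alpha) beta Y (idop H) \ob
    (xleg13 alpha Y \ob (tens_op phi (ltri hbeta alpha alpha) phi (rtri alpha beta alpha) (idop L) V \ob
    assoc phi alpha hbeta alpha)) = adj (assoc eps beta alpha beta) \ob
    (tens_op eps (ltri hbeta alpha beta) eps (ltri alpha beta beta) (idop L) V \ob
    (assoc eps beta hbeta alpha \ob
    tens_op (rtri phi alpha hbeta) alpha (rtri eps beta hbeta) alpha Y (idop H))).
  by rewrite pY [RHS]compopA (assoc_unitary _ _ _ _ _).1 ?comp1op//; mk.
rewrite eY; have s7 := pentagon_slice dx.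
by rewrite (comp31 s7) -!compopA.
Qed.

Lemma boxop_rep : rep_facts Z.
Proof.
by split => //; exact: boxop_pentagon.
Qed.

End Box.
End RepFacts.

(** * Units and the trivial representation *)

Section Units.
Variables (R : realType) (b : cstar_base R).
Notation E := (bK b).
Implicit Types F H K L : hilbertType R.

Section AlgebraModules.
Variables (k : bool) (H : hilbertType R) (alpha : set (bop E H)).
Hypothesis ma : modk k alpha.

(** Read off from a module instead of an approximate unit: the algebra is the closed span of alpha^*
    alpha, and it satisfies [alpha B] = alpha. *)
Lemma alg_idem : clspan (opprod (alg k) (alg k)) = alg (b := b) k.
Proof.
have [_ _ aB aa] := ma.
by rewrite -{1}aa opprod_clspanl -opprodA -opprod_clspanr aB.
Qed.

Lemma mod_alg : modk k (alg (b := b) k).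
Proof.
split; [exact: alg_closed|by case: (alg_nondeg b k)|exact: alg_idem|].
suff -> : @adj _ _ _ @` alg (b := b) k = alg k by exact: alg_idem.
apply/seteqP; split; first by move=> _ [T kT <-]; exact: algJ.
by move=> T kT; exists (adj T); [exact: algJ|rewrite adjK].
Qed.

Lemma rho_alg T : alg (~~ k) T -> rho (alg (b := b) k) T = T.
Proof.
move=> kT; apply: rho_uniq => [|xi kx]; first exact: mod_total mod_alg.
by rewrite (alg_comm kx kT).
Qed.

End AlgebraModules.

Lemma stab_alg k H (alpha : set (bop E H)) K (beta : set (bop E K)) :
  modk k alpha -> modk (~~ k) beta -> stab k (alg k) (alg (b := b) (~~ k)).
Proof.
move=> ma mb; rewrite /stab -[RHS](alg_idem mb); congr (clspan (opprod _ _)).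
apply/seteqP; split; first by move=> _ [T kT <-]; rewrite (rho_alg ma).
by move=> T kT; exists T => //; rewrite (rho_alg ma).
Qed.

Section LeftUnit.
Variables (k : bool).
Hypothesis mk_alg : modk k (alg (b := b) k).

Section LeftUnitMap.
Variables (L : hilbertType R) (lam : set (bop E L)).
Hypothesis ml : modk (~~ k) lam.

Let c : compat (alg (b := b) k) lam := compat_mod mk_alg ml.

Definition unitl_spec (U : bop (rtp (alg (b := b) k) lam) L) :=
  forall c z eta, alg k c -> lam eta -> U (tens (alg k) lam c z eta) = eta (c z).

(** On the base itself [rho] is the identity ([rho_alg]), so the kets of eta and eta' have the same
    Gram operator as eta and eta' themselves. *)
Lemma unitl_ex : exists2 U : bop (rtp (alg (b := b) k) lam) L,
  (forall eta, lam eta -> U \ob ket2 (alg k) lam eta = eta) & unitary_op U.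
Proof.
have [|||U UA uU] := @unitary_family R (bop E L) lam E _ L (ket2 (alg k) lam) (fun x => x);
  last by exists U.
- exact: total_ket2.
- rewrite [X in clspan (vecprod X)](_ : _ = lam); first exact: mod_total ml.
  by apply/seteqP; split=> [_ [x lx <-]//|x lx]; exists x.
- move=> eta eta' lx lx'; rewrite ket2_adj// (rho_alg mk_alg)//.
  exact: (mod_gram ml lx lx').
Qed.

(** One operator for several purposes: for k = false it is the left unit isomorphism and [triv_Phi],
    for k = true it is [triv_Psi] and, after a flip, the right unit isomorphism. *)
Definition unitl := xget 0 unitl_spec.

Lemma unitlP : unitl_spec unitl.
Proof.
apply: xgetPex; have [U UE _] := unitl_ex; exists U => d z eta kd lx.
by rewrite -(ket2_ex c lx kd) -[LHS]/((U \ob ket2 _ _ eta) (d z)) UE.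
Qed.

Lemma unitl_ket2 eta : lam eta -> unitl \ob ket2 (alg k) lam eta = eta.
Proof.
move=> lx; apply: (vecprod_ext (mod_total mk_alg)) => d kd; apply: bopP => z.
by rewrite /= ket2_ex// unitlP.
Qed.

Lemma unitl_unitary : unitary_op unitl.
Proof.
have [U UE uU] := unitl_ex; suff -> : unitl = U by [].
by apply: (rtp_ext2 c) => eta lx; rewrite unitl_ket2// UE.
Qed.

Lemma unitl_ket1 d : alg k d -> unitl \ob ket1 (alg k) lam d = rho lam d.
Proof.
move=> kd; have kd' : alg (b := b) (~~ ~~ k) d by rewrite negbK.
apply: (vecprod_ext (mod_total ml)) => eta lx.
by rewrite -compopA ket12// compopA unitl_ket2// (mod_rhoE ml).
Qed.

Lemma morphism_unitl_l : morphism (ltri (alg k) lam (alg (~~ k))) lam unitl.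
Proof.
apply/unitary_morphismP; first exact: unitl_unitary.
case: (ml) => _ _ lB _; rewrite -[RHS]lB.
apply: clspan_image; first exact: unitl_unitary.
rewrite opimage_opprod; congr opprod; apply/seteqP; split.
  by move=> _ [_ [eta lx <-] <-]; rewrite unitl_ket2.
move=> eta lx; exists (ket2 (alg k) lam eta); first by exists eta.
by rewrite unitl_ket2.
Qed.

Lemma morphism_unitl_r F (l : set (bop F L)) : stab (~~ k) lam l ->
  morphism (rtri (alg k) lam l) l unitl.
Proof.
move=> st; apply/unitary_morphismP; first exact: unitl_unitary.
rewrite -[RHS]st; apply: clspan_image; first exact: unitl_unitary.
rewrite opimage_opprod negbK; congr opprod; apply/seteqP; split.
  by move=> _ [_ [d kd <-] <-]; rewrite unitl_ket1//; exists d.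
move=> _ [d kd <-]; exists (ket1 (alg k) lam d); first by exists d.
by rewrite unitl_ket1.
Qed.

End LeftUnitMap.

Lemma unitl_natural L L' (lam : set (bop E L)) (lam' : set (bop E L')) (T : bop L L') :
  modk (~~ k) lam -> modk (~~ k) lam' -> semimorphism lam lam' T ->
  unitl lam' \ob tens_op (alg k) lam (alg k) lam' (idop E) T = T \ob unitl lam.
Proof.
move=> ml ml' sT; have c := compat_mod mk_alg ml; have c' := compat_mod mk_alg ml'.
have si := @semi_id R E E (alg k).
apply: (rtp_ext2 c) => eta lx.
by rewrite -!compopA tens_op_ket2// compop1 !unitl_ket2//; semi.
Qed.

Lemma unitl_assoc (l : bool) L N (lam eps : set (bop E L)) (phi : set (bop E N)) :
  modk (~~ k) lam -> modk l eps -> modk (~~ l) phi ->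
  stab (~~ k) lam eps -> stab l eps lam ->
  unitl (ltri eps phi lam) \ob assoc (alg k) lam eps phi =
  tens_op (rtri (alg k) lam eps) phi eps phi (unitl lam) (idop N).
Proof.
move=> ml me mp sle sel.
have c1 := compat_mod mk_alg ml; have c2 := compat_mod me mp.
have mr := mod_rtri mk_alg ml me sle; have mt := mod_ltri me mp ml sel.
have c3 := compat_mod mr mp; have c4 := compat_mod mk_alg mt.
have st : stable (alg (b := b) k) lam eps.
  by apply: (@stable_mod _ _ (~~ k)) => //; rewrite negbK.
have su := proj1 (morphism_unitl_r ml sle).
have si := @semi_id R E N phi.
apply: (rtp_ext2 c3) => chi px; apply: (rtp_ext1 c1) => d kd.
rewrite -!compopA assoc_ket// compopA unitl_ket1//.
rewrite (rho_ltri_ket2 me mp ml sel _ px) ?negbK//.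
by rewrite [RHS]compopA tens_op_ket2// comp1op -[RHS]compopA unitl_ket1.
Qed.

End LeftUnit.

Section RightUnit.
Hypotheses (mB : modk true (bB b)) (mC : modk false (bBd b)).
Hypotheses (sBC : stab true (bB b) (bBd b)) (sCB : stab false (bBd b) (bB b)).
Variables (K : hilbertType R) (gamma delta : set (bop E K)).
Hypotheses (mg : modk true gamma) (md : modk false delta).
Hypotheses (sgd : stab true gamma delta) (sdg : stab false delta gamma).

Definition unitr : bop (rtp delta (bB b)) K :=
  locked (unitl true delta \ob flip delta (bB b)).

Lemma unitrE : unitr = unitl true delta \ob flip delta (bB b).
Proof. by rewrite /unitr -lock. Qed.

Let c : compat delta (bB b). Proof. by mk. Qed.

Lemma unitr_unitary : unitary_op unitr.
Proof.
by rewrite unitrE; apply: unitary_comp; [exact: (@unitl_unitary true mB)|exact: flip_unitary].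
Qed.

Lemma unitr_ket1 xi : delta xi -> unitr \ob ket1 delta (bB b) xi = xi.
Proof.
by move=> dx; rewrite unitrE -compopA flip_ket1// (@unitl_ket2 true mB).
Qed.

Lemma unitr_ket2 d : bB b d -> unitr \ob ket2 delta (bB b) d = rho delta d.
Proof.
by move=> dx; rewrite unitrE -compopA flip_ket2// (@unitl_ket1 true mB).
Qed.

Lemma unitr_tens xi z d : delta xi -> bB b d ->
  unitr (tens delta (bB b) xi z d) = xi (d z).
Proof.
by move=> dx bd; rewrite unitrE /= flip_tens// (@unitlP true mB).
Qed.

Lemma morphism_unitr_l F (a : set (bop F K)) : stab false delta a ->
  morphism (ltri delta (bB b) a) a unitr.
Proof.
move=> st; rewrite unitrE; apply: (morphism_comp (morphism_flip_l c a)).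
exact: (@morphism_unitl_r true mB).
Qed.

Lemma morphism_unitr_r : morphism (rtri delta (bB b) (bBd b)) delta unitr.
Proof.
rewrite unitrE; apply: (morphism_comp (morphism_flip_r c (bBd b))).
exact: (@morphism_unitl_l true mB).
Qed.

End RightUnit.

Section RightUnitLaws.
Hypotheses (mB : modk true (bB b)) (mC : modk false (bBd b)).
Hypotheses (sBC : stab true (bB b) (bBd b)) (sCB : stab false (bBd b) (bB b)).
Variables (K : hilbertType R) (delta : set (bop E K)).
Hypothesis md : modk false delta.

Lemma unitr_assoc L (lam : set (bop E L)) : modk true lam ->
  tens_op (rtri delta (bB b) (bBd b)) lam delta lam (unitr delta) (idop L) =
  tens_op delta (ltri (bBd b) lam (bB b)) delta lam (idop K) (unitl false lam) \ob
  assoc delta (bB b) (bBd b) lam.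
Proof.
move=> ml; have mr1 : morphism (rtri delta (bB b) (bBd b)) delta (unitr delta).
  exact: (morphism_unitr_r mB).
have ml1 : morphism (ltri (bBd b) lam (bB b)) lam (unitl false lam).
  exact: (@morphism_unitl_l false mC).
apply: rtp_ext2; first by mk.
move=> chi ax; apply: rtp_ext1; first by mk.
move=> xi dx; rewrite tens_op_ket2//; try mk; try sm.
rewrite comp1op -!compopA (unitr_ket1 mB)// assoc_ket//; try mk.
rewrite compopA tens_op_ket1//; try mk; try sm.
by rewrite comp1op -compopA (@unitl_ket2 false mC)// ket12//; mk.
Qed.

Lemma unitr_natural K' (delta' : set (bop E K')) (S : bop K K') :
  modk false delta' -> semimorphism delta delta' S ->
  unitr delta' \ob tens_op delta (bB b) delta' (bB b) S (idop E) = S \ob unitr delta.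
Proof.
move=> md' sS; apply: rtp_ext1; first by mk.
move=> xi dx.
rewrite -!compopA tens_op_ket1//; try mk; try sm.
by rewrite compop1 !(unitr_ket1 mB)//; semi.
Qed.

End RightUnitLaws.
End Units.

Section TrivialRep.
Variables (R : realType) (b : cstar_base R).
Notation E := (bK b).
Variables (H : hilbertType R) (hbeta alpha beta : set (bop E H)).
Variable V : bop (rtp hbeta alpha) (rtp alpha beta).
Hypothesis bf : base_facts V.

Let ma : modk true alpha. Proof. exact: bf_a bf. Qed.
Let mb : modk false beta. Proof. exact: bf_b bf. Qed.
Let mh : modk false hbeta. Proof. exact: bf_h bf. Qed.
Let sab : stab true alpha beta. Proof. exact: bf_ab bf. Qed.
Let sba : stab false beta alpha. Proof. exact: bf_ba bf. Qed.
Let sah : stab true alpha hbeta. Proof. exact: bf_ah bf. Qed.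
Let sha : stab false hbeta alpha. Proof. exact: bf_ha bf. Qed.
Let sbh : stab false beta hbeta. Proof. exact: bf_bh bf. Qed.
Let shb : stab false hbeta beta. Proof. exact: bf_hb bf. Qed.
Let uV : unitary_op V. Proof. exact: bf_V bf. Qed.
Let mV1 : morphism (ltri hbeta alpha alpha) (rtri alpha beta alpha) V. Proof. exact: bf_V1 bf. Qed.
Let mV2 : morphism (rtri hbeta alpha beta) (ltri alpha beta hbeta) V. Proof. exact: bf_V2 bf. Qed.
Let mV3 : morphism (rtri hbeta alpha hbeta) (rtri alpha beta hbeta) V. Proof. exact: bf_V3 bf. Qed.
Let mV4 : morphism (ltri hbeta alpha beta) (ltri alpha beta beta) V. Proof. exact: bf_V4 bf. Qed.

Lemma mod_bB : modk true (bB b). Proof. exact: (mod_alg ma). Qed.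
Lemma mod_bBd : modk false (bBd b). Proof. exact: (mod_alg mb). Qed.
Lemma stab_bB : stab true (bB b) (bBd b). Proof. exact: (stab_alg ma mb). Qed.
Lemma stab_bBd : stab false (bBd b) (bB b). Proof. exact: (stab_alg mb ma). Qed.

Let mB := mod_bB.
Let mC := mod_bBd.
Let sBC := stab_bB.
Let sCB := stab_bBd.

Definition trivX : bop (rtp (bBd b) alpha) (rtp (bB b) beta) :=
  locked (adj (unitl true beta) \ob unitl false alpha).

Lemma trivXE : trivX = adj (unitl true beta) \ob unitl false alpha.
Proof. by rewrite /trivX -lock. Qed.

Let uPhi : unitary_op (unitl false alpha). Proof. exact: (@unitl_unitary _ _ false mC). Qed.
Let uPsi : unitary_op (unitl true beta). Proof. exact: (@unitl_unitary _ _ true mB). Qed.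

Lemma trivX_unitary : unitary_op trivX.
Proof. by rewrite trivXE; apply: unitary_comp => //; exact: unitary_adj. Qed.

Lemma trivX_1 : morphism (ltri (bBd b) alpha (bB b)) (rtri (bB b) beta alpha) trivX.
Proof.
rewrite trivXE; apply: (morphism_comp (beta := alpha)).
  exact: (@morphism_unitl_l _ _ false mC).
by apply: morphism_adj; apply: (@morphism_unitl_r _ _ true mB).
Qed.

Lemma trivX_2 : morphism (rtri (bBd b) alpha beta) (ltri (bB b) beta (bBd b)) trivX.
Proof.
rewrite trivXE; apply: (morphism_comp (beta := beta)).
  exact: (@morphism_unitl_r _ _ false mC).
by apply: morphism_adj; apply: (@morphism_unitl_l _ _ true mB).
Qed.

Lemma trivX_3 : morphism (rtri (bBd b) alpha hbeta) (rtri (bB b) beta hbeta) trivX.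
Proof.
rewrite trivXE; apply: (morphism_comp (beta := hbeta)).
  exact: (@morphism_unitl_r _ _ false mC).
by apply: morphism_adj; apply: (@morphism_unitl_r _ _ true mB).
Qed.

Let uX := trivX_unitary.
Let mX1 := trivX_1.
Let mX2 := trivX_2.
Let mX3 := trivX_3.

(** Evaluates the trivial representation inside larger products, both in its own pentagon and in its
    product with another representation: only unit isomorphisms survive. *)
Lemma leg13_triv L (eps : set (bop E L)) : modk true eps ->
  tens_op (ltri (bBd b) eps (bB b)) beta eps beta (unitl false eps) (idop H) \ob
    xleg13 eps trivX = unitl false (rtri eps beta alpha).
Proof.
move=> me; have mW : modk true (rtri eps beta alpha) by mk.
have mu : morphism (ltri (bBd b) eps (bB b)) eps (unitl false eps).
  exact: (@morphism_unitl_l _ _ false mC).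
apply: (leg13_ext mC ma mb sba me) => eta ex; rewrite -compopA leg13_ket//.
rewrite compopA tens_op_comp; try mk; try sm.
rewrite (@unitl_ket2 _ _ false mC)// comp1op.
(* eta is regarded as a semi-morphism from the base to L; tensored with the identity it becomes the
   ket of eta up to the unit isomorphism. *)
have se : semimorphism (bB b) eps eta.
  by move=> _ [T bT <-]; exact: (mod_mul me ex bT).
have -> : tens_op (bB b) beta eps beta eta (idop H) = ket1 eps beta eta \ob unitl true beta.
  apply: rtp_ext2; first by mk.
  move=> be bx; rewrite tens_op_ket2 ?comp1op//; try mk; try sm.
  by rewrite -compopA (@unitl_ket2 _ _ true mB)// ket12//; mk.
rewrite (@unitl_natural _ _ false mC)//; last by sm.
by rewrite trivXE -!compopA (compopA (unitl true beta)) uPsi.2 comp1op.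
Qed.

(** After composition with a left unit isomorphism, naturality of the unit and its compatibility
    with associativity turn both sides of the pentagon into V composed with Phi tensored with the
    identity. *)
Lemma trivX_rep : rep_facts V trivX.
Proof.
split=> //.
have mW : modk false (ltri alpha beta beta) by mk.
have mW' : modk false (ltri hbeta alpha beta) by mk.
have uU : unitary_op (unitl true (ltri alpha beta beta)) by exact: (@unitl_unitary _ _ true mB).
have canc G (A B : bop G _) : unitl true (ltri alpha beta beta) \ob A = unitl true (ltri alpha beta beta) \ob B -> A = B.
  by move=> AB; rewrite -[A]comp1op -[B]comp1op -uU.1 -!compopA AB.
have mP1 : morphism (rtri (bB b) beta hbeta) hbeta (unitl true beta).
  exact: (@morphism_unitl_r _ _ true mB).
have mP2 : morphism (rtri (bB b) beta alpha) alpha (unitl true beta).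
  exact: (@morphism_unitl_r _ _ true mB).
have mP3 : morphism (rtri (bBd b) alpha hbeta) hbeta (unitl false alpha).
  exact: (@morphism_unitl_r _ _ false mC).
have mP4 : morphism (ltri (bBd b) alpha (bB b)) alpha (unitl false alpha).
  exact: (@morphism_unitl_l _ _ false mC).
have PX : unitl true beta \ob trivX = unitl false alpha.
  by rewrite trivXE compopA uPsi.2 comp1op.
apply: canc; rewrite -!compopA.
rewrite (comp22 (@unitl_natural _ _ true mB _ _ _ _ _ mW' mW (proj1 mV4))).
rewrite (comp21 (@unitl_assoc _ _ true mB false _ _ _ _ _ mb mh ma sbh shb)).
rewrite tens_op_comp; try mk; try sm.
rewrite PX comp1op.
rewrite (comp21 (@unitl_assoc _ _ true mB true _ _ _ _ _ mb ma mb sba sab)).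
have e1 : tens_op (rtri (bB b) beta alpha) beta alpha beta (unitl true beta) (idop H) \ob
    tens_op (ltri (bBd b) alpha (bB b)) beta (rtri (bB b) beta alpha) beta trivX (idop H) =
    tens_op (ltri (bBd b) alpha (bB b)) beta alpha beta (unitl false alpha) (idop H).
  by rewrite tens_op_comp ?PX ?comp1op//; try mk; sm.
rewrite (comp21 e1) (comp21 (leg13_triv ma)).
have mW2 : modk true (ltri hbeta alpha alpha) by mk.
have mW3 : modk true (rtri alpha beta alpha) by mk.
rewrite (comp22 (@unitl_natural _ _ false mC _ _ _ _ _ mW2 mW3 (proj1 mV1))).
by rewrite (@unitl_assoc _ _ false mC false _ _ _ _ _ ma mh ma sah sha).
Qed.

Section UnitIntertwiners.
Variables (K : hilbertType R) (gamma delta : set (bop E K)).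
Variable X : bop (rtp delta alpha) (rtp gamma beta).
Hypothesis rX : rep_facts V X.

Let mg : modk true gamma. Proof. exact: rf_g rX. Qed.
Let md : modk false delta. Proof. exact: rf_d rX. Qed.
Let sgd : stab true gamma delta. Proof. exact: rf_gd rX. Qed.
Let sdg : stab false delta gamma. Proof. exact: rf_dg rX. Qed.
Let uX' : unitary_op X. Proof. exact: rf_X rX. Qed.
Let mX1' : morphism (ltri delta alpha gamma) (rtri gamma beta alpha) X. Proof. exact: rf_X1 rX. Qed.
Let mX2' : morphism (rtri delta alpha beta) (ltri gamma beta delta) X. Proof. exact: rf_X2 rX. Qed.

Lemma unitl_intertwiner :
  X \ob tens_op (rtri (bBd b) gamma delta) alpha delta alpha (unitl false gamma) (idop H) =
  tens_op (ltri (bBd b) gamma (bB b)) beta gamma beta (unitl false gamma) (idop H) \ob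
    boxop trivX X.
Proof.
have mW1 : modk true (ltri delta alpha gamma) by mk.
have mW2 : modk true (rtri gamma beta alpha) by mk.
rewrite (boxopE bf trivX_rep rX) -!compopA (comp21 (leg13_triv mg)).
rewrite (comp22 (@unitl_natural _ _ false mC _ _ _ _ _ mW1 mW2 (proj1 mX1'))).
by rewrite (@unitl_assoc _ _ false mC false _ _ _ _ _ mg md ma sgd sdg).
Qed.

(** For [rtri delta alpha beta] and [ltri gamma beta delta] the operators [rho] act on a single
    factor, and X, which maps the first structure to the second, intertwines them. The right unit
    needs this because it turns kets of base elements into such operators. *)
Lemma leg13_rho d : bB b d ->
  X \ob tens_op delta alpha delta alpha (idop K) (rho beta d) =
  tens_op gamma beta gamma beta (rho delta d) (idop H) \ob X.
Proof.
move=> bd; have bd' : alg (b := b) (~~ false) d by [].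
have mb1 : morphism alpha alpha (rho beta d) by exact: (stab_morphism mb sba).
have mg1 : morphism gamma gamma (rho delta d) by exact: (stab_morphism md sdg).
have mR1 : modk false (rtri delta alpha beta) by mk.
have mR2 : modk false (ltri gamma beta delta) by mk.
have -> : tens_op delta alpha delta alpha (idop K) (rho beta d) = rho (rtri delta alpha beta) d.
  apply: rtp_ext1; first by mk.
  move=> xi dx; rewrite tens_op_ket1 ?comp1op//; try mk; try sm.
  by rewrite (@rho_rtri_ket1 _ _ false _ _ _ _ md ma false beta).
have -> : tens_op gamma beta gamma beta (rho delta d) (idop H) = rho (ltri gamma beta delta) d.
  apply: rtp_ext2; first by mk.
  move=> xi dx; rewrite tens_op_ket2 ?comp1op//; try mk; try sm.
  by rewrite (@rho_ltri_ket2 _ _ true _ _ _ _ mg mb false delta).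
apply: semi_rho; [exact: mod_total mR1|exact: mod_total mR2| | |exact: (proj1 mX2')].
  exact: (mod_cent mR1 bd').
exact: (mod_cent mR2 bd').
Qed.

Lemma unitr_intertwiner :
  X \ob tens_op (rtri delta (bB b) (bBd b)) alpha delta alpha (unitr delta) (idop H) =
  tens_op (ltri delta (bB b) gamma) beta gamma beta (unitr delta) (idop H) \ob
    boxop X trivX.
Proof.
have mr1 : morphism (rtri delta (bB b) (bBd b)) delta (unitr delta).
  exact: morphism_unitr_r.
have mr2 : morphism (ltri delta (bB b) gamma) gamma (unitr delta).
  exact: morphism_unitr_l.
have mP4 : morphism (ltri (bBd b) alpha (bB b)) alpha (unitl false alpha).
  exact: (@morphism_unitl_l _ _ false mC).
have mP2 : morphism (rtri (bB b) beta alpha) alpha (unitl true beta).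
  exact: (@morphism_unitl_r _ _ true mB).
have PX : unitl true beta \ob trivX = unitl false alpha.
  by rewrite trivXE compopA uPsi.2 comp1op.
(* The unit isomorphisms remove the base from between the two legs of X; on the ket of d this is
   [leg13_rho]. *)
have R2 : tens_op (ltri delta (bB b) gamma) beta gamma beta (unitr delta) (idop H) \ob
    xleg13 (bB b) X =
    X \ob tens_op delta (rtri (bB b) beta alpha) delta alpha (idop K) (unitl true beta).
  apply: (leg13_ext md ma mb sba mB) => d bd.
  have mb1 : morphism alpha alpha (rho beta d) by exact: (stab_morphism mb sba).
  have mg1 : morphism gamma gamma (rho delta d) by exact: (stab_morphism md sdg).
  rewrite -!compopA leg13_ket// compopA tens_op_comp; try mk; try sm.
  rewrite unitr_ket2// tens_op_comp; try mk; try sm.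
  by rewrite (@unitl_ket1 _ _ true mB)// !comp1op leg13_rho.
rewrite (boxopE bf rX trivX_rep) (unitr_assoc mB mC sBC sCB md ma) -!compopA (comp22 R2).
have e : tens_op delta (rtri (bB b) beta alpha) delta alpha (idop K) (unitl true beta) \ob
    tens_op delta (ltri (bBd b) alpha (bB b)) delta (rtri (bB b) beta alpha) (idop K) trivX =
    tens_op delta (ltri (bBd b) alpha (bB b)) delta alpha (idop K) (unitl false alpha).
  by rewrite tens_op_comp ?PX ?comp1op//; try mk; sm.
by rewrite (comp21 e).
Qed.

End UnitIntertwiners.
End TrivialRep.

(** * Coherence *)

Section Coherence.
Variables (R : realType) (b : cstar_base R).
Notation E := (bK b).

Lemma assoc_pentagon (H K L N : hilbertType R) (delta : set (bop E H))
    (eps phi : set (bop E K)) (nu omega : set (bop E L)) (gamma : set (bop E N)) :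
  modk false delta -> modk true eps -> modk false phi -> stab true eps phi ->
  stab false phi eps -> modk true nu -> modk false omega -> stab true nu omega ->
  stab false omega nu -> modk true gamma ->
  tens_op delta (ltri (rtri phi nu omega) gamma (ltri phi nu eps))
    delta (ltri phi (ltri omega gamma nu) eps) (idop H) (assoc phi nu omega gamma) \ob
  (assoc delta (ltri phi nu eps) (rtri phi nu omega) gamma \ob
   tens_op (rtri (rtri delta eps phi) nu omega) gamma
     (rtri delta (ltri phi nu eps) (rtri phi nu omega)) gamma
     (assoc delta eps phi nu) (idop N)) =
  assoc delta eps phi (ltri omega gamma nu) \ob assoc (rtri delta eps phi) nu omega gamma.
Proof.
move=> md me mp sep spe mn mo sno son mg.
have ma1 : morphism (rtri (rtri delta eps phi) nu omega)
    (rtri delta (ltri phi nu eps) (rtri phi nu omega)) (assoc delta eps phi nu).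
  exact: (morphism_assoc_r (k := false) (l := false)).
have ma2 : morphism (ltri (rtri phi nu omega) gamma (ltri phi nu eps))
    (ltri phi (ltri omega gamma nu) eps) (assoc phi nu omega gamma).
  exact: (morphism_assoc_l (k := false) (l := false)).
have mW : modk true (ltri omega gamma nu) by mk.
apply: rtp_ext2; first by mk.
move=> chi gx; apply: rtp_ext2; first by mk.
move=> n nx; apply: rtp_ext1; first by mk.
move=> xi dx.
have nchi : ltri omega gamma nu (ket2 omega gamma chi \ob n).
  by apply: (semi_ket2 gx); exists n.
have -> : assoc delta eps phi (ltri omega gamma nu) \ob assoc (rtri delta eps phi) nu omega gamma
    \ob ket2 (rtri (rtri delta eps phi) nu omega) gamma chi
    \ob ket2 (rtri delta eps phi) nu n \ob ket1 delta eps xi =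
    ket1 delta (ltri phi (ltri omega gamma nu) eps) xi \ob
      ket2 phi (ltri omega gamma nu) (ket2 omega gamma chi \ob n).
  rewrite -!compopA (comp21 (assoc_ket2 _ _ _ _ _ _))//; try mk.
  rewrite (comp21 (tens_op_ket2 _ _ _ _ _ _))//; try mk; try sm.
  by rewrite compop1 assoc_ket//; mk.
rewrite -!compopA (comp22 (tens_op_ket2 _ _ _ _ _ _))//; try mk; try sm.
rewrite comp1op assoc_ket//; try mk.
rewrite (comp31 (assoc_ket _ _ _ _ _ _ _))//; try mk.
rewrite -compopA (comp22 (tens_op_ket1 _ _ _ _ _ _))//; try mk; try sm.
rewrite comp1op (comp21 (assoc_ket2 _ _ _ _ _ _))//; try mk.
by rewrite tens_op_ket2 ?compop1//; try mk; sm.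
Qed.

Section Monoidal.
Variables (H : hilbertType R) (hbeta alpha beta : set (bop E H)).
Variable V : bop (rtp hbeta alpha) (rtp alpha beta).
Hypothesis bf : base_facts V.

Let ma : modk true alpha. Proof. exact: bf_a bf. Qed.
Let mb : modk false beta. Proof. exact: bf_b bf. Qed.
Let sab : stab true alpha beta. Proof. exact: bf_ab bf. Qed.
Let sba : stab false beta alpha. Proof. exact: bf_ba bf. Qed.

Section Functor.
Variables (K K' L L' : hilbertType R).
Variables (gamma delta : set (bop E K)) (gamma' delta' : set (bop E K')).
Variables (eps phi : set (bop E L)) (eps' phi' : set (bop E L')).
Variables (X : bop (rtp delta alpha) (rtp gamma beta)) (X' : bop (rtp delta' alpha) (rtp gamma' beta)).
Variables (Y : bop (rtp phi alpha) (rtp eps beta)) (Y' : bop (rtp phi' alpha) (rtp eps' beta)).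
Hypotheses (rX : rep_facts V X) (rX' : rep_facts V X') (rY : rep_facts V Y) (rY' : rep_facts V Y').
Variables (S : bop K K') (T : bop L L').
Hypotheses (sg : semimorphism gamma gamma' S) (sd : semimorphism delta delta' S).
Hypotheses (se : semimorphism eps eps' T) (sp : semimorphism phi phi' T).
Hypothesis iS : X' \ob tens_op delta alpha delta' alpha S (idop H) =
  tens_op gamma beta gamma' beta S (idop H) \ob X.
Hypothesis iT : Y' \ob tens_op phi alpha phi' alpha T (idop H) =
  tens_op eps beta eps' beta T (idop H) \ob Y.

Lemma boxop_natural :
  boxop X' Y' \ob tens_op (rtri delta eps phi) alpha (rtri delta' eps' phi') alpha
     (tens_op delta eps delta' eps' S T) (idop H) =
  tens_op (ltri delta eps gamma) beta (ltri delta' eps' gamma') beta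
     (tens_op delta eps delta' eps' S T) (idop H) \ob boxop X Y.
Proof.
have [mg md sgd sdg _ _ mX2 _ _] := rX.
have [mg' md' sgd' sdg' _ _ mX2' _ _] := rX'.
have [me mp sep spe _ mY1 mY2 _ _] := rY.
have [me' mp' sep' spe' _ mY1' mY2' _ _] := rY'.
have legs : xleg13 eps' X' \ob
    tens_op delta (rtri eps beta alpha) delta' (rtri eps' beta alpha) S
      (tens_op eps beta eps' beta T (idop H)) =
    tens_op (ltri delta eps gamma) beta (ltri delta' eps' gamma') beta
      (tens_op delta eps delta' eps' S T) (idop H) \ob xleg13 eps X.
  apply: (leg13_ext md ma mb sba me) => eta ex.
  have ex' : eps' (T \ob eta) by apply: se; exists eta.
  rewrite -!compopA leg13_ket// tens_op_comp; try mk; try sm.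
  rewrite tens_op_ket1//; try mk; try sm.
  rewrite [RHS]compopA tens_op_comp; try mk; try sm.
  rewrite tens_op_ket2//; try mk; try sm.
  rewrite compop1 comp1op.
  have -> : tens_op delta alpha delta' (rtri eps' beta alpha) S
       (ket1 eps' beta (T \ob eta) \ob idop H) =
     tens_op delta' alpha delta' (rtri eps' beta alpha) (idop K') (ket1 eps' beta (T \ob eta)) \ob
     tens_op delta alpha delta' alpha S (idop H).
    by rewrite tens_op_comp ?comp1op//; try mk; sm.
  rewrite compopA leg13_ket// -compopA iS compopA tens_op_comp; try mk; try sm.
  by rewrite comp1op.
rewrite (boxopE bf rX rY) (boxopE bf rX' rY') -!compopA assoc_natural; try mk; try sm.
rewrite (comp22 (B := tens_op _ _ _ _ _ _) (C := tens_op delta (rtri eps beta alpha) delta' (rtri eps' beta alpha) S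
      (tens_op eps beta eps' beta T (idop H))) (D := tens_op delta (ltri phi alpha eps) delta (rtri eps beta alpha) (idop K) Y)).
  by rewrite (comp22 legs).
by rewrite !tens_op_comp; try mk; try sm; rewrite comp1op compop1 iT.
Qed.
End Functor.

Section Assoc.
Variables (K L N : hilbertType R).
Variables (gamma delta : set (bop E K)) (eps phi : set (bop E L)) (nu omega : set (bop E N)).
Variables (X : bop (rtp delta alpha) (rtp gamma beta)) (Y : bop (rtp phi alpha) (rtp eps beta)).
Variable Z : bop (rtp omega alpha) (rtp nu beta).
Hypotheses (rX : rep_facts V X) (rY : rep_facts V Y) (rZ : rep_facts V Z).

Lemma boxop_assoc :
  boxop X (boxop Y Z) \ob tens_op (rtri (rtri delta eps phi) nu omega) alpha
     (rtri delta (ltri phi nu eps) (rtri phi nu omega)) alpha (assoc delta eps phi nu) (idop H) =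
  tens_op (ltri (rtri delta eps phi) nu (ltri delta eps gamma)) beta
     (ltri delta (ltri phi nu eps) gamma) beta (assoc delta eps phi nu) (idop H) \ob
  boxop (boxop X Y) Z.
Proof.
have [mg md sgd sdg _ _ mX2 _ _] := rX.
have [me mp sep spe _ mY1 mY2 _ _] := rY.
have [mn mo sno son _ mZ1 mZ2 _ _] := rZ.
have [mg2 md2 sgd2 sdg2 _ _ mXY2 _ _] := boxop_rep bf rX rY.
have [_ _ _ _ _ mYZ1 mYZ2 _ _] := boxop_rep bf rY rZ.
have ma1 : morphism (rtri (rtri delta eps phi) nu omega)
    (rtri delta (ltri phi nu eps) (rtri phi nu omega)) (assoc delta eps phi nu).
  exact: (morphism_assoc_r (k := false) (l := false)).
have ma2 : morphism (ltri (rtri delta eps phi) nu (ltri delta eps gamma))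
    (ltri delta (ltri phi nu eps) gamma) (assoc delta eps phi nu).
  exact: (morphism_assoc_l (k := false) (l := false)).
have ma3 : morphism (ltri (rtri phi nu omega) alpha (ltri phi nu eps))
    (ltri phi (ltri omega alpha nu) eps) (assoc phi nu omega alpha).
  exact: (morphism_assoc_l (k := false) (l := false)).
have sa3 := proj1 ma3.
have mlY : morphism (ltri phi (rtri nu beta alpha) eps) (rtri (ltri phi nu eps) beta alpha)
    (xleg13 nu Y).
  exact: (morphism_leg13_l me mp sep spe ma mb sab sba).
(* Y skipping N, followed by X skipping L and N, amounts to the product of X and Y skipping N;
   freezing the factor N reduces this to the definition of the product. *)
have legs : xleg13 (ltri phi nu eps) X \ob
    (tens_op delta (ltri phi (rtri nu beta alpha) eps) delta (rtri (ltri phi nu eps) beta alpha)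
       (idop K) (xleg13 nu Y) \ob assoc delta eps phi (rtri nu beta alpha)) =
    tens_op (ltri (rtri delta eps phi) nu (ltri delta eps gamma)) beta
      (ltri delta (ltri phi nu eps) gamma) beta (assoc delta eps phi nu) (idop H) \ob
    xleg13 nu (boxop X Y).
  apply: (leg13_ext md2 ma mb sba mn) => n nx.
  have smt : semimorphism eps (ltri phi nu eps) (ket2 phi nu n) by exact: semi_ket2.
  have mt : modk true (ltri phi nu eps) by mk.
  rewrite -[RHS]compopA (leg13_ket mg2 md2 sgd2 sdg2 ma mb sab sba mXY2 mn nx).
  rewrite [RHS]compopA tens_op_comp; try mk; try sm.
  rewrite assoc_ket2//; try mk.
  rewrite comp1op (boxopE bf rX rY) -!compopA.
  rewrite (comp22 (esym (leg13_natural mg md sgd sdg ma mb sab sba mX2 me mt smt))).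
  rewrite -[idop (rtp delta eps)]tens_op_id; last by mk.
  rewrite assoc_natural; try mk; try sm.
  rewrite (comp22 (A := tens_op delta (ltri phi (rtri nu beta alpha) eps) _ _ _ _)
     (C := tens_op delta (rtri eps beta alpha) delta (rtri (ltri phi nu eps) beta alpha) (idop K)
       (tens_op eps beta (ltri phi nu eps) beta (ket2 phi nu n) (idop H)))
     (D := tens_op delta (ltri phi alpha eps) delta (rtri eps beta alpha) (idop K) Y))//.
  by rewrite !tens_op_comp; try mk; try sm; rewrite leg13_ket.
rewrite (boxopE bf rX (boxop_rep bf rY rZ)) (boxopE bf (boxop_rep bf rX rY) rZ).
rewrite -!compopA (comp22 (esym legs)).
have -> : tens_op delta (ltri (rtri phi nu omega) alpha (ltri phi nu eps)) delta
      (rtri (ltri phi nu eps) beta alpha) (idop K) (boxop Y Z) =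
    tens_op delta (ltri phi (rtri nu beta alpha) eps) delta (rtri (ltri phi nu eps) beta alpha)
       (idop K) (xleg13 nu Y) \ob
    (tens_op delta (ltri phi (ltri omega alpha nu) eps) delta (ltri phi (rtri nu beta alpha) eps)
       (idop K) (tens_op phi (ltri omega alpha nu) phi (rtri nu beta alpha) (idop L) Z) \ob
     tens_op delta (ltri (rtri phi nu omega) alpha (ltri phi nu eps)) delta
       (ltri phi (ltri omega alpha nu) eps) (idop K) (assoc phi nu omega alpha)).
  rewrite tens_op_comp; try mk; try sm.
  rewrite comp1op tens_op_comp; try mk; try sm.
  by rewrite comp1op (boxopE bf rY rZ) -compopA.
(* The leg operators now agree on both sides; what is left is the pentagon of the module category
   and naturality of associativity with respect to Z. *)
rewrite -!compopA assoc_pentagon//; try mk.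
rewrite (comp22 (esym (assoc_natural _ _ _ _ _ _ _ _ _ _ _ _ _ _ _ _ _ _))); try mk; try sm.
by rewrite tens_op_id//; mk.
Qed.
End Assoc.
End Monoidal.
End Coherence.

(** * Morphisms, products and coherence isomorphisms of representations *)

Section RepCategory.
Variables (R : realType) (M : cpmu R).
Notation b := (mb M).
Notation E := (bK b).
Notation alpha := (malpha M).
Notation beta := (mbeta M).
Notation hbeta := (mhbeta M).
Notation H := (mH M).
Notation V := (mV M).
Implicit Types X Y Z W : rep_data M.

Lemma base_facts_cpmu : base_facts V.
Proof.
have [[mh ma sha sah] [_ mb shb sbh] [_ _ sab sba]] := m_module M.
have uV := mV_unitary M.
split=> //; apply/(unitary_morphismP _ _ uV).
- exact: mV_alpha_alpha.
- exact: mV_hbeta_beta.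
- exact: mV_hbeta_hbeta.
- exact: mV_beta_alpha.
Qed.

Let bf := base_facts_cpmu.
Let ma : modk true alpha. Proof. exact: bf_a bf. Qed.
Let mb : modk false beta. Proof. exact: bf_b bf. Qed.
Let mB : modk true (bB b). Proof. exact: (mod_bB bf). Qed.
Let mC : modk false (bBd b). Proof. exact: (mod_bBd bf). Qed.
Let sBC : stab true (bB b) (bBd b). Proof. exact: (stab_bB bf). Qed.
Let sCB : stab false (bBd b) (bB b). Proof. exact: (stab_bBd bf). Qed.

Lemma is_repP X : is_rep X <-> rep_facts V (rX X).
Proof.
split=> [[[mg md sgd sdg] uX X1 X2 X3 p]|[mg md sgd sdg uX X1 X2 X3 p]].
  have m1 := (unitary_morphismP _ _ uX).2 X1.
  have m2 := (unitary_morphismP _ _ uX).2 X2.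
  have m3 := (unitary_morphismP _ _ uX).2 X3.
  by split=> //; rewrite -(pentagon_eqE bf).
split; [by split|by []|by apply/unitary_morphismP..|].
by rewrite (pentagon_eqE bf).
Qed.

Lemma rX_box X Y : rX (box X Y) = boxop (rX X) (rX Y).
Proof. by rewrite /boxop -lock. Qed.

Lemma triv_PhiE : triv_Phi M = unitl false alpha.
Proof.
have c : compat (bBd b) alpha by mk.
apply: (rtp_ext1 c) => d bd; rewrite (@unitl_ket1 _ _ false mC)//.
suff : [set T : bop (rtp (bBd b) alpha) H |
    forall c, bBd b c -> T \ob ket1 (bBd b) alpha c = rho alpha c] (triv_Phi M) by exact.
apply: xgetPex; exists (unitl false alpha) => e be; exact: (@unitl_ket1 _ _ false mC).
Qed.

Lemma triv_PsiE : triv_Psi M = unitl true beta.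
Proof.
have c : compat (bB b) beta by mk.
apply: (rtp_ext1 c) => d bd; rewrite (@unitl_ket1 _ _ true mB)//.
suff : [set T : bop (rtp (bB b) beta) H |
    forall c, bB b c -> T \ob ket1 (bB b) beta c = rho beta c] (triv_Psi M) by exact.
apply: xgetPex; exists (unitl true beta) => e be; exact: (@unitl_ket1 _ _ true mB).
Qed.

Lemma rX_triv : rX (triv_rep M) = trivX alpha beta.
Proof. by rewrite trivXE /= triv_PhiE triv_PsiE. Qed.

Lemma triv_is_rep : is_rep (triv_rep M).
Proof. by apply/is_repP; rewrite rX_triv; exact: trivX_rep bf. Qed.

Lemma box_is_rep X Y : is_rep X -> is_rep Y -> is_rep (box X Y).
Proof.
by move=> /is_repP rX /is_repP rY; apply/is_repP; rewrite rX_box; exact: boxop_rep.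
Qed.

Lemma box_unit_rE X : is_rep X -> box_unit_r X = unitr (rhdelta X).
Proof.
move=> /is_repP[_ md _ _ _ _ _ _ _]; have c : compat (rhdelta X) (bB b) by mk.
have uP : [set U : bop (rtp (rhdelta X) (bB b)) (rK X) |
    forall xi z c, rhdelta X xi -> bB b c ->
      U (tens (rhdelta X) (bB b) xi z c) = xi (c z)] (box_unit_r X).
  by apply: xgetPex; exists (unitr (rhdelta X)) => xi z d dx bd; exact: (unitr_tens mB).
apply: (rtp_ext c) => xi d dx bd; apply: bopP => z.
by rewrite /= ket1_ex// uP// (unitr_tens mB).
Qed.

Lemma intertwinerE X Y T : is_rep X -> is_rep Y ->
  semimorphism (rgamma X) (rgamma Y) T -> semimorphism (rhdelta X) (rhdelta Y) T ->
  intertwiner T =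
  (rX Y \ob tens_op (rhdelta X) alpha (rhdelta Y) alpha T (idop H) =
   tens_op (rgamma X) beta (rgamma Y) beta T (idop H) \ob rX X).
Proof.
move=> /is_repP[mg md _ _ _ _ _ _ _] /is_repP[mg' md' _ _ _ _ _ _ _] sg sd.
by rewrite /intertwiner !tens_lE//; mk.
Qed.

Lemma rep_morphism_semi X Y T : rep_morphism X Y T -> rep_semimorphism X Y T.
Proof. by case=> [[? _] [? _] ?]; split. Qed.

Lemma rep_semimorphism_id X : is_rep X -> rep_semimorphism X X (idop (rK X)).
Proof.
move=> rX; have sg := @semi_id _ _ _ (rgamma X); have sd := @semi_id _ _ _ (rhdelta X).
split=> //; rewrite intertwinerE//; move/is_repP: rX => [mg md _ _ _ _ _ _ _].
by rewrite !tens_op_id ?compop1 ?comp1op//; mk.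
Qed.

Lemma rep_morphism_id X : is_rep X -> rep_morphism X X (idop (rK X)).
Proof. by move=> /rep_semimorphism_id[_ _ iT]; split=> //; exact: morphism_id. Qed.

Lemma rep_semimorphism_comp X Y Z S T : is_rep X -> is_rep Y -> is_rep Z ->
  rep_semimorphism X Y T -> rep_semimorphism Y Z S -> rep_semimorphism X Z (S \ob T).
Proof.
move=> rX rY rZ [tg td iT] [sg sd iS].
have cg := semi_comp tg sg; have cd := semi_comp td sd.
split=> //; move: iT iS; rewrite !intertwinerE//.
move/is_repP: rX => [mg md _ _ _ _ _ _ _].
move/is_repP: rY => [mg' md' _ _ _ _ _ _ _].
move/is_repP: rZ => [mg'' md'' _ _ _ _ _ _ _] iT iS.
have -> : tens_op (rhdelta X) alpha (rhdelta Z) alpha (S \ob T) (idop H) =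
    tens_op (rhdelta Y) alpha (rhdelta Z) alpha S (idop H) \ob
    tens_op (rhdelta X) alpha (rhdelta Y) alpha T (idop H).
  by rewrite tens_op_comp ?compop1//; try mk; sm.
have -> : tens_op (rgamma X) beta (rgamma Z) beta (S \ob T) (idop H) =
    tens_op (rgamma Y) beta (rgamma Z) beta S (idop H) \ob
    tens_op (rgamma X) beta (rgamma Y) beta T (idop H).
  by rewrite tens_op_comp ?compop1//; try mk; sm.
by rewrite compopA iS -compopA iT compopA.
Qed.

Lemma rep_morphism_comp X Y Z S T : is_rep X -> is_rep Y -> is_rep Z ->
  rep_morphism X Y T -> rep_morphism Y Z S -> rep_morphism X Z (S \ob T).
Proof.
move=> rX rY rZ mT mS.
have [_ _ iST] := rep_semimorphism_comp rX rY rZ (rep_morphism_semi mT) (rep_morphism_semi mS).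
have [tg td _] := mT; have [sg sd _] := mS.
by split=> //; [exact: (morphism_comp tg)|exact: (morphism_comp td)].
Qed.

(** The adjoint of the intertwining relation, multiplied by X on the left and by Y on the right, is
    the relation for the adjoint of T; the tensor products commute with adjoints because T is a
    morphism and not only a semi-morphism. *)
Lemma rep_morphism_adj X Y T : is_rep X -> is_rep Y ->
  rep_morphism X Y T -> rep_morphism Y X (adj T).
Proof.
move=> rX rY [tg td iT]; have [tg1 tg2] := tg; have [td1 td2] := td.
split; [exact: morphism_adj|exact: morphism_adj|].
move: iT; rewrite !intertwinerE//.
move/is_repP: rX => [mg md _ _ [uX1 uX2] _ _ _ _].
move/is_repP: rY => [mg' md' _ _ [uY1 uY2] _ _ _ _] iT.
have /(congr1 (fun S => rX X \ob adj S \ob rX Y)) := iT; rewrite !adjM => e.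
have [e1 e2] : adj (tens_op (rhdelta X) alpha (rhdelta Y) alpha T (idop H)) =
      tens_op (rhdelta Y) alpha (rhdelta X) alpha (adj T) (idop H) /\
    adj (tens_op (rgamma X) beta (rgamma Y) beta T (idop H)) =
      tens_op (rgamma Y) beta (rgamma X) beta (adj T) (idop H).
  by split; rewrite adj_tens_op ?adj1//; try mk; exact: morphism_id.
move: e; rewrite e1 e2 -!compopA uY1 compop1 => ->.
by rewrite !compopA uX2 comp1op.
Qed.

Lemma box_op_semimorphism X X' Y Y' S T :
  is_rep X -> is_rep X' -> is_rep Y -> is_rep Y' ->
  rep_semimorphism X X' S -> rep_semimorphism Y Y' T ->
  rep_semimorphism (box X Y) (box X' Y') (box_op S T).
Proof.
move=> rX rX' rY rY' [sg sd iS] [tg td iT].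
have rB := box_is_rep rX rY; have rB' := box_is_rep rX' rY'.
have fX := (is_repP X).1 rX; have fX' := (is_repP X').1 rX'.
have fY := (is_repP Y).1 rY; have fY' := (is_repP Y').1 rY'.
move: iS iT; rewrite !intertwinerE// => iS iT.
have [mg md _ _ _ _ _ _ _] := fX; have [mg' md' _ _ _ _ _ _ _] := fX'.
have [me mp _ _ _ _ _ _ _] := fY; have [me' mp' _ _ _ _ _ _ _] := fY'.
have bg : semimorphism (rgamma (box X Y)) (rgamma (box X' Y')) (box_op S T).
  by apply: semi_tens_op_ltri => //; mk.
have bd : semimorphism (rhdelta (box X Y)) (rhdelta (box X' Y')) (box_op S T).
  by apply: semi_tens_op_rtri => //; mk.
by split=> //; rewrite intertwinerE// !rX_box; exact: (boxop_natural bf fX fX' fY fY').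
Qed.

Lemma box_op_morphism X X' Y Y' S T :
  is_rep X -> is_rep X' -> is_rep Y -> is_rep Y' ->
  rep_morphism X X' S -> rep_morphism Y Y' T ->
  rep_morphism (box X Y) (box X' Y') (box_op S T).
Proof.
move=> rX rX' rY rY' mS mT.
have [_ _ iST] := box_op_semimorphism rX rX' rY rY' (rep_morphism_semi mS) (rep_morphism_semi mT).
have [sg sd _] := mS; have [tg td _] := mT.
move/is_repP: rX => [mg md _ _ _ _ _ _ _]; move/is_repP: rX' => [mg' md' _ _ _ _ _ _ _].
move/is_repP: rY => [me mp _ _ _ _ _ _ _]; move/is_repP: rY' => [me' mp' _ _ _ _ _ _ _].
split=> //.
  by apply: morphism_tens_op_ltri => //; mk.
by apply: morphism_tens_op_rtri => //; mk.
Qed.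

Lemma box_op_id X Y : is_rep X -> is_rep Y ->
  box_op (idop (rK X)) (idop (rK Y)) = idop (rK (box X Y)).
Proof.
move=> /is_repP[mg md _ _ _ _ _ _ _] /is_repP[me mp _ _ _ _ _ _ _].
by apply: tens_op_id; mk.
Qed.

Lemma box_op_comp X X' X'' Y Y' Y'' S S' T T' :
  is_rep X -> is_rep X' -> is_rep X'' -> is_rep Y -> is_rep Y' -> is_rep Y'' ->
  rep_semimorphism X X' S -> rep_semimorphism X' X'' S' ->
  rep_semimorphism Y Y' T -> rep_semimorphism Y' Y'' T' ->
  box_op (S' \ob S) (T' \ob T) = box_op S' T' \ob box_op S T.
Proof.
move=> /is_repP[mg md _ _ _ _ _ _ _] /is_repP[mg' md' _ _ _ _ _ _ _].
move=> /is_repP[mg2 md2 _ _ _ _ _ _ _] /is_repP[me mp _ _ _ _ _ _ _].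
move=> /is_repP[me' mp' _ _ _ _ _ _ _] /is_repP[me2 mp2 _ _ _ _ _ _ _].
move=> [? ? _] [? ? _] [? ? _] [? ? _].
by rewrite /box_op tens_op_comp//; mk.
Qed.

Lemma box_assoc_unitary X Y Z : is_rep X -> is_rep Y -> is_rep Z ->
  unitary_op (box_assoc X Y Z).
Proof.
move=> /is_repP[mg md sgd sdg _ _ _ _ _] /is_repP[me mp sep spe _ _ _ _ _].
move=> /is_repP[mn mo sno son _ _ _ _ _].
by apply: assoc_unitary; mk.
Qed.

Lemma box_assoc_morphism X Y Z : is_rep X -> is_rep Y -> is_rep Z ->
  rep_morphism (box (box X Y) Z) (box X (box Y Z)) (box_assoc X Y Z).
Proof.
move=> rX rY rZ; have rXY := box_is_rep rX rY; have rYZ := box_is_rep rY rZ.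
have rl := box_is_rep rXY rZ; have rr := box_is_rep rX rYZ.
have fX := (is_repP X).1 rX; have fY := (is_repP Y).1 rY; have fZ := (is_repP Z).1 rZ.
have [mg md sgd sdg _ _ _ _ _] := fX; have [me mp sep spe _ _ _ _ _] := fY.
have [mn mo sno son _ _ _ _ _] := fZ.
have ag : morphism (rgamma (box (box X Y) Z)) (rgamma (box X (box Y Z))) (box_assoc X Y Z).
  exact: (morphism_assoc_l (k := false) (l := false)).
have ad : morphism (rhdelta (box (box X Y) Z)) (rhdelta (box X (box Y Z))) (box_assoc X Y Z).
  exact: (morphism_assoc_r (k := false) (l := false)).
split=> //; rewrite intertwinerE//; [|exact: (proj1 ag)|exact: (proj1 ad)].
by rewrite !rX_box; exact: (boxop_assoc bf fX fY fZ).
Qed.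

Lemma box_unit_l_unitary X : is_rep X -> unitary_op (box_unit_l X).
Proof. by move=> /is_repP[mg _ _ _ _ _ _ _ _]; exact: (@unitl_unitary _ _ false mC). Qed.

Lemma box_unit_r_unitary X : is_rep X -> unitary_op (box_unit_r X).
Proof.
move=> rX; rewrite box_unit_rE//; move/is_repP: rX => [_ md _ _ _ _ _ _ _].
exact: (unitr_unitary mB).
Qed.

Lemma box_unit_l_morphism X : is_rep X ->
  rep_morphism (box (triv_rep M) X) X (box_unit_l X).
Proof.
move=> rX; have r1 := triv_is_rep; have r1X := box_is_rep r1 rX.
have fX := (is_repP X).1 rX; have [mg md sgd sdg _ _ _ _ _] := fX.
have ug : morphism (rgamma (box (triv_rep M) X)) (rgamma X) (box_unit_l X).
  exact: (@morphism_unitl_l _ _ false mC).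
have ud : morphism (rhdelta (box (triv_rep M) X)) (rhdelta X) (box_unit_l X).
  exact: (@morphism_unitl_r _ _ false mC).
split=> //; rewrite intertwinerE//; [|exact: (proj1 ug)|exact: (proj1 ud)].
by rewrite rX_box rX_triv; exact: (unitl_intertwiner bf fX).
Qed.

Lemma box_unit_r_morphism X : is_rep X ->
  rep_morphism (box X (triv_rep M)) X (box_unit_r X).
Proof.
move=> rX; have r1 := triv_is_rep; have rX1 := box_is_rep rX r1.
rewrite box_unit_rE//.
have fX := (is_repP X).1 rX; have [mg md sgd sdg _ _ _ _ _] := fX.
have ug : morphism (rgamma (box X (triv_rep M))) (rgamma X) (unitr (rhdelta X)).
  exact: (morphism_unitr_l mB).
have ud : morphism (rhdelta (box X (triv_rep M))) (rhdelta X) (unitr (rhdelta X)).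
  exact: (morphism_unitr_r mB).
split=> //; rewrite intertwinerE//; [|exact: (proj1 ug)|exact: (proj1 ud)].
by rewrite rX_box rX_triv; exact: (unitr_intertwiner bf fX).
Qed.

Lemma box_assoc_natural X X' Y Y' Z Z' S T U :
  is_rep X -> is_rep X' -> is_rep Y -> is_rep Y' -> is_rep Z -> is_rep Z' ->
  rep_semimorphism X X' S -> rep_semimorphism Y Y' T -> rep_semimorphism Z Z' U ->
  box_assoc X' Y' Z' \ob box_op (box_op S T) U =
  box_op S (box_op T U) \ob box_assoc X Y Z.
Proof.
move=> /is_repP[mg md sgd sdg _ _ _ _ _] /is_repP[mg' md' sgd' sdg' _ _ _ _ _].
move=> /is_repP[me mp sep spe _ _ _ _ _] /is_repP[me' mp' sep' spe' _ _ _ _ _].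
move=> /is_repP[mn mo sno son _ _ _ _ _] /is_repP[mn' mo' sno' son' _ _ _ _ _].
move=> [? ? _] [? ? _] [? ? _].
by apply: assoc_natural => //; mk.
Qed.

Lemma box_unit_l_natural X Y T : is_rep X -> is_rep Y -> rep_semimorphism X Y T ->
  box_unit_l Y \ob box_op (idop (rK (triv_rep M))) T = T \ob box_unit_l X.
Proof.
move=> /is_repP[mg _ _ _ _ _ _ _ _] /is_repP[mg' _ _ _ _ _ _ _ _] [tg _ _].
exact: (@unitl_natural _ _ false mC).
Qed.

Lemma box_unit_r_natural X Y T : is_rep X -> is_rep Y -> rep_semimorphism X Y T ->
  box_unit_r Y \ob box_op T (idop (rK (triv_rep M))) = T \ob box_unit_r X.
Proof.
move=> rX rY [_ td _]; rewrite !box_unit_rE//.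
move: rX rY => /is_repP[_ md _ _ _ _ _ _ _] /is_repP[_ md' _ _ _ _ _ _ _].
exact: (unitr_natural mB).
Qed.

Lemma box_pentagon W X Y Z : is_rep W -> is_rep X -> is_rep Y -> is_rep Z ->
  box_op (idop (rK W)) (box_assoc X Y Z) \ob
    (box_assoc W (box X Y) Z \ob box_op (box_assoc W X Y) (idop (rK Z))) =
  box_assoc W X (box Y Z) \ob box_assoc (box W X) Y Z.
Proof.
move=> /is_repP[_ md _ _ _ _ _ _ _] /is_repP[me mp sep spe _ _ _ _ _].
move=> /is_repP[mn mo sno son _ _ _ _ _] /is_repP[mg _ _ _ _ _ _ _ _].
exact: assoc_pentagon.
Qed.

Lemma box_triangle X Y : is_rep X -> is_rep Y ->
  box_op (idop (rK X)) (box_unit_l Y) \ob box_assoc X (triv_rep M) Y =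
  box_op (box_unit_r X) (idop (rK Y)).
Proof.
move=> rX; rewrite box_unit_rE//.
move: rX => /is_repP[_ md _ _ _ _ _ _ _] /is_repP[mg _ _ _ _ _ _ _ _].
exact: (esym (unitr_assoc mB mC sBC sCB md mg)).
Qed.

End RepCategory.

(** * The C*-category of representations *)

Section OperatorLimits.
Variable R : realType.
Implicit Types H K : hilbertType R.

(** Values at x converge with rate e ||x||; this rate, uniform on the unit ball, is already the norm
    estimate for the pointwise limit. *)
Lemma bop_net H K (S : R -> set (bop H K)) :
  (forall e : R, 0 < e -> S e !=set0) ->
  (forall (e e' : R) T T', 0 < e -> 0 < e' -> S e T -> S e' T' -> nrm (T - T') <= e + e') ->
  exists L, forall e : R, 0 < e -> forall T, S e T -> nrm (L - T) <= e.
Proof.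
move=> S0 SS.
have pw (x : H) : exists l, forall e : R, 0 < e -> forall T, S e T -> nrm (l - T x) <= e * nrm x.
  have n1 : 0 < nrm x + 1 by have := nrm_ge0 x; lra.
  pose s (e : R) : R := e / (nrm x + 1).
  have s0 e : 0 < e -> 0 < s e by move=> e0; rewrite divr_gt0.
  have sn e : 0 < e -> s e * nrm x <= e.
    move=> e0; rewrite /s mulrAC ler_pdivrMr// ler_pM2l//.
    by rewrite lerDl.
  have TT (e e' : R) T T' : 0 < e -> 0 < e' -> S e T -> S e' T' ->
      nrm (T x - T' x) <= (e + e') * nrm x.
    move=> e0 e0' ST ST'; have := nrm_bop (T - T') x.
    rewrite [(T - T') x]/(T x - T' x) => /le_trans; apply.
    by rewrite ler_wpM2r ?nrm_ge0// SS.
  have [e e0|e e' _ _ e0 e0' [T ST <-] [T' ST' <-]|l lS] :=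
      @complete_net R K (fun e => [set T x | T in S (s e)]).
  - by have [T ST] := S0 _ (s0 _ e0); exists (T x), T.
  - rewrite (le_trans (TT _ _ _ _ (s0 _ e0) (s0 _ e0') ST ST'))// mulrDl.
    by rewrite lerD// sn.
  exists l => e e0 T ST; apply/ler_addgt0Pr => d d0.
  have d2 : 0 < d / 2 by lra.
  have [T' ST'] := S0 _ (s0 _ d2).
  have l1 : nrm (l - T' x) <= d / 2 by apply: lS => //; exists T'.
  have := nrm_triangle (T' x) l (T x); have := TT _ _ _ _ (s0 _ d2) e0 ST' ST.
  by rewrite mulrDl; have := sn _ d2; lra.
have [f fP] := choice pw.
have [T1 ST1] := S0 1 ltr01.
have lf : linear f.
  move=> a x y; apply/eqP; rewrite -subr_eq0; apply/eqP/nrm_small => d d0.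
  (* c collects the norms in the three-term estimate below, so that accuracy d / c suffices. *)
  pose c := nrm (a *: x + y) + cn a * nrm x + nrm y + 1.
  have c0 : 0 < c.
    by rewrite /c ltr_wpDl// !addr_ge0 ?mulr_ge0 ?nrm_ge0 ?cn_ge0.
  have e0 : 0 < d / c by rewrite divr_gt0.
  have [T ST] := S0 _ e0.
  rewrite [X in nrm X](_ : _ = (f (a *: x + y) - T (a *: x + y)) -
      (a *: (f x - T x) + (f y - T y))); last first.
    by rewrite bop_linear scalerBr addrACA -opprD opprB addrA subrK.
  rewrite (le_trans (nrmD _ _))// nrmN.
  have := nrmD (a *: (f x - T x)) (f y - T y); rewrite nrmZ.
  have := ler_wpM2l (cn_ge0 a) (fP x _ e0 _ ST).
  have := fP (a *: x + y) _ e0 _ ST; have := fP y _ e0 _ ST.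
  have dc : d / c * c = d by rewrite divfK// gt_eqF.
  rewrite -[X in _ -> _ -> _ -> _ -> _ <= X]dc.
  by move: e0; rewrite /c; move: (d / _) => e e0; lra.
have fM x : nrm (f x) <= (nrm T1 + 1) * nrm x.
  have := fP x 1 ltr01 _ ST1; have := nrm_bop T1 x.
  have := nrmD (f x - T1 x) (T1 x); rewrite subrK mulrDl; lra.
have [L LE] := bop_exists lf fM; exists L => e e0 T ST.
apply: nrm_bop_le; first exact: ltW.
by move=> x; rewrite [(L - T) x]/(L x - T x) LE; exact: fP.
Qed.

Lemma bop_complete H K (u : nat -> bop H K) :
  (forall e : R, 0 < e -> exists N, forall n k, (N <= n)%N -> (N <= k)%N ->
     nrm (u n - u k) <= e) ->
  exists L, forall e : R, 0 < e -> exists N, forall n, (N <= n)%N -> nrm (L - u n) <= e.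
Proof.
move=> uC; pose S (e : R) : set (bop H K) :=
  [set T | exists2 n, forall k, (n <= k)%N -> nrm (u n - u k) <= e & T = u n].
have [e e0|e e' _ _ e0 e0' [n nP ->] [m mP ->]|L LS] := @bop_net H K S.
- by have [N NP] := uC e e0; exists (u N), N => // k Nk; exact: NP.
- rewrite (le_trans (nrm_triangle (u (maxn n m)) _ _))// lerD//.
    by apply: nP; exact: leq_maxl.
  by rewrite nrmB; apply: mP; exact: leq_maxr.
exists L => e e0; have [N NP] := uC e e0; exists N => n Nn.
apply: LS => //; exists n => // k nk; apply: NP => //; exact: leq_trans nk.
Qed.

Lemma cauchy_bop H K (u : nat -> bop H K) : cauchy (u @ \oo) ->
  forall e : R, 0 < e -> exists N, forall n k, (N <= n)%N -> (N <= k)%N ->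
    nrm (u n - u k) <= e.
Proof.
move=> /cauchyP uC e e0; have [] := uC (e / 2)%:C; first by rewrite ltcR; lra.
move=> T [N _ NP]; exists N => n k Nn Nk.
have := NP n Nn; have := NP k Nk; rewrite /= !ballC.
move=> Tk Tn; rewrite (le_trans (nrm_triangle T _ _))// (nrmB (u n)) [e]splitr.
by rewrite lerD// ltW.
Qed.

Lemma cvg_bop H K (u : nat -> bop H K) L :
  (forall e : R, 0 < e -> exists N, forall n, (N <= n)%N -> nrm (L - u n) <= e) ->
  u @ \oo --> L.
Proof.
move=> uL; apply/cvg_ballP => e /posC[e0 ->].
have [|N NP] := uL (complex.Re e / 2); first by lra.
by exists N => // n /NP h; rewrite /= ballC; lra.
Qed.

Lemma closed_limit H K (A : set (bop H K)) (u : nat -> bop H K) L : closed_subspace A ->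
  (forall n, A (u n)) ->
  (forall e : R, 0 < e -> exists N, forall n, (N <= n)%N -> nrm (L - u n) <= e) -> A L.
Proof.
move=> /csubP[_ _ cA] uA uL; apply: cA; apply/closureE => e e0.
have [|N NP] := uL (e / 2); first by lra.
by exists (u N) => //; have := NP N (leqnn N); lra.
Qed.

End OperatorLimits.

(** * Square roots inside closed operator algebras *)

Section SquareRoots.
Variables (R : realType) (H : hilbertType R).
Implicit Types (A B Z : bop H H).

(** ||(1 - F^* F) x||^2 = ||x||^2 - 2 ||F x||^2 + ||F^* F x||^2, and the last term is at most ||F
    x||^2. *)
Lemma nrm_idsub_cstar K (F : bop H K) : nrm F <= 1 -> nrm (idop H - (adj F \ob F)) <= 1.
Proof.
move=> F1; apply: nrm_bop_le => // x; rewrite mul1r.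
rewrite -(@ler_pXn2r _ 2) ?nnegrE ?nrm_ge0//.
rewrite [(idop H - _) x]/(x - adj F (F x)) nrm_sqrB -adjP Re_inner_sqr.
have := nrm_bop (adj F) (F x); rewrite nrm_adj => h.
have : nrm (adj F (F x)) <= nrm (F x).
  by rewrite (le_trans h)// ler_piMl ?nrm_ge0.
have := nrm_ge0 (adj F (F x)); have := nrm_ge0 (F x); nra.
Qed.

(* The binomial series of 1 - sqrt (1 - B) as the iteration Z := (B + Z^2) / 2,
   majorized by the scalar iteration with B = 1, which increases to 1. *)
Lemma sqrt_id_sub (C : set (bop H H)) B : closed_subspace C ->
  (forall S T, C S -> C T -> C (S \ob T)) -> C (idop H) -> C B -> adj B = B -> nrm B <= 1 ->
  exists2 Z, C Z & adj Z = Z /\ Z \ob Z = idop H - B.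
Proof.
move=> cC CM C1 CB Bs B1; have [C0 Cl _] := (csubP C).1 cC.
have CD S T : C S -> C T -> C (S + T) by move=> CS CT; rewrite -[S]scale1r; exact: Cl.
have CZ a S : C S -> C (a *: S) by move=> CS; rewrite -[a *: S]addr0; exact: Cl.
pose h : R[i] := (2^-1)%:C.
have hE S : nrm (h *: S) = nrm S / 2 by rewrite nrmZ cnR gtr0_norm ?invr_gt0// mulrC.
have [Z [Z0 ZS]] : exists Z : nat -> bop H H, Z 0%N = 0 /\
    forall n, Z n.+1 = h *: (B + (Z n \ob Z n)).
  by exists (fun n => iter n (fun T => h *: (B + (T \ob T))) 0).
have [z [z0 zS]] : exists z : nat -> R, z 0%N = 0 /\ forall n, z n.+1 = (1 + z n ^+ 2) / 2.
  by exists (fun n => iter n (fun t => (1 + t ^+ 2) / 2) 0).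
have ZC n : C (Z n).
  by elim: n => [|n IH]; [rewrite Z0; exact: C0|rewrite ZS; apply: CZ; apply: CD => //; exact: CM].
have Zs n : adj (Z n) = Z n.
  elim: n => [|n IH]; first by rewrite Z0 adj0.
  by rewrite ZS adjZ adjD adjM IH Bs conjc_real.
have z01 n : 0 <= z n <= 1.
  by elim: n => [|n /andP[zn0 zn1]]; [rewrite z0 lexx ler01|rewrite zS; apply/andP; split; nra].
have Zn n : nrm (Z n) <= z n.
  elim: n => [|n IH]; first by rewrite Z0 z0 nrm0.
  rewrite ZS zS hE ler_pM2r ?invr_gt0// (le_trans (nrmD _ _))// lerD//.
  rewrite (le_trans (nrm_comp _ _))// expr2.
  by apply: ler_pM => //; exact: nrm_ge0.
(* Writing Z_(n+1)^2 - Z_n^2 as Z_(n+1) (Z_(n+1) - Z_n) + (Z_(n+1) - Z_n) Z_n bounds each operator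
   increment by the corresponding scalar increment. *)
have ZZ n : nrm (Z n.+1 - Z n) <= z n.+1 - z n.
  elim: n => [|n IH].
    by rewrite Z0 z0 !subr0 (Zn 1%N).
  have -> : z n.+2 - z n.+1 = (z n.+1 ^+ 2 - z n ^+ 2) / 2.
    by rewrite (zS n.+1) [in X in _ - X](zS n); field.
  have -> : Z n.+2 - Z n.+1 = h *: ((Z n.+1 \ob Z n.+1) - (Z n \ob Z n)).
    by rewrite (ZS n.+1) [in X in _ - X](ZS n) -scalerBr opprD addrACA subrr add0r.
  rewrite hE ler_pM2r ?invr_gt0//.
  have -> : (Z n.+1 \ob Z n.+1) - (Z n \ob Z n) =
      (Z n.+1 \ob (Z n.+1 - Z n)) + ((Z n.+1 - Z n) \ob Z n).
    by rewrite !compDr !compDl compNr compNl addrA subrK.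
  have z1 := z01 n; have z2 := z01 n.+1.
  have := nrmD (Z n.+1 \ob (Z n.+1 - Z n)) ((Z n.+1 - Z n) \ob Z n).
  have := nrm_comp (Z n.+1) (Z n.+1 - Z n); have := nrm_comp (Z n.+1 - Z n) (Z n).
  have := Zn n; have := Zn n.+1; move: IH.
  have := nrm_ge0 (Z n); have := nrm_ge0 (Z n.+1); have := nrm_ge0 (Z n.+1 - Z n).
  move: (nrm (Z n.+1 - Z n)) (nrm (Z n)) (nrm (Z n.+1)) => d p q d0 p0 q0 dz qz pz h1 h2 h3.
  have : d * p <= (z n.+1 - z n) * z n by apply: ler_pM.
  have : q * d <= z n.+1 * (z n.+1 - z n) by apply: ler_pM.
  by rewrite !expr2; lra.
have Zk n k : nrm (Z (n + k)%N - Z n) <= z (n + k)%N - z n.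
  elim: k => [|k IH]; first by rewrite addn0 !subrr nrm0.
  rewrite addnS (le_trans (nrm_triangle (Z (n + k)%N) _ _))//.
  by rewrite [X in _ <= X](_ : _ = (z (n + k).+1 - z (n + k)%N) + (z (n + k)%N - z n))
    ?lerD// addrA subrK.
have hz : has_sup [set z n | n in setT].
  by split; [exists (z 0%N), 0%N|exists 1 => _ [n _ <-]; case/andP: (z01 n)].
have zm n k : z n <= z (n + k)%N by have := Zk n k; have := nrm_ge0 (Z (n + k)%N - Z n); lra.
(* The increments are dominated by those of the bounded increasing sequence z, so an index N with
   z_N close to the supremum makes Z a Cauchy sequence. *)
have [e e0|L LP] := @bop_complete R H H Z.
  have e2 : 0 < e / 2 by lra.
  have [_ [N _ <-] zN] := sup_adherent e2 hz.
  exists N => n k Nn Nk.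
  have su m : z m <= sup [set z n | n in setT] by apply: sup_upper_bound => //; exists m.
  have Zm m : (N <= m)%N -> nrm (Z m - Z N) <= e / 2.
    by move=> /subnKC <-; have := Zk N (m - N)%N; have := su (N + (m - N))%N; lra.
  by rewrite (le_trans (nrm_triangle (Z N) _ _))// (nrmB (Z N)) [e]splitr lerD// Zm.
have Ls : adj L = L.
  apply/eqP; rewrite -subr_eq0; apply/eqP/nrm_small => e e0.
  have [|N NP] := LP (e / 2); first by lra.
  have := NP N (leqnn N) => LN.
  have : nrm (adj L - adj (Z N)) <= e / 2 by rewrite -adjB nrm_adj.
  rewrite Zs => LN'; rewrite (le_trans (nrm_triangle (Z N) _ _))// (nrmB (Z N)) [e]splitr.
  exact: lerD LN' LN.
have LE : L = h *: (B + (L \ob L)).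
  apply/eqP; rewrite -subr_eq0; apply/eqP/nrm_small => e e0.
  have m0 : 0 < nrm L + 2 by have := nrm_ge0 L; lra.
  have [|N NP] := LP (e / (nrm L + 2)); first by rewrite divr_gt0.
  have a1 := NP N.+1 (leqnSn N); have a2 := NP N (leqnn N).
  rewrite (le_trans (nrm_triangle (Z N.+1) _ _))//.
  have : nrm (Z N.+1 - h *: (B + (L \ob L))) <= e / (nrm L + 2) * (nrm L + 1).
    rewrite ZS -scalerBr hE opprD addrACA subrr add0r.
    have -> : (Z N \ob Z N) - (L \ob L) = ((Z N - L) \ob Z N) + (L \ob (Z N - L)).
      by rewrite !compDr !compDl compNr compNl addrA subrK.
    have := nrmD ((Z N - L) \ob Z N) (L \ob (Z N - L)).
    have := nrm_comp (Z N - L) (Z N); have := nrm_comp L (Z N - L).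
    have := Zn N; have /andP[_ z1] := z01 N; rewrite nrmB in a2.
    move: a2; have := nrm_ge0 L; have := nrm_ge0 (Z N); have := nrm_ge0 (Z N - L).
    by move: (e / _) => d; nra.
  have : e = e / (nrm L + 2) * (nrm L + 2) by rewrite divfK// gt_eqF.
  by move: (e / _) a1 => d; have := nrm_ge0 L; nra.
have CL : C L by apply: (closed_limit cC ZC LP).
(* The limit satisfies 2 L = B + L^2, that is, (1 - L)^2 = 1 - B. *)
exists (idop H - L); first by rewrite -scaleN1r; apply: CD => //; exact: CZ.
split; first by rewrite adjB adj1 Ls.
have e2 : L + L = B + (L \ob L).
  rewrite {1 2}LE -scalerDl -rmorphD /=.
  by rewrite [(2^-1 + 2^-1)](_ : _ = 1) ?scale1r//; field.
rewrite compDl !compDr !compNl !compNr comp1op compop1 comp1op.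
have -> : B = L + L - (L \ob L) by rewrite e2 addrK.
by rewrite !opprD !opprK !addrA.
Qed.

(** With F the multiple of f of norm 1, [sqrt_id_sub] is applied to 1 - F^* F and the root is scaled
    back. It stays in the closed unital algebra [C]; for the endomorphisms of a representation it is
    therefore a morphism. *)
Lemma cstar_sqrt (C : set (bop H H)) K (f : bop H K) : closed_subspace C ->
  (forall S T, C S -> C T -> C (S \ob T)) -> C (idop H) -> C (adj f \ob f) ->
  exists2 g, C g & adj f \ob f = adj g \ob g.
Proof.
move=> cC CM C1 Cf; have [C0 Cl _] := (csubP C).1 cC.
have [f0|f0] := eqVneq (nrm f) 0.
  exists 0 => //; rewrite (nrm_eq0 f0); apply: bopP => x.
  by rewrite /= !linear0.
have np : 0 < nrm f by rewrite lt_neqAle eq_sym f0 nrm_ge0.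
pose c : R[i] := ((nrm f)^-1)%:C; pose F := c *: f.
have FE : adj F \ob F = (c * c) *: (adj f \ob f).
  by rewrite /F adjZ conjc_real compZl compZr scalerA.
have [Z CZ [Zs ZE]] : exists2 Z, C Z & adj Z = Z /\ Z \ob Z = idop H - (idop H - (adj F \ob F)).
  apply: sqrt_id_sub => //.
  - rewrite FE addrC -[idop H]addr0 -scaleNr; apply: (Cl _ _ _ Cf).
    by rewrite addr0.
  - by rewrite adjB adj1 adjM adjK.
  - apply: nrm_idsub_cstar; rewrite /F nrmZ cnR ger0_norm ?invr_ge0 ?nrm_ge0//.
    by rewrite mulVf.
exists ((nrm f)%:C *: Z); first by rewrite -[_ *: Z]addr0; exact: Cl.
rewrite adjZ conjc_real Zs compZl compZr scalerA ZE opprB addrC subrK FE scalerA.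
rewrite -!rmorphM /= [_ * _ * _](_ : _ = 1) ?scale1r//.
by field.
Qed.

End SquareRoots.

(** * Norm-closed morphism spaces and the two tensor categories *)

Section RepCstar.
Variables (R : realType) (M : cpmu R).
Notation b := (mb M).
Notation E := (bK b).
Notation alpha := (malpha M).
Notation beta := (mbeta M).
Notation H := (mH M).
Implicit Types X Y Z : rep_data M.

Lemma comp0op (F K L : hilbertType R) (S : bop F K) : (0 : bop K L) \ob S = 0.
Proof. by rewrite -[0 in LHS](scale0r 0) compZl scale0r. Qed.

Lemma compop0 (F K L : hilbertType R) (S : bop K L) : S \ob (0 : bop F K) = 0.
Proof. by rewrite -[0 in LHS](scale0r 0) compZr scale0r. Qed.

Lemma semi_closed F K L (a : set (bop F K)) (c : set (bop F L)) (T : bop K L) :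
  closed_subspace c ->
  (forall e : R, 0 < e -> exists2 S : bop K L, semimorphism a c S & nrm (T - S) < e) ->
  semimorphism a c T.
Proof.
move=> /csubP[_ _ cc] TS _ [xi ax <-]; apply: cc; apply/closureE => e e0.
have n1 : 0 < nrm xi + 1 by have := nrm_ge0 xi; lra.
have [|S sS TSe] := TS (e / (nrm xi + 1)); first by rewrite divr_gt0.
exists (S \ob xi); first by apply: sS; exists xi.
rewrite -compNl -compDl (le_lt_trans (nrm_comp _ _))//.
rewrite -[ltRHS](divfK (lt0r_neq0 n1)).
rewrite (@le_lt_trans _ _ (e / (nrm xi + 1) * nrm xi))//.
  by rewrite ler_wpM2r ?nrm_ge0// ltW.
by rewrite ltr_pM2l ?divr_gt0// ltrDl.
Qed.

Lemma divD1_mul_le (e c : R) : 0 < e -> 0 <= c -> e / (c + 1) * c <= e.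
Proof. by move=> e0 c0; rewrite mulrAC ler_pdivrMr ?ler_pM2l//; lra. Qed.

(** Each defining condition survives norm limits; for the intertwining relation this rests on
    [nrm_tens_op], through which T tensored with the identity depends continuously on T. *)
Lemma rep_morphism_closed X Y : is_rep X -> is_rep Y -> closed_subspace (rep_morphism X Y).
Proof.
move=> repX repY.
have bf := base_facts_cpmu M; have ma : modk true alpha := bf_a bf.
have mb : modk false beta := bf_b bf.
have [mg md _ _ _ _ _ _ _] := (is_repP X).1 repX.
have [mg' md' _ _ _ _ _ _ _] := (is_repP Y).1 repY.
have cg := mod_closed mg; have cd := mod_closed md.
have cg' := mod_closed mg'; have cd' := mod_closed md'.
have siE (F G : hilbertType R) (a : set (bop F G)) := @semi_id R F G a.
have lin (a : R[i]) S T : rep_morphism X Y S -> rep_morphism X Y T ->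
    rep_morphism X Y (a *: S + T).
  move=> [[sg sg'] [sd sd'] iS] [[tg tg'] [td td'] iT].
  have lg : semimorphism (rgamma X) (rgamma Y) (a *: S + T) by exact: semiDZ.
  have ld : semimorphism (rhdelta X) (rhdelta Y) (a *: S + T) by exact: semiDZ.
  split; [split=> //; rewrite adjD adjZ; exact: semiDZ..|].
  move: iS iT; rewrite !intertwinerE// => iS iT.
  rewrite tens_op_linear_l//; try mk; rewrite tens_op_linear_l//; try mk.
  by rewrite compDr compZr iS iT compDl compZl.
have m0 : rep_morphism X Y 0.
  have s0 (F K L : hilbertType R) (a : set (bop F K)) (c : set (bop F L)) : closed_subspace c ->
      semimorphism a c (0 : bop K L).
    by move=> /csubP[c0 _ _] _ [xi _ <-]; rewrite comp0op.
  have sg0 := s0 _ _ _ (rgamma X) _ cg'; have sd0 := s0 _ _ _ (rhdelta X) _ cd'.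
  split; [split=> //; rewrite adj0; exact: s0..|].
  rewrite intertwinerE//.
  (* The value of [tens_op] at 0 is read off from linearity, with 0 written as - 0 + 0. *)
  have t0 (K K' L : hilbertType R) (a : set (bop E K)) (a' : set (bop E K')) (c : set (bop E L)) :
      compat a c -> compat a' c -> semimorphism a a' (0 : bop K K') ->
      tens_op a c a' c (0 : bop K K') (idop L) = 0.
    move=> c1 c2 sa; rewrite -[0 in LHS](addNr (0 : bop K K')) -scaleN1r.
    by rewrite tens_op_linear_l// scaleN1r addNr.
  by rewrite !t0 ?compop0 ?comp0op//; mk.
apply/csubP; split=> // T /closureE cT.
have cT' e : 0 < e -> exists2 S, rep_morphism X Y S & nrm (T - S) < e by exact: cT.
have tg : semimorphism (rgamma X) (rgamma Y) T.
  by apply: semi_closed => // e /cT'[S [[? _] _ _] h]; exists S.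
have td : semimorphism (rhdelta X) (rhdelta Y) T.
  by apply: semi_closed => // e /cT'[S [_ [? _] _] h]; exists S.
have tg' : semimorphism (rgamma Y) (rgamma X) (adj T).
  apply: semi_closed => // e /cT'[S [[_ ?] _ _] h]; exists (adj S) => //.
  by rewrite -adjB nrm_adj.
have td' : semimorphism (rhdelta Y) (rhdelta X) (adj T).
  apply: semi_closed => // e /cT'[S [_ [_ ?] _] h]; exists (adj S) => //.
  by rewrite -adjB nrm_adj.
split=> //; rewrite intertwinerE//.
apply/eqP; rewrite -subr_eq0; apply/eqP/nrm_small => e e0.
(* A Lipschitz constant for the difference of the two sides of the intertwining relation as a
   function of T; below, c + 1 avoids division by 0. *)
pose c := (nrm (rX X) + nrm (rX Y)) * nrm (idop H).
have c0 : 0 <= c by rewrite mulr_ge0 ?addr_ge0 ?nrm_ge0.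
have [|S mS TS] := cT' (e / (c + 1)); first by rewrite divr_gt0//; lra.
have [[sg _] [sd _]] := mS; rewrite intertwinerE// => iS.
have tB (K K' L : hilbertType R) (a : set (bop E K)) (a' : set (bop E K')) (d : set (bop E L)) (A B : bop K K') :
    compat a d -> compat a' d -> closed_subspace a' ->
    semimorphism a a' A -> semimorphism a a' B ->
    nrm (tens_op a d a' d A (idop L) - tens_op a d a' d B (idop L)) <= nrm (A - B) * nrm (idop L).
  move=> c1 c2 ca sA sB.
  rewrite addrC -scaleN1r -tens_op_linear_l// scaleN1r addrC.
  apply: nrm_tens_op => //; rewrite addrC -scaleN1r; exact: semiDZ.
have {iS} -> : rX Y \ob tens_op (rhdelta X) alpha (rhdelta Y) alpha T (idop H) -
    (tens_op (rgamma X) beta (rgamma Y) beta T (idop H) \ob rX X) =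
    (rX Y \ob (tens_op (rhdelta X) alpha (rhdelta Y) alpha T (idop H) -
               tens_op (rhdelta X) alpha (rhdelta Y) alpha S (idop H))) -
    ((tens_op (rgamma X) beta (rgamma Y) beta T (idop H) -
      tens_op (rgamma X) beta (rgamma Y) beta S (idop H)) \ob rX X).
  by rewrite compDr compNr compDl compNl iS opprB addrA subrK.
rewrite (le_trans (nrmD _ _))// nrmN.
have h1 := tB _ _ _ (rhdelta X) (rhdelta Y) alpha T S.
have h2 := tB _ _ _ (rgamma X) (rgamma Y) beta T S.
apply: (@le_trans _ _ (nrm (T - S) * c)).
  rewrite /c mulrCA [X in _ <= X]mulrDl [X in _ <= X]addrC lerD//.
    rewrite (le_trans (nrm_comp _ _))// ler_wpM2l ?nrm_ge0//.
    by apply: h1 => //; mk.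
  rewrite (le_trans (nrm_comp _ _))// mulrC ler_wpM2l ?nrm_ge0//.
  by apply: h2 => //; mk.
rewrite (@le_trans _ _ (e / (c + 1) * c))//; first by rewrite ler_wpM2r// ltW.
exact: divD1_mul_le.
Qed.

Lemma rep_s_tensor_category : is_tensor_category
  (@TensorData (rep_s M) (@box R M) (@box_op R M) (triv_rep M)
     (@box_assoc R M) (@box_unit_l R M) (@box_unit_r R M)).
Proof.
(* The inverse is the adjoint. Among semi-morphisms this asks that the adjoint respect the
   structures as well, so the coherence unitaries enter as morphisms in the strict sense. *)
have iso X Y (U : bop (rK X) (rK Y)) : is_rep X -> is_rep Y -> unitary_op U ->
    rep_morphism X Y U -> is_iso (rep_s M) X Y U.
  move=> rX rY [U1 U2] mU; split; first exact: rep_morphism_semi.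
  by exists (adj U) => //; apply: rep_morphism_semi; exact: rep_morphism_adj.
split=> /=.
- split=> /=.
  + exact: rep_semimorphism_id.
  + move=> X Y Z f g rX rY rZ; exact: rep_semimorphism_comp.
  + by move=> *; rewrite comp1op.
  + by move=> *; rewrite compop1.
  + by move=> *; rewrite compopA.
- exact: box_is_rep.
- exact: triv_is_rep.
- exact: box_op_semimorphism.
- exact: box_op_id.
- exact: box_op_comp.
- move=> X Y Z rX rY rZ; apply: iso; [by do !apply: box_is_rep|by do !apply: box_is_rep| |].
    exact: box_assoc_unitary.
  exact: box_assoc_morphism.
- move=> X rX; apply: iso => //; first by apply: box_is_rep => //; exact: triv_is_rep.
    exact: box_unit_l_unitary.
  exact: box_unit_l_morphism.
- move=> X rX; apply: iso => //; first by apply: box_is_rep => //; exact: triv_is_rep.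
    exact: box_unit_r_unitary.
  exact: box_unit_r_morphism.
- exact: box_assoc_natural.
- exact: box_unit_l_natural.
- exact: box_unit_r_natural.
- exact: box_pentagon.
- exact: box_triangle.
Qed.

Lemma cstar_rep_cstar_category : is_cstar_category (cstar_rep M).
Proof.
have cat : is_category (cstar_rep M).
  split=> /=.
  + exact: rep_morphism_id.
  + move=> X Y Z f g rX rY rZ; exact: rep_morphism_comp.
  + by move=> *; rewrite comp1op.
  + by move=> *; rewrite compop1.
  + by move=> *; rewrite compopA.
split=> //=.
- by move=> X Y rX rY; have [] := rep_morphism_closed rX rY.
- move=> X Y rX rY u mu /cauchy_bop/bop_complete[f uf]; exists f; last exact: cvg_bop.
  exact: (closed_limit (rep_morphism_closed rX rY) mu uf).
- by move=> *; rewrite compDl compZl.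
- by move=> *; rewrite compDr compZr.
- by move=> X Y Z f g _ _ _ _ _; rewrite !nrmE -rmorphM lecR; exact: nrm_comp.
- exact: rep_morphism_adj.
- by move=> *; rewrite adjD adjZ.
- by move=> *; rewrite adjK.
- by move=> *; rewrite adjM.
- by move=> X Y f _ _ _; rewrite !nrmE -rmorphXn; congr (_%:C); exact: nrm_cstar.
move=> X Y f rX rY mf.
apply: (@cstar_sqrt _ _ (rep_morphism X X)); first exact: rep_morphism_closed.
- by move=> S T mS mT; exact: (rep_morphism_comp rX rX rX mT mS).
- exact: rep_morphism_id.
- exact: (rep_morphism_comp rX rY rX mf (rep_morphism_adj rX rY mf)).
Qed.

Lemma cstar_rep_cstar_tensor_category : is_cstar_tensor_category
  (@TensorData (cstar_rep M) (@box R M) (@box_op R M) (triv_rep M)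
     (@box_assoc R M) (@box_unit_l R M) (@box_unit_r R M)).
Proof.
have bf := base_facts_cpmu M.
have semi := rep_morphism_semi.
have iso X Y (U : bop (rK X) (rK Y)) : is_rep X -> is_rep Y -> unitary_op U ->
    rep_morphism X Y U -> is_iso (cstar_rep M) X Y U.
  by move=> rX rY [U1 U2] mU; split=> //; exists (adj U) => //; exact: rep_morphism_adj.
split; first exact: cstar_rep_cstar_category.
- split=> /=.
  + by case: cstar_rep_cstar_category.
  + exact: box_is_rep.
  + exact: triv_is_rep.
  + exact: box_op_morphism.
  + exact: box_op_id.
  + move=> X X' X'' Y Y' Y'' f f' g g' rX rX' rX'' rY rY' rY'' mf mf' mg mg'.
    by apply: box_op_comp => //; exact: semi.
  + move=> X Y Z rX rY rZ; apply: iso; [by do !apply: box_is_rep|by do !apply: box_is_rep| |].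
      exact: box_assoc_unitary.
    exact: box_assoc_morphism.
  + move=> X rX; apply: iso => //; first by apply: box_is_rep => //; exact: triv_is_rep.
      exact: box_unit_l_unitary.
    exact: box_unit_l_morphism.
  + move=> X rX; apply: iso => //; first by apply: box_is_rep => //; exact: triv_is_rep.
      exact: box_unit_r_unitary.
    exact: box_unit_r_morphism.
  + move=> X X' Y Y' Z Z' f g h rX rX' rY rY' rZ rZ' mf mg mh.
    by apply: box_assoc_natural => //; exact: semi.
  + by move=> X Y f rX rY mf; apply: box_unit_l_natural => //; exact: semi.
  + by move=> X Y f rX rY mf; apply: box_unit_r_natural => //; exact: semi.
  + exact: box_pentagon.
  + exact: box_triangle.
- move=> /= X X' Y Y' a f f' g /is_repP[mg md _ _ _ _ _ _ _] /is_repP[mg' md' _ _ _ _ _ _ _].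
  move=> /is_repP[me mp _ _ _ _ _ _ _] /is_repP[me' mp' _ _ _ _ _ _ _].
  by move=> [_ [? _] _] [_ [? _] _] [[? _] _ _]; apply: tens_op_linear_l => //; mk.
- move=> /= X X' Y Y' a f g g' /is_repP[mg md _ _ _ _ _ _ _] /is_repP[mg' md' _ _ _ _ _ _ _].
  move=> /is_repP[me mp _ _ _ _ _ _ _] /is_repP[me' mp' _ _ _ _ _ _ _].
  by move=> [_ [? _] _] [[? _] _ _] [[? _] _ _]; apply: tens_op_linear_r => //; mk.
- move=> /= X X' Y Y' f g /is_repP[mg md _ _ _ _ _ _ _] /is_repP[mg' md' _ _ _ _ _ _ _].
  move=> /is_repP[me mp _ _ _ _ _ _ _] /is_repP[me' mp' _ _ _ _ _ _ _].
  by move=> [_ ? _] [? _ _]; apply: adj_tens_op => //; mk.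
- exact: box_assoc_unitary.
- exact: box_unit_l_unitary.
- exact: box_unit_r_unitary.
Qed.

End RepCstar.

Theorem theorem4p4 (R : realType) (M : cpmu R) :
  is_cstar_tensor_category
    (@TensorData (cstar_rep M) (@box R M) (@box_op R M) (triv_rep M)
       (@box_assoc R M) (@box_unit_l R M) (@box_unit_r R M))
  /\
  is_tensor_category
    (@TensorData (rep_s M) (@box R M) (@box_op R M) (triv_rep M)
       (@box_assoc R M) (@box_unit_l R M) (@box_unit_r R M)).
Proof.
split; [exact: cstar_rep_cstar_tensor_category|exact: rep_s_tensor_category].
Qed.
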